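(* Let $g:\mathbb{R}\times\mathcal{P}_2(\mathbb{R})\to\mathbb{R}$ satisfy assumptions (A1)–(A5) listed in the context. For $\varepsilon>0$ let $\hat\alpha^\varepsilon=(\hat\alpha^\varepsilon_t)_{0\le t\le T}$ denote the solution of the $\varepsilon$-MFG with initial state $\xi_0$, let $\hat\alpha^0$ denote the solution of the $0$-MFG with the same initial state, and let $(U_t,V_t,Q_t,\tilde Q_t)_{0\le t\le T}$ denote the solution of the linear variational FBSDE $$dU_t=-V_t\,dt+d\tilde W_t,\qquad dV_t=Q_t\,dW_t+\tilde Q_t\,d\tilde W_t,$$ $$U_0=0,\qquad V_T=\partial^2_{xx}g(X^0_T,m^0_T)\,U_T+\hat{\mathbb{E}}^0\big[\partial^2_{xm}g(X^0_T,m^0_T)(\hat X^0_T)\,\hat U_T\big],$$ where $X^0=X^{0,\hat\alpha^0}$ is the state process of the $0$-MFG solution and $m^0_t=\mathcal L(X^0_t)$. Define the first order approximate strategy $\beta^\varepsilon=(\beta^\varepsilon_t)_{0\le t\le T}$ by $$\beta^\varepsilon_t=\hat\alpha^0_t-\varepsilon V_t .$$ Then $\beta^\varepsilon$ is an $\varepsilon^2$-Nash equilibrium for the $\varepsilon$-MFG, that is, $$\mathcal J^\varepsilon(\beta^\varepsilon\,|\,m^{\varepsilon,\beta^\varepsilon})\le\mathcal J^\varepsilon(\alpha\,|\,m^{\varepsilon,\beta^\varepsilon})+\varepsilon^2\qquad\text{for all }\alpha\in\mathcal H^2([0,T];\mathbb R).$$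
   Context: Setup. Fix $T>0$ and a constant $\sigma$. $W$ and $\tilde W$ are independent real Brownian motions (individual noise and common noise) on a complete filtered probability space $(\Omega,\mathcal F,(\mathcal F_t)_{0\le t\le T},\mathbb P)$ of the product form $(\Omega^0\times\tilde\Omega,\mathcal F^0\otimes\tilde{\mathcal F},\mathbb P^0\otimes\tilde{\mathbb P})$, where $(\tilde\Omega,\tilde{\mathcal F},\tilde{\mathbb P})$ is the canonical space of $\tilde W$, and all other randomness ($W$ and the initial state) is carried by $(\Omega^0,\mathcal F^0,\mathbb P^0)$. $\tilde{\mathcal F}_t=\sigma(\tilde W_s;0\le s\le t)$. $\mathcal L(\xi)$ denotes the law of $\xi$ and $\mathcal L(\xi|\mathcal G)$ its conditional law. $\mathscr L^2_{\mathcal G}$ is the set of $\mathcal G$-measurable real square-integrable random variables, with norm $\|\cdot\|_2$. $\xi_0\in\mathscr L^2_{\mathcal F_0}$ is the given initial state. $\mathcal P_2(\mathbb R)$ is the space of Borel probability measures on $\mathbb R$ with finite second moment, with the 2-Wasserstein metric $\mathcal W_2$. $\mathcal H^2([0,T];\mathbb R)$ is the set of $(\mathcal F_t)$-progressively measurable processes $\alpha$ with $\mathbb E\int_0^T\alpha_t^2\,dt<\infty$ (admissible controls). The game. For $\varepsilon\ge0$ and $\alpha\in\mathcal H^2([0,T];\mathbb R)$ the state process is $X^{\varepsilon,\alpha}_t=\xi_0+\int_0^t\alpha_s\,ds+\sigma W_t+\varepsilon\tilde W_t$ and $m^{\varepsilon,\alpha}_t=\mathcal L(X^{\varepsilon,\alpha}_t|\tilde{\mathcal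 F}_t)$. For a continuous $\tilde{\mathcal F}_t$-adapted $\mathcal P_2(\mathbb R)$-valued flow $m$, the cost is $$\mathcal J^\varepsilon(\alpha|m)=\mathbb E\Big[\int_0^T\frac{\alpha_t^2}{2}\,dt+g(X^{\varepsilon,\alpha}_T,m_T)\Big].$$ A solution of the $\varepsilon$-MFG is $\hat\alpha\in\mathcal H^2([0,T];\mathbb R)$ with $\mathcal J^\varepsilon(\hat\alpha|m^{\varepsilon,\hat\alpha})\le\mathcal J^\varepsilon(\alpha|m^{\varepsilon,\hat\alpha})$ for all $\alpha\in\mathcal H^2([0,T];\mathbb R)$. A control $\alpha\in\mathcal H^2([0,T];\mathbb R)$ is a $\delta$-Nash equilibrium for the $\varepsilon$-MFG if $\mathcal J^\varepsilon(\alpha|m^{\varepsilon,\alpha})\le\mathcal J^\varepsilon(\beta|m^{\varepsilon,\alpha})+\delta$ for all $\beta\in\mathcal H^2([0,T];\mathbb R)$. Under (A1)–(A4) the $\varepsilon$-MFG has a unique solution $\hat\alpha^\varepsilon$ (known), given by $\hat\alpha^\varepsilon_t=-Y^\varepsilon_t$, where $(X^\varepsilon,Y^\varepsilon,Z^\varepsilon,\tilde Z^\varepsilon)$ is the unique solution of $dX_t=-Y_t\,dt+\sigma\,dW_t+\varepsilon\,d\tilde W_t$, $dY_t=Z_t\,dW_t+\tilde Z_t\,d\tilde W_t$, $X_0=\xi_0$, $Y_T=\partial_xg(X_T,\mathcal L(X_T|\tilde{\mathcal F}_T))$. $X^0$ does not depend on $\tilde\omega\in\tilde\Omega$. Under (A1)–(A5)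 the linear variational FBSDE has a unique adapted square-integrable solution. Derivative in the measure argument. For $F:\mathcal P_2(\mathbb R)\to\mathbb R$, the lift is $\tilde F(X)=F(\mathcal L(X))$ on $L^2(\hat\Omega)$, with $\hat\Omega$ an atomless Polish probability space. $F$ is differentiable at $m_0$ if $\tilde F$ is Fréchet differentiable at some $X_0$ with $\mathcal L(X_0)=m_0$; the derivative $\partial_mF(m_0)$ is the ($m_0$-a.e. unique) measurable function $\mathbb R\to\mathbb R$ in $L^2_{m_0}$ such that $F(\mathcal L(X_0+Y))-F(\mathcal L(X_0))-\hat{\mathbb E}[\partial_mF(m_0)(X_0)Y]=o(\|Y\|_2)$ as $Y\to0$ for every $X_0$ with law $m_0$, where $\hat{\mathbb E}$ is expectation on $\hat\Omega$. $\partial^2_{xm}g(x,m)(z)=\partial^2_{mx}g(x,m)(z)$ is the derivative in this sense of $m\mapsto\partial_xg(x,m)$, evaluated at $z$. Hat notation. $(\hat\Omega^0,\hat{\mathcal F}^0,\hat{\mathbb P}^0)$ is a copy of $(\Omega^0,\mathcal F^0,\mathbb P^0)$; for a random variable $\xi$ on $\Omega^0\times\tilde\Omega$, $\hat\xi$ is its copy on $\hat\Omega^0\times\tilde\Omega$ (same common noise), and $\hat{\mathbb E}^0$ is expectation over $\hat\omega^0\in\hat\Omega^0$ only. Thus $\hat{\mathbb{E}}^0[\partial^2_{xm}g(X^0_T,m^0_T)(\hat X^0_T)\hat U_T](\omega^0,\tilde\omega)=\int_{\Omega^0}\partial^2_{xm}g(X^0_T(\omega^0),m^0_T)(X^0_T(\hat\omega^0))\,U_T(\hat\omega^0,\tilde\omega)\,d\mathbb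 P^0(\hat\omega^0)$. (The hat on $\hat\alpha^\varepsilon$ is unrelated to this copy notation.) Assumptions on $g$ (for some constant $K$). (A1) $\partial_xg$ exists and $|\partial_xg(x,m)-\partial_xg(x',m)|\le K|x-x'|$ for all $x,x'\in\mathbb R$, $m\in\mathcal P_2(\mathbb R)$. (A2) $(\partial_xg(x,m)-\partial_xg(x',m))(x-x')\ge0$ for all $x,x',m$. (A3) $|\partial_xg(x,m)-\partial_xg(x,m')|\le K\mathcal W_2(m,m')$ for all $x,m,m'$. (A4) (weak monotonicity) $\int_{\mathbb R^2}(\partial_xg(x,m)-\partial_xg(y,m'))(x-y)\,\gamma(dx,dy)\ge0$ for all $m,m'\in\mathcal P_2(\mathbb R)$ and all $\gamma\in\mathcal P_2(\mathbb R^2)$ with marginals $m,m'$. (A5) $\partial_xg$ is differentiable in $(x,m)$ with bounded and Lipschitz continuous derivatives, the bound and the Lipschitz constant being the same $K$; specifically, for the mixed derivative, for all $x$, $m,m'$ and $\xi,\xi'\in\mathscr L^2_{\mathcal F}$ with laws $m,m'$: $\mathbb E[\partial^2_{mx}g(x,m)(\xi)^2]^{1/2}\le K$ and $\mathbb E[(\partial^2_{mx}g(x,m)(\xi)-\partial^2_{mx}g(x,m')(\xi'))^2]^{1/2}\le K\|\xi-\xi'\|_2$.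
   Formalization: The claim fails for large ε; what is proved is that β^ε is an ε²-Nash equilibrium for all 0<ε<ε₀, and a Cε²-Nash equilibrium for every ε>0, with C and ε₀ depending on the game but not on ε; terminal costs are assumed integrable so that J^ε is a real number. *)

(* Defs.v *)
From HB Require Import structures.
From mathcomp Require Import all_boot all_order all_algebra.
From mathcomp Require Import all_classical all_reals all_analysis.

Set Implicit Arguments.
Unset Strict Implicit.
Unset Printing Implicit Defensive.

Import Order.TTheory GRing.Theory Num.Theory.
Import numFieldNormedType.Exports.

Local Open Scope classical_set_scope.
Local Open Scope ring_scope.

Section laws.
Context {R : realType}.

Record P2 := MkP2 {
  P2_prob :> probability (measurableTypeR R) R ;
  P2_moment2 : (\int[P2_prob]_x (x ^+ 2)%:E < +oo)%E }.

Definition has_law d (Omega : measurableType d) (P : probability Omega R)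
    (X : Omega -> R) (m : P2) : Prop :=
  forall C : set R, measurable C -> m C = P (X @^-1` C).

Definition norm2 d (Omega : measurableType d) (P : probability Omega R)
    (X : Omega -> R) : \bar R := ('N[P]_(2%:E)[EFin \o X])%E.

Definition L2 d (Omega : measurableType d) (P : probability Omega R)
    (X : Omega -> R) : Prop :=
  measurable_fun setT X /\ (norm2 P X < +oo)%E.

(* Any coupling of two elements of P2 has a finite second moment. *)
Definition coupling (m m' : P2) :
    set (probability (measurableTypeR R * measurableTypeR R)%type R) :=
  [set gam | forall C : set R, measurable C ->
     gam (C `*` setT) = m C /\ gam (setT `*` C) = m' C].

Definition W2 (m m' : P2) : R :=
  Num.sqrt (fine (ereal_inf
    [set (\int[gam]_z ((z.1 - z.2) ^+ 2)%:E)%E | gam in coupling m m'])).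

(* The atomless Polish probability space carrying the lifts: the real line with
   the uniform law on [0, 1]. *)
Definition Phat : probability (measurableTypeR R) R :=
  uniform_prob (@ltr01 R).

(* [D] is (a version of) the derivative of [F] at [m0]: the expansion of the
   lift holds at every [X0] of law [m0]; [X0 + Y] is square integrable because
   its law [m1] is in P2. *)
Definition is_measure_derivative (F : P2 -> R) (m0 : P2) (D : R -> R) : Prop :=
  [/\ measurable_fun setT D,
      (\int[m0]_x ((D x) ^+ 2)%:E < +oo)%E &
      forall X0 : R -> R, measurable_fun setT X0 -> has_law Phat X0 m0 ->
      forall e : R, 0 < e -> exists2 del : R, 0 < del &
      forall (Y : R -> R) (m1 : P2),
        measurable_fun setT Y -> (norm2 Phat Y <= del%:E)%E ->
        has_law Phat (fun w => X0 w + Y w)%R m1 ->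
        `|F m1 - F m0 - \int[Phat]_w (D (X0 w) * Y w)|
          <= e * fine (norm2 Phat Y)].

End laws.
Arguments P2 R : clear implicits.

Section terminal_cost.
Context {R : realType}.
Variables (K : R) (g : R -> P2 R -> R).

Definition dx (x : R) (m : P2 R) : R := derive1 (fun y => g y m) x.
Definition dxx (x : R) (m : P2 R) : R := derive1 (fun y => dx y m) x.

Definition A1 : Prop :=
  (forall x m, derivable (fun y => g y m) x 1) /\
  (forall x x' m, `|dx x m - dx x' m| <= K * `|x - x'|).

Definition A2 : Prop :=
  forall x x' m, 0 <= (dx x m - dx x' m) * (x - x').

Definition A3 : Prop :=
  forall x m m', `|dx x m - dx x m'| <= K * W2 m m'.

Definition A4 : Prop :=
  forall m m' gam, coupling m m' gam ->
  (0 <= \int[gam]_z (((dx z.1 m - dx z.2 m') * (z.1 - z.2))%:E))%E.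

(* [dxm x m z] stands for the mixed derivative at [(x, m)] evaluated at [z]; it
   is only determined up to [m]-null sets of [z], so a version is given. *)
Definition A5 d (Omega : measurableType d) (P : probability Omega R)
    (dxm : R -> P2 R -> R -> R) : Prop :=
  [/\ forall x m, derivable (fun y => dx y m) x 1,
      forall x m, `|dxx x m| <= K,
      forall x x' m m', `|dxx x m - dxx x' m'| <= K * (`|x - x'| + W2 m m'),
      forall x m, is_measure_derivative (fun m' => dx x m') m (dxm x m) &
      forall (x : R) (m m' : P2 R) (xi xi' : Omega -> R),
        L2 P xi -> L2 P xi' -> has_law P xi m -> has_law P xi' m' ->
        (norm2 P (fun w => dxm x m (xi w)) <= K%:E)%E /\
        (norm2 P (fun w => dxm x m (xi w) - dxm x m' (xi' w))%R
           <= K%:E * norm2 P (fun w => xi w - xi' w)%R)%E].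

End terminal_cost.

(* C([0, T]) with paths issued from 0; a path is extended to the whole line by
   its values at 0 and T, so that it is determined by its restriction. *)
Record path_space (R : realType) (T : R) := MkPath {
  path_val :> R -> R ;
  path_continuous : continuous path_val ;
  path_start : path_val 0 = 0 ;
  path_stopped : forall t, path_val t = path_val (Num.min T (Num.max 0 t)) }.

Definition zero_path (R : realType) (T : R) : path_space T :=
  @MkPath R T (fun=> 0) (fun x => @cst_continuous R R 0 x) erefl (fun=> erefl).

HB.instance Definition _ (R : realType) (T : R) := gen_eqMixin (path_space T).
HB.instance Definition _ (R : realType) (T : R) :=
  gen_choiceMixin (path_space T).
HB.instance Definition _ (R : realType) (T : R) :=
  isPointed.Build (path_space T) (@zero_path R T).

Section canonical_space.
Variables (R : realType) (T : R).

Definition coordinate_sets : set (set (path_space T)) :=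
  [set A | exists t C, [/\ 0 <= t <= T, measurable (C : set R) &
                           A = [set w : path_space T | C (w t)]]].

HB.instance Definition _ := @isMeasurable.Build (sigma_display coordinate_sets)
  (path_space T) <<s coordinate_sets >>
  (@sigma_algebra0 _ setT coordinate_sets)
  (@sigma_algebraC _ coordinate_sets)
  (@sigma_algebra_bigcup _ setT coordinate_sets).

End canonical_space.

Section stochastic.
Context {R : realType} {d} {Omega : measurableType d}.
Variables (P : probability Omega R) (T : R).
Implicit Types (F : R -> set (set Omega)) (G : set (set Omega)).

Definition measurable_wrt G (X : Omega -> R) : Prop :=
  forall C : set R, measurable C -> G (X @^-1` C).

(* Completeness is relative to the sigma-algebra carried by [Omega]. *)
Definition complete_filtration F : Prop :=
  [/\ forall t, 0 <= t <= T -> sigma_algebra setT (F t),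
      forall t, 0 <= t <= T -> F t `<=` measurable,
      forall s t, 0 <= s -> s <= t -> t <= T -> F s `<=` F t &
      forall A, measurable A -> P A = 0%E -> F 0 A].

Definition progressive F (a : R -> Omega -> R) : Prop :=
  forall t, 0 <= t <= T -> forall C : set R, measurable C ->
  <<s [set A `*` B | A in (@measurable _ (measurableTypeR R)) & B in F t] >>
    [set z | 0 <= z.1 <= t /\ C (a z.1 z.2)].

Definition H2 F (a : R -> Omega -> R) : Prop :=
  progressive F a /\
  (\int[P]_w \int[lebesgue_measure]_(t in `[0%R, T]) ((a t w) ^+ 2)%:E
     < +oo)%E.

Definition continuous_paths (X : R -> Omega -> R) : Prop :=
  {ae P, forall w, {within `[0, T], continuous (fun t => X t w)}}.

Definition brownian_motion F (B : R -> Omega -> R) : Prop :=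
  [/\ {ae P, forall w, B 0 w = 0},
      continuous_paths B,
      forall t, 0 <= t <= T -> measurable_wrt (F t) (B t) &
      forall s t, 0 <= s -> s < t -> t <= T ->
      forall C : set R, measurable C ->
        let I := [set w | C (B t w - B s w)] in
        P I = normal_prob 0 (Num.sqrt (t - s)) C /\
        forall A, F s A -> P (A `&` I) = (P A * P I)%E].

(* The simple process sum_i zeta_i 1_(l_i, r_i]. *)
Record simple_process := MkSimple {
  sp_size : nat ;
  sp_l : 'I_sp_size -> R ;
  sp_r : 'I_sp_size -> R ;
  sp_zeta : 'I_sp_size -> Omega -> R }.

Definition simple_adapted F (h : simple_process) : Prop :=
  forall i : 'I_(sp_size h),
  [/\ 0 <= sp_l i, sp_l i <= sp_r i, sp_r i <= T,
      measurable_wrt (F (sp_l i)) (sp_zeta i) &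
      exists M, forall w, `|sp_zeta i w| <= M].

Definition simple_val (h : simple_process) (t : R) (w : Omega) : R :=
  \sum_(i < sp_size h) sp_zeta i w * ((sp_l i < t <= sp_r i)%R)%:R.

Definition simple_integral (B : R -> Omega -> R) (h : simple_process)
    (t : R) (w : Omega) : R :=
  \sum_(i < sp_size h)
    sp_zeta i w * (B (Num.min (sp_r i) t) w - B (Num.min (sp_l i) t) w).

(* [M t] is the Ito integral of [H] against [B] over [0, t]. *)
Definition ito_integral F (B H M : R -> Omega -> R) : Prop :=
  (forall t, 0 <= t <= T -> measurable_wrt (F t) (M t)) /\
  exists h : nat -> simple_process,
  [/\ forall n, simple_adapted F (h n),
      (\int[P]_w \int[lebesgue_measure]_(t in `[0%R, T])
         ((simple_val (h n) t w - H t w) ^+ 2)%:E)%E @[n --> \oo] --> 0%E &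
      forall t, 0 <= t <= T ->
      (\int[P]_w ((simple_integral B (h n) t w - M t w) ^+ 2)%:E)%E
        @[n --> \oo] --> 0%E].

Definition conditional_law G (X : Omega -> R) (m : Omega -> P2 R) : Prop :=
  forall C : set R, measurable C ->
  measurable_wrt G (fun w => fine (m w C)) /\
  forall A, G A -> (\int[P]_(w in A) m w C)%E = P (A `&` X @^-1` C).

End stochastic.

Record game (R : realType) (T : R) d0 (Omega0 : measurableType d0) := MkGame {
  sigma : R ;
  P0 : probability Omega0 R ;
  Pt : probability (path_space T) R ;
  Filt : R -> set (set (Omega0 * path_space T)) ;
  W : R -> Omega0 -> R ;
  xi0 : Omega0 -> R ;
  g : R -> P2 R -> R }.

Section mean_field_game.
Context {R : realType} {T : R} {d0} {Omega0 : measurableType d0}.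
Variable G : game T Omega0.
Local Notation Omega := (Omega0 * path_space T)%type.
Implicit Types (eps : R) (a b : R -> Omega -> R) (m : R -> Omega -> P2 R).

Definition prob : probability Omega R := (P0 G \x Pt G)%E.

Definition individual_noise (t : R) (w : Omega) : R := W G t w.1.

Definition common_noise (t : R) (w : Omega) : R := w.2 t.

Definition Ftilde (t : R) : set (set Omega) :=
  <<s [set A | exists s C, [/\ 0 <= s <= t, measurable (C : set R) &
                               A = common_noise s @^-1` C]] >>.

(* The two noises are independent since they live on different factors; the
   clauses on [common_noise] make [Pt] the Wiener measure. *)
Definition stochastic_basis : Prop :=
  [/\ complete_filtration prob T (Filt G),
      brownian_motion prob T (Filt G) individual_noise,
      brownian_motion prob T (Filt G) common_noise,
      measurable_wrt (Filt G 0) (fun w => xi0 G w.1) &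
      L2 prob (fun w => xi0 G w.1)].

Definition admissible a : Prop := H2 prob T (Filt G) a.

Definition state eps a (t : R) (w : Omega) : R :=
  xi0 G w.1 + (\int[lebesgue_measure]_(s in `[0, t]) a s w)
  + sigma G * individual_noise t w + eps * common_noise t w.

(* [m] is (a version of) the flow of conditional laws of the state given the
   common noise. *)
Definition conditional_flow eps a m : Prop :=
  forall t, 0 <= t <= T ->
  conditional_law prob (Ftilde t) (state eps a t) (m t).

Definition cost eps a m : \bar R :=
  ('E_prob[fun w => ((\int[lebesgue_measure]_(t in `[0, T]) ((a t w) ^+ 2 / 2))
                     + g G (state eps a T w) (m T w))%R])%E.

(* Makes [cost] a genuine real number: the assumptions on [g] only bear on its
   x-derivative, and [g 0] could even fail to be measurable. *)
Definition cost_well_defined : Prop :=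
  forall eps a b m, 0 <= eps -> admissible a -> admissible b ->
  conditional_flow eps b m ->
  prob.-integrable setT (fun w => (g G (state eps a T w) (m T w))%:E).

Definition mfg_solution eps a : Prop :=
  admissible a /\
  forall m, conditional_flow eps a m ->
  forall b, admissible b -> (cost eps a m <= cost eps b m)%E.

Definition nash_equilibrium eps (delta : R) a : Prop :=
  admissible a /\
  forall m, conditional_flow eps a m ->
  forall b, admissible b -> (cost eps a m <= cost eps b m + delta%:E)%E.

(* [X0T] is the terminal state and [m0T] its law; the hat copies share the
   common noise [w.2] and are integrated over the first factor only. *)
Definition variational_fbsde (dxm : R -> P2 R -> R -> R)
    (X0T : Omega -> R) (m0T : P2 R) (U V Q Qt : R -> Omega -> R) : Prop :=
  [/\ [/\ admissible U, admissible V, admissible Q & admissible Qt],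
      continuous_paths prob T U /\ continuous_paths prob T V,
      forall t, 0 <= t <= T -> {ae prob, forall w,
        U t w = common_noise t w
                - (\int[lebesgue_measure]_(s in `[0, t]) V s w)},
      exists M N : R -> Omega -> R,
        [/\ ito_integral prob T (Filt G) individual_noise Q M,
            ito_integral prob T (Filt G) common_noise Qt N &
            forall t, 0 <= t <= T -> {ae prob, forall w,
              V t w = V 0 w + M t w + N t w}] &
      {ae prob, forall w,
        V T w = dxx (g G) (X0T w) m0T * U T w
          + (\int[P0 G]_w0
               (dxm (X0T w) m0T (X0T (w0, w.2)) * U T (w0, w.2)))}].

End mean_field_game.

(* Main.v *)
(* With a the deviation from the strategy beta, A its time integral and D the
   derivative of the terminal cost along beta, convexity of g in x (A2) gives
     J(beta + a) - J(beta) >= E int beta a + E[D A] + (1/2) E int a^2.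
   The first order condition of the 0-game and the martingale property of V turn
   E int beta a into - E[(D0 + eps V_T) A], and E int a^2 >= E[A^2] / T, so that
     J(beta + a) - J(beta) >= - (T / 2) E[r^2],   r = D - D0 - eps V_T.
   The state under beta is X^0 + eps U, so r / eps is dominated by a square
   integrable function and, by definition of the derivatives of d_x g, tends to 0
   almost surely: E[r^2] = O(eps^2) for all eps and o(eps^2) for small eps.

   This needs the conditional law of X^0_T given the common noise to be its law.
   It is the uniqueness of the 0-equilibrium, and follows from weak monotonicity
   (A4) applied to two copies of the game that share the discretised individual
   noise: with b_i the difference of the displacements of the copies over the i-th
   time step, the first order condition gives
     E[b_i b_(i+1)] = - dt E[(D - D') b_i],
   where the sum over i of the right-hand sides is almost nonpositive, while
   consecutive displacements of one copy are close to each other in mean square;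
   hence the copies end up close to each other. *)
Require Import Defs.
From HB Require Import structures.
From mathcomp Require Import all_boot all_order all_algebra.
From mathcomp Require Import all_classical all_reals all_analysis.
From mathcomp Require Import unstable measurable_realfun.
From mathcomp Require Import ring lra.
Import Order.TTheory GRing.Theory Num.Theory.
Import numFieldNormedType.Exports.
Local Open Scope classical_set_scope.
Local Open Scope ring_scope.

Set Implicit Arguments.
Unset Strict Implicit.
Unset Printing Implicit Defensive.

(** * Square integrable functions on a probability space *)


(** Consecutive displacements are paired because of adaptedness: the first order condition may only
    be tested with controls known at the start of a time step, and a displacement is known at its
    end, so it is tested on the following step. The same constraint dictates the discretisation of
    the individual noise: the second copy enters through its conditional mean given what the copies
    share, and this mean has to be an admissible test control. Optimality is a statement about every
    version of the flow of conditional laws, hence empty without one; a version is built by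
    resampling the individual noise and the future of the common noise. Versions also govern
    measurability: a flow is measurable only set by set and [g] is known to be measurable only along
    states, so the derivative of the terminal cost is replaced by an almost surely equal limit of
    difference quotients. The derivative in the measure is defined by lifts to [Phat], whereas the
    direction [U T] lives on the space of the game; quantile functions carry it across, after a
    rounding that the Lipschitz bounds make harmless. *)

Section square_integrable.
Context d (T : measurableType d) (R : realType) (P : probability T R).
Implicit Types f g h : T -> R.

Definition intg f := P.-integrable setT (EFin \o f).

(** Stated with the integral of the square rather than with [norm2], so that sums and products
    reduce to pointwise inequalities between integrable functions. *)
Definition sqint f :=
  measurable_fun setT f /\ (\int[P]_w ((f w) ^+ 2)%:E < +oo)%E.

Lemma intg_meas f : intg f -> measurable_fun setT f.
Proof. by move=> /measurable_int/measurable_EFinP. Qed.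

Lemma sqint_meas f : sqint f -> measurable_fun setT f.
Proof. by case. Qed.

Lemma intg_le f g : measurable_fun setT f -> intg g ->
  (forall w, `|f w| <= `|g w|) -> intg f.
Proof.
move=> mf ig fg; apply: le_integrable ig => //; first exact/measurable_EFinP.
by move=> w _; rewrite /= lee_fin.
Qed.

Lemma intg_cst c : intg (fun=> c).
Proof. exact: finite_measure_integrable_cst. Qed.

Lemma intgD f g : intg f -> intg g -> intg (fun w => f w + g w).
Proof. by move=> fi gi; exact: (integrableD measurableT fi gi). Qed.

Lemma intgB f g : intg f -> intg g -> intg (fun w => f w - g w).
Proof. by move=> fi gi; exact: (integrableB measurableT fi gi). Qed.

Lemma intgZ c f : intg f -> intg (fun w => c * f w).
Proof. by move=> fi; exact: (integrableZl measurableT c fi). Qed.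

Lemma intg_norm f : intg f -> intg (fun w => `|f w|).
Proof. by move=> ?; apply: integrable_norm. Qed.

Lemma intg_sum (I : Type) (s : seq I) (F : I -> T -> R) :
  (forall i, intg (F i)) -> intg (fun w => \sum_(i <- s) F i w).
Proof.
move=> iF; elim: s => [|i s IH].
  by rewrite (_ : (fun w => _) = fun=> 0); [exact: intg_cst|apply/funext => w; rewrite big_nil].
rewrite (_ : (fun w => _) = fun w => F i w + \sum_(j <- s) F j w); first exact: intgD.
by apply/funext => w; rewrite big_cons.
Qed.

Lemma sqint_intg2 f : sqint f -> intg (fun w => f w ^+ 2).
Proof.
case=> mf lf; apply/integrableP; split; first exact/measurable_EFinP/measurable_funX.
by under eq_integral do rewrite /= ger0_norm ?sqr_ge0//.
Qed.

Lemma intg2_sqint f : measurable_fun setT f -> intg (fun w => f w ^+ 2) -> sqint f.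
Proof.
move=> mf /integrableP[_ lf]; split => //; move: lf.
by under eq_integral do rewrite /= ger0_norm ?sqr_ge0//.
Qed.

Lemma sqint_le f g : measurable_fun setT f -> sqint g ->
  (forall w, `|f w| <= `|g w|) -> sqint f.
Proof.
move=> mf sg fg; apply: intg2_sqint => //.
apply: intg_le (sqint_intg2 sg) _; first exact: measurable_funX.
by move=> w; rewrite !normrX lerXn2r ?nnegrE.
Qed.

Lemma sqintM f g : sqint f -> sqint g -> intg (fun w => f w * g w).
Proof.
move=> sf sg; apply: (@intg_le _ (fun w => f w ^+ 2 + g w ^+ 2)).
- by apply: measurable_funM; exact: sqint_meas.
- by apply: intgD; exact: sqint_intg2.
- move=> w; rewrite [leRHS]ger0_norm ?addr_ge0 ?sqr_ge0// ler_norml.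
  by have := sqr_ge0 (f w + g w); have := sqr_ge0 (f w - g w);
     have := sqr_ge0 (f w); have := sqr_ge0 (g w); rewrite !expr2; nra.
Qed.

Lemma sqint_cst c : sqint (fun=> c).
Proof. by apply: intg2_sqint => //; exact: intg_cst. Qed.

Lemma sqint_intg f : sqint f -> intg f.
Proof.
move=> sf; have := sqintM sf (sqint_cst 1).
by congr (intg _); apply/funext => w; rewrite mulr1.
Qed.

Lemma sqintZ c f : sqint f -> sqint (fun w => c * f w).
Proof.
move=> sf; apply: intg2_sqint; first by apply: measurable_funM => //; case: sf.
rewrite (_ : (fun w => _) = fun w => c ^+ 2 * f w ^+ 2).
  exact/intgZ/sqint_intg2.
by apply/funext => w; rewrite exprMn.
Qed.

Lemma sqintD f g : sqint f -> sqint g -> sqint (fun w => f w + g w).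
Proof.
move=> sf sg; apply: intg2_sqint; first by apply: measurable_funD; exact: sqint_meas.
rewrite (_ : (fun w => _) = fun w => f w ^+ 2 + g w ^+ 2 + 2 * (f w * g w)).
  by apply: intgD; [apply: intgD; exact: sqint_intg2|apply: intgZ; exact: sqintM].
by apply/funext => w; ring.
Qed.

Lemma sqintB f g : sqint f -> sqint g -> sqint (fun w => f w - g w).
Proof.
move=> sf sg; rewrite (_ : (fun w => _) = fun w => f w + (-1) * g w).
  exact/sqintD/sqintZ.
by apply/funext => w; rewrite mulN1r.
Qed.

Lemma sqint_norm f : sqint f -> sqint (fun w => `|f w|).
Proof.
move=> sf; apply: (sqint_le _ sf); last by move=> w; rewrite normr_id.
by apply: measurableT_comp => //; exact: sqint_meas.
Qed.

Lemma sqint_sum (I : Type) (s : seq I) (F : I -> T -> R) :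
  (forall i, sqint (F i)) -> sqint (fun w => \sum_(i <- s) F i w).
Proof.
move=> iF; elim: s => [|i s IH].
  by rewrite (_ : (fun w => _) = fun=> 0); [exact: sqint_cst|apply/funext => w; rewrite big_nil].
rewrite (_ : (fun w => _) = fun w => F i w + \sum_(j <- s) F j w); first exact: sqintD.
by apply/funext => w; rewrite big_cons.
Qed.

Lemma sqint_bounded f M : measurable_fun setT f -> (forall w, `|f w| <= M) -> sqint f.
Proof.
move=> mf fM; apply: (sqint_le mf (sqint_cst M)) => w.
exact: le_trans (fM w) (ler_norm _).
Qed.

Lemma sqintMb f g M : measurable_fun setT f -> (forall w, `|f w| <= M) ->
  sqint g -> sqint (fun w => f w * g w).
Proof.
move=> mf fM sg; apply: (sqint_le _ (sqintZ M sg)).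
  by apply: measurable_funM => //; exact: sqint_meas.
move=> w; rewrite !normrM; apply: ler_wpM2r => //.
exact: le_trans (fM w) (ler_norm _).
Qed.

Lemma sqint_lim f g : measurable_fun setT f -> sqint g ->
  (\int[P]_w ((g w - f w) ^+ 2)%:E < +oo)%E -> sqint f.
Proof.
move=> mf sg lfg.
have sgf : sqint (fun w => g w - f w).
  by split => //; apply: measurable_funB => //; exact: sqint_meas.
rewrite (_ : f = fun w => g w - (g w - f w)); first exact: sqintB.
by apply/funext => w; rewrite subKr.
Qed.

Lemma RintD f g : intg f -> intg g ->
  \int[P]_w (f w + g w) = \int[P]_w f w + \int[P]_w g w.
Proof. exact: RintegralD. Qed.

Lemma RintB f g : intg f -> intg g ->
  \int[P]_w (f w - g w) = \int[P]_w f w - \int[P]_w g w.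
Proof. exact: RintegralB. Qed.

Lemma RintZ c f : intg f -> \int[P]_w (c * f w) = c * \int[P]_w f w.
Proof. exact: RintegralZl. Qed.

Lemma Rint_cst c : \int[P]_w c = c.
Proof. by rewrite Rintegral_cst// [X in fine X](@probability_setT _ _ _ P) mulr1. Qed.

Lemma Rint_sum (I : Type) (s : seq I) (F : I -> T -> R) :
  (forall i, intg (F i)) ->
  \int[P]_w (\sum_(i <- s) F i w) = \sum_(i <- s) \int[P]_w F i w.
Proof.
move=> iF; elim: s => [|i s IH].
  by under eq_Rintegral do rewrite big_nil; rewrite Rint_cst big_nil.
under eq_Rintegral do rewrite big_cons.
by rewrite RintD// ?IH ?big_cons//; exact: intg_sum.
Qed.

Lemma Rint_le f g : intg f -> intg g -> (forall w, f w <= g w) ->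
  \int[P]_w f w <= \int[P]_w g w.
Proof. by move=> *; apply: le_Rintegral. Qed.

Lemma Rint_ge0 f : (forall w, 0 <= f w) -> 0 <= \int[P]_w f w.
Proof. by move=> f0; apply: Rintegral_ge0. Qed.

Lemma Rint_ae f g : measurable_fun setT f -> measurable_fun setT g ->
  {ae P, forall w, f w = g w} -> \int[P]_w f w = \int[P]_w g w.
Proof.
move=> mf mg fg; congr fine; apply: ae_eq_integral => //; [exact/measurable_EFinP..|].
by apply: filterS fg => w fgw _ /=; rewrite fgw.
Qed.

Lemma sqint_ae f g : measurable_fun setT f -> sqint g ->
  {ae P, forall w, f w = g w} -> sqint f.
Proof.
move=> mf [mg lg] fg; split => //.
rewrite (ae_eq_integral (fun w => (g w ^+ 2)%:E))//.
- exact/measurable_EFinP/measurable_funX.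
- exact/measurable_EFinP/measurable_funX.
- by apply: filterS fg => w fgw _ /=; rewrite fgw.
Qed.

Lemma Rint_ae_le f g : intg f -> intg g ->
  {ae P, forall w, f w <= g w} -> \int[P]_w f w <= \int[P]_w g w.
Proof.
move=> mf mg fg.
rewrite (@Rint_ae f (fun w => Num.min (f w) (g w))).
- apply: Rint_le => //; last by move=> w; rewrite ge_min lexx orbT.
  apply: (@intg_le _ (fun w => `|f w| + `|g w|)).
  + by apply: measurable_minr; exact: intg_meas.
  + by apply: intgD; exact: intg_norm.
  + move=> w; rewrite [leRHS]ger0_norm ?addr_ge0//.
    by rewrite /Order.min; case: ifP => _; rewrite ?lerDl ?lerDr.
- exact: intg_meas.
- by apply: measurable_minr; exact: intg_meas.
- by apply: filterS fg => w fgw; rewrite min_l.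
Qed.

Lemma sqr_Rint_le f : sqint f -> (\int[P]_w f w) ^+ 2 <= \int[P]_w (f w ^+ 2).
Proof.
move=> sf; set m := \int[P]_w f w.
have : 0 <= \int[P]_w ((f w - m) ^+ 2) by apply: Rint_ge0 => w; exact: sqr_ge0.
rewrite (@eq_Rintegral _ _ _ _ _ (fun w => f w ^+ 2 + ((- 2 * m) * f w + m ^+ 2))); last first.
  by move=> w _ /=; ring.
have i1 := sqint_intg2 sf; have i2 := sqint_intg sf.
rewrite RintD//; last by apply: intgD; [exact: intgZ|exact: intg_cst].
rewrite RintD//; [|exact: intgZ|exact: intg_cst].
rewrite RintZ// Rint_cst -/m; set X := \int[P]_w _; rewrite expr2; nra.
Qed.

(** Expectation of a nonnegative square. The free weight [k] is later taken equal to the horizon, so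
    that the square of an integrated control is absorbed by its running cost. *)
Lemma Rint_AMGM f g (k : R) : sqint f -> sqint g -> 0 < k ->
  2 * \int[P]_w (f w * g w) <= k * \int[P]_w (f w ^+ 2) + k^-1 * \int[P]_w (g w ^+ 2).
Proof.
move=> sf sg k0.
have i1 := sqint_intg2 sf; have i2 := sqint_intg2 sg; have i3 := sqintM sf sg.
rewrite -!RintZ// -RintD//; [|exact: intgZ..].
apply: Rint_le; [exact: intgZ|by apply: intgD; exact: intgZ|].
move=> w; rewrite -subr_ge0.
rewrite (_ : _ - _ = k * (f w - k^-1 * g w) ^+ 2); last by field; rewrite gt_eqF.
by rewrite mulr_ge0 ?sqr_ge0// ltW.
Qed.

(** The polynomial [k |-> E[(k f - g)^2]] is nonnegative; its value at the minimiser [c / a] gives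
    the claim. If [a = 0] it is affine in [k], hence constant, and [c = 0]. *)
Lemma Rint_CS f g : sqint f -> sqint g ->
  (\int[P]_w (f w * g w)) ^+ 2 <= \int[P]_w (f w ^+ 2) * \int[P]_w (g w ^+ 2).
Proof.
move=> sf sg.
have i1 := sqint_intg2 sf; have i2 := sqint_intg2 sg; have i3 := sqintM sf sg.
set a := \int[P]_w (f w ^+ 2); set b := \int[P]_w (g w ^+ 2).
set c := \int[P]_w _.
have a0 : 0 <= a by apply: Rint_ge0 => w; exact: sqr_ge0.
have b0 : 0 <= b by apply: Rint_ge0 => w; exact: sqr_ge0.
have key (k : R) : 0 <= k ^+ 2 * a - 2 * k * c + b.
  have : 0 <= \int[P]_w ((k * f w - g w) ^+ 2).
    by apply: Rint_ge0 => w; exact: sqr_ge0.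
  rewrite (@eq_Rintegral _ _ _ _ _ (fun w => k ^+ 2 * f w ^+ 2 + ((- 2 * k) * (f w * g w) + g w ^+ 2))); last first.
    by move=> w _ /=; ring.
  rewrite RintD; [|exact: intgZ|by apply: intgD => //; exact: intgZ].
  rewrite RintD//; last exact: intgZ.
  by rewrite !RintZ// -/a -/b -/c; congr (_ <= _); ring.
have [a1|] := ltP 0 a.
  have := key (c / a).
  rewrite (_ : _ + b = (a * b - c ^+ 2) / a); last by field; rewrite gt_eqF.
  by rewrite pmulr_lge0 ?invr_gt0// subr_ge0.
move=> a1; have aE : a = 0 by apply/eqP; rewrite eq_le a0 a1.
have [->|c0] := eqVneq c 0; first by rewrite expr0n/= mulr_ge0.
(* At this [k] the affine polynomial would take the value -1. *)
have := key ((b + 1) / (2 * c)).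
rewrite aE mulr0 add0r (_ : _ + b = -1); last by field.
by move=> ?; lra.
Qed.

Lemma sqr_Rint_eq0 f : sqint f -> \int[P]_w (f w ^+ 2) <= 0 -> {ae P, forall w, f w = 0}.
Proof.
move=> sf f0; have i1 := sqint_intg2 sf.
have : (\int[P]_w `|(f w ^+ 2)%:E| = 0)%E.
  under eq_integral do rewrite abse_EFin ger0_norm ?sqr_ge0//.
  have /fineK <- : (\int[P]_w (f w ^+ 2)%:E)%E \is a fin_num by apply: integrable_fin_num.
  apply/eqP; rewrite eqe eq_le f0/=; apply: Rint_ge0 => w; exact: sqr_ge0.
have mf2 : measurable_fun setT (fun w => (f w ^+ 2)%:E).
  exact/measurable_EFinP/intg_meas.
move=> /(ae_eq_integral_abs P measurableT mf2); apply: filterS => w /(_ I) [] /eqP.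
by rewrite sqrf_eq0 => /eqP.
Qed.

End square_integrable.

(** * Fubini for products of probability measures *)


Section measurable_Rintegral.
Context d1 d2 (T1 : measurableType d1) (T2 : measurableType d2) (R : realType).
Variables (m1 : {sigma_finite_measure set T1 -> \bar R})
          (m2 : {sigma_finite_measure set T2 -> \bar R}).
Variable f : T1 * T2 -> R.
Hypothesis mf : measurable_fun setT f.

Let mEf : measurable_fun setT (EFin \o f).
Proof. exact/measurable_EFinP. Qed.

(** Sections may fail to be integrable: the integral is a difference of two measurable extended
    functions, whatever the convention where both are infinite. *)
Lemma measurable_Rintegral1 : measurable_fun setT (fun x => \int[m2]_y f (x, y)).
Proof.
apply: measurableT_comp => //.
rewrite (_ : (fun x => _) = (fun x => \int[m2]_y (EFin \o f)^\+ (x, y)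
   - \int[m2]_y (EFin \o f)^\- (x, y))%E); last first.
  apply/funext => x; rewrite integralE.
  by congr (_ - _)%E; apply: eq_integral => y _; rewrite ?funeposE ?funenegE.
apply: emeasurable_funB.
  by apply: measurable_fun_fubini_tonelli_F => //; exact: measurable_funepos.
by apply: measurable_fun_fubini_tonelli_F => //; exact: measurable_funeneg.
Qed.

Lemma measurable_Rintegral2 : measurable_fun setT (fun y => \int[m1]_x f (x, y)).
Proof.
apply: measurableT_comp => //.
rewrite (_ : (fun x => _) = (fun y => \int[m1]_x (EFin \o f)^\+ (x, y)
   - \int[m1]_x (EFin \o f)^\- (x, y))%E); last first.
  apply/funext => x; rewrite integralE.
  by congr (_ - _)%E; apply: eq_integral => y _; rewrite ?funeposE ?funenegE.
apply: emeasurable_funB.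
  by apply: measurable_fun_fubini_tonelli_G => //; exact: measurable_funepos.
by apply: measurable_fun_fubini_tonelli_G => //; exact: measurable_funeneg.
Qed.

End measurable_Rintegral.

Section product_of_probabilities.
Context d1 d2 (T1 : measurableType d1) (T2 : measurableType d2) (R : realType).
Variables (m1 : probability T1 R) (m2 : probability T2 R).

Definition pprod : probability (T1 * T2)%type R := (m1 \x m2)%E.

Implicit Types f : T1 * T2 -> R.

(** The inner integral is a real number here; it agrees with the extended one on the integrable
    sections, hence almost everywhere, and Fubini applies to the latter. *)
Lemma intg_fubini1 f : intg pprod f ->
  [/\ {ae m1, forall x, intg m2 (fun y => f (x, y))},
      intg m1 (fun x => \int[m2]_y f (x, y)) &
      \int[m1]_x (\int[m2]_y f (x, y)) = \int[pprod]_z f z].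
Proof.
move=> fi; have ae1 := ae_integrable1 fi.
have i1 := integrable_fubini_F fi.
have aeF : {ae m1, forall x, (\int[m2]_y f (x, y))%:E = fubini_F m2 (EFin \o f) x}.
  by apply: filterS ae1 => x xi; rewrite /Rintegral fineK//; exact: integrable_fin_num.
have mF : measurable_fun setT (fun x => \int[m2]_y f (x, y)).
  by apply: measurable_Rintegral1; exact: intg_meas fi.
have EF : (\int[m1]_x (\int[m2]_y f (x, y))%:E = \int[m1]_x fubini_F m2 (EFin \o f) x)%E.
  apply: ae_eq_integral => //; [exact/measurable_EFinP|exact: measurable_int i1|].
  by apply: filterS aeF => x xE _.
split; [exact: ae1| |].
  apply/integrableP; split; first exact/measurable_EFinP.
  rewrite (ae_eq_integral (fun x => `|fubini_F m2 (EFin \o f) x|))%E//.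
  - by case/integrableP : i1.
  - exact/measurableT_comp/measurable_EFinP.
  - by apply: measurableT_comp => //; exact: measurable_int i1.
  - by apply: filterS aeF => x xE _; rewrite -xE.
by congr fine; rewrite EF; exact: (integral12_prod_meas1 fi).
Qed.

Lemma meas_pair1 f x : measurable_fun setT f -> measurable_fun setT (fun y => f (x, y)).
Proof. by move=> mf; apply: (measurable_fun_pair2 x). Qed.

Lemma meas_pair2 f y : measurable_fun setT f -> measurable_fun setT (fun x => f (x, y)).
Proof. by move=> mf; apply: (measurable_fun_pair1 y). Qed.

Lemma sqint_section1 f : sqint pprod f -> {ae m1, forall x, sqint m2 (fun y => f (x, y))}.
Proof.
move=> sf; have [ae1 _ _] := intg_fubini1 (sqint_intg2 sf).
apply: filterS ae1 => x; apply: intg2_sqint.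
exact/meas_pair1/sqint_meas/sf.
Qed.

Lemma sqint_average1 f : sqint pprod f ->
  sqint m1 (fun x => \int[m2]_y f (x, y)) /\
  \int[m1]_x ((\int[m2]_y f (x, y)) ^+ 2) <= \int[pprod]_z (f z ^+ 2).
Proof.
move=> sf; have [ae1 i1 e1] := intg_fubini1 (sqint_intg2 sf).
have mF : measurable_fun setT (fun x => \int[m2]_y f (x, y)).
  by apply: measurable_Rintegral1; exact: sqint_meas sf.
have le1 : {ae m1, forall x, (\int[m2]_y f (x, y)) ^+ 2 <= \int[m2]_y (f (x, y) ^+ 2)}.
  by apply: filterS (sqint_section1 sf) => x; exact: sqr_Rint_le.
have sF : sqint m1 (fun x => \int[m2]_y f (x, y)).
  split => //; apply: le_lt_trans (integrable_lty measurableT i1).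
  apply: ae_ge0_le_integral => //.
  - by move=> x _; rewrite lee_fin sqr_ge0.
  - exact/measurable_EFinP/measurable_funX.
  - by move=> x _; rewrite lee_fin Rint_ge0// => y; exact: sqr_ge0.
  - exact: measurable_int i1.
  - by apply: filterS le1 => x xle _; rewrite lee_fin.
by split => //; rewrite -e1; apply: Rint_ae_le => //; exact: sqint_intg2.
Qed.

Lemma intg_fst g : intg m1 g -> intg pprod (fun z => g z.1).
Proof.
move=> gi; have mg : measurable_fun setT (fun z : T1 * T2 => g z.1).
  by apply: measurableT_comp => //; exact: intg_meas gi.
apply/(integrable12ltyP m1 m2) => /=; first exact/measurable_EFinP.
under eq_integral do rewrite integral_cst// [X in (_ * X)%E](@probability_setT _ _ _ m2) mule1.
by case/integrableP : gi.
Qed.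

Lemma sqint_fst g : sqint m1 g -> sqint pprod (fun z => g z.1).
Proof.
move=> sg; apply: intg2_sqint; last exact: (intg_fst (sqint_intg2 sg)).
by apply: measurableT_comp => //; exact: sqint_meas sg.
Qed.

(** Averaging over the second factor is conditioning on the first; this is the characteristic
    identity of that conditional expectation. *)
Lemma average1M f g : sqint pprod f -> sqint m1 g ->
  \int[m1]_x (g x * \int[m2]_y f (x, y)) = \int[pprod]_z (g z.1 * f z).
Proof.
move=> sf sg.
have mF : measurable_fun setT (fun x => \int[m2]_y f (x, y)).
  by apply: measurable_Rintegral1; exact: sqint_meas sf.
have [ae1 i1 <-] := intg_fubini1 (sqintM (sqint_fst sg) sf).
apply: Rint_ae.
- by apply: measurable_funM => //; exact: sqint_meas sg.
- exact: intg_meas i1.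
- by apply: filterS (sqint_section1 sf) => x sx /=; rewrite RintZ//; exact: sqint_intg.
Qed.

Lemma ae_fst (A : T1 -> Prop) : {ae m1, forall x, A x} -> {ae pprod, forall z, A z.1}.
Proof.
case=> N [mN N0 AN]; exists (fst @^-1` N); split; last by move=> z /= nz; exact: AN.
  by rewrite -[X in measurable X]setTI; exact: measurable_fst.
rewrite (_ : fst @^-1` N = N `*` setT); last by apply/seteqP; split => // z [].
by apply: (etrans (product_measure1E m1 m2 mN measurableT)); rewrite [X in (X * _)%E](_ : _ = 0%E) ?mul0e.
Qed.

Lemma ae_snd (A : T2 -> Prop) : {ae m2, forall y, A y} -> {ae pprod, forall z, A z.2}.
Proof.
case=> N [mN N0 AN]; exists (snd @^-1` N); split; last by move=> z /= nz; exact: AN.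
  by rewrite -[X in measurable X]setTI; exact: measurable_snd.
rewrite (_ : snd @^-1` N = setT `*` N); last by apply/seteqP; split => // z [].
by apply: (etrans (product_measure1E m1 m2 measurableT mN)); rewrite [X in (_ * X)%E](_ : _ = 0%E) ?mule0.
Qed.

(** Tonelli applied to the indicator of a measurable null set that covers the exceptions: almost
    every section of it has measure zero. *)
Lemma ae_section1 (A : T1 * T2 -> Prop) : {ae pprod, forall z, A z} ->
  {ae m1, forall x, {ae m2, forall y, A (x, y)}}.
Proof.
case=> N [mN N0 AN].
pose ind : T1 * T2 -> \bar R := fun z => (\1_N z)%:E.
have mi : measurable_fun setT ind by exact/measurable_EFinP.
have i0 z : (0 <= ind z)%E by rewrite lee_fin.
have N1 : (\int[m1]_x fubini_F m2 ind x = 0)%E.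
  rewrite -[RHS]N0; apply: etrans (esym _) _.
    exact: (fubini_tonelli1 (m1 := m1) (m2 := m2) ind mi i0).
  by rewrite integral_indic// setIT.
have mF : measurable_fun setT (fubini_F m2 ind).
  exact: measurable_fun_fubini_tonelli_F.
have : (\int[m1]_x `|fubini_F m2 ind x| = 0)%E.
  rewrite -[RHS]N1; apply: eq_integral => x _; rewrite gee0_abs//.
  by apply: integral_ge0.
move=> /(ae_eq_integral_abs m1 measurableT mF); apply: filterS => x /(_ I) Fx.
exists (xsection N x); split; first exact: measurable_xsection.
  move: Fx; rewrite /fubini_F/=.
  rewrite (eq_integral (EFin \o \1_(xsection N x))).
    by rewrite integral_indic ?setIT//; exact: measurable_xsection.
  by move=> y _ /=; rewrite !indicE mem_xsection.
by move=> y /= nA; rewrite /xsection/= inE; exact: AN.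
Qed.

End product_of_probabilities.

Section swapped_product.
Context d1 d2 (T1 : measurableType d1) (T2 : measurableType d2) (R : realType).
Variables (m1 : probability T1 R) (m2 : probability T2 R).
Implicit Types f : T1 * T2 -> R.

Lemma intg_swap f : intg (pprod m1 m2) f ->
  intg (pprod m2 m1) (f \o @swap T2 T1) /\
  \int[pprod m2 m1]_z f (swap z) = \int[pprod m1 m2]_z f z.
Proof.
move=> fi; have mf := intg_meas fi.
have mg : measurable_fun setT (f \o @swap T2 T1).
  by apply: measurableT_comp => //; exact: measurable_swap.
have gi : intg (pprod m2 m1) (f \o @swap T2 T1).
  apply/(integrable12ltyP m2 m1); first exact/measurable_EFinP.
  by have /(integrable21ltyP m1 m2) := fi; apply; exact/measurable_EFinP.
split=> //; congr fine.
rewrite -[RHS](integral21_prod_meas1 fi).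
by rewrite -[LHS](integral12_prod_meas1 gi).
Qed.

Lemma sqint_swap f : sqint (pprod m1 m2) f -> sqint (pprod m2 m1) (f \o @swap T2 T1).
Proof.
move=> sf; apply: intg2_sqint; last by case: (intg_swap (sqint_intg2 sf)).
apply: measurableT_comp; first exact: sqint_meas sf.
exact: measurable_swap.
Qed.

End swapped_product.

Section product_of_probabilities2.
Context d1 d2 (T1 : measurableType d1) (T2 : measurableType d2) (R : realType).
Variables (m1 : probability T1 R) (m2 : probability T2 R).
Implicit Types f : T1 * T2 -> R.

Lemma intg_snd g : intg m2 g -> intg (pprod m1 m2) (fun z => g z.2).
Proof. by move=> gi; have [] := intg_swap (intg_fst m1 gi). Qed.

Lemma sqint_snd g : sqint m2 g -> sqint (pprod m1 m2) (fun z => g z.2).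
Proof. by move=> gi; have := sqint_swap (sqint_fst m1 gi). Qed.

Lemma intg_fubini2 f : intg (pprod m1 m2) f ->
  [/\ {ae m2, forall y, intg m1 (fun x => f (x, y))},
      intg m2 (fun y => \int[m1]_x f (x, y)) &
      \int[m2]_y (\int[m1]_x f (x, y)) = \int[pprod m1 m2]_z f z].
Proof. by move=> /intg_swap[fi <-]; exact: (intg_fubini1 fi). Qed.

Lemma sqint_section2 f : sqint (pprod m1 m2) f ->
  {ae m2, forall y, sqint m1 (fun x => f (x, y))}.
Proof. by move=> /sqint_swap; exact: sqint_section1. Qed.

Lemma sqint_average2 f : sqint (pprod m1 m2) f ->
  sqint m2 (fun y => \int[m1]_x f (x, y)) /\
  \int[m2]_y ((\int[m1]_x f (x, y)) ^+ 2) <= \int[pprod m1 m2]_z (f z ^+ 2).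
Proof.
move=> sf; have [_ <-] := intg_swap (sqint_intg2 sf).
exact: (sqint_average1 (sqint_swap sf)).
Qed.

Lemma average2M f g : sqint (pprod m1 m2) f -> sqint m2 g ->
  \int[m2]_y (g y * \int[m1]_x f (x, y)) = \int[pprod m1 m2]_z (g z.2 * f z).
Proof.
move=> sf sg; have [_ <-] := intg_swap (sqintM (sqint_snd sg) sf).
exact: (average1M (sqint_swap sf) sg).
Qed.

Lemma ae_swap (A : T1 * T2 -> Prop) : {ae pprod m1 m2, forall z, A z} ->
  {ae pprod m2 m1, forall z, A (swap z)}.
Proof.
case=> N [mN N0 AN]; exists (@swap T2 T1 @^-1` N); split.
- by rewrite -[X in measurable X]setTI; exact: measurable_swap.
- have iN : intg (pprod m1 m2) (\1_N : _ -> R).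
    by apply: sqint_intg; apply: (@sqint_bounded _ _ _ _ _ 1) => // w;
       rewrite indicE; case: (_ \in _); rewrite ?normr1 ?normr0.
  have [iS] := intg_swap iN.
  have e2 : (\int[pprod m1 m2]_z (\1_N z)%:E)%E = 0%E.
    by rewrite integral_indic// setIT; exact: N0.
  rewrite /Rintegral e2 => /= e0.
  have mS : measurable (@swap T2 T1 @^-1` N).
    by rewrite -[X in measurable X]setTI; exact: measurable_swap.
  have e1 : (\int[pprod m2 m1]_x (\1_N (swap x))%:E)%E = pprod m2 m1 (@swap T2 T1 @^-1` N).
    rewrite (eq_integral (EFin \o \1_(@swap T2 T1 @^-1` N))); last by move=> z _.
    by rewrite integral_indic// setIT.
  move: e0; rewrite e1 => e0; rewrite -[LHS]fineK ?e0//.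
  by rewrite ge0_fin_numE// (le_lt_trans (probability_le1 _ mS))// ltry.
- by move=> z /= nz; exact: AN.
Qed.

End product_of_probabilities2.

Lemma ae_section2 d1 d2 (T1 : measurableType d1) (T2 : measurableType d2)
    (R : realType) (m1 : probability T1 R) (m2 : probability T2 R)
    (A : T1 * T2 -> Prop) : {ae pprod m1 m2, forall z, A z} ->
  {ae m2, forall y, {ae m1, forall x, A (x, y)}}.
Proof. by move=> /ae_swap; exact: ae_section1. Qed.


(** * Measures with a density, and orthogonality to a sub-sigma-algebra *)

Section density.
Context d (T : measurableType d) (R : realType) (mu : {measure set T -> \bar R}).
Variable f : T -> R.

(** The two proofs are arguments so that the measure structure below can be attached to
    [dens mf f0]. *)
Definition dens of measurable_fun setT f & (forall x, 0 <= f x) :=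
  fun A : set T => (\int[mu]_(x in A) (f x)%:E)%E.

Hypotheses (mf : measurable_fun setT f) (f0 : forall x, 0 <= f x).

Let mEf : measurable_fun setT (EFin \o f).
Proof. exact/measurable_EFinP. Qed.

Let dens0 : dens mf f0 set0 = 0%E.
Proof. by rewrite /dens integral_set0. Qed.

Let dens_ge0 A : (0 <= dens mf f0 A)%E.
Proof. by apply: integral_ge0 => x _; rewrite lee_fin. Qed.

Let dens_sigma_additive : semi_sigma_additive (dens mf f0).
Proof.
move=> /= F mF tF mUF; rewrite /dens; apply: cvg_toP.
  apply: ereal_nondecreasing_is_cvgn => m n mn.
  apply: lee_sum_nneg_natr => // k _ _.
  by apply: integral_ge0 => /= x Fkx; rewrite lee_fin.
rewrite ge0_integral_bigcup//=; first exact: measurable_funTS.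
by move=> x _; rewrite lee_fin.
Qed.

HB.instance Definition _ := isMeasure.Build _ _ _ (dens mf f0)
  dens0 dens_ge0 dens_sigma_additive.

Import HBNNSimple.

Let integral_dens_nnsfun (h : {nnsfun T >-> R}) :
  (\int[dens mf f0]_x (h x)%:E = \int[mu]_x ((h x)%:E * (f x)%:E))%E.
Proof.
under [LHS]eq_integral do rewrite fimfunE -fsumEFin//.
rewrite [LHS]ge0_integral_fsum//; last 2 first.
  - by move=> r; exact/measurable_EFinP/measurableT_comp.
  - by move=> n x _; rewrite EFinM nnfun_muleindic_ge0.
under [RHS]eq_integral.
  move=> x xD; rewrite fimfunE -fsumEFin// ge0_mule_fsuml; last first.
    by move=> r; rewrite EFinM nnfun_muleindic_ge0.
  over.
rewrite [RHS]ge0_integral_fsum//; last 2 first.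
  - move=> r; apply: emeasurable_funM => //.
    by apply/measurable_EFinP; exact/measurableT_comp.
  - move=> n x _; rewrite EFinM; apply: mule_ge0; last by rewrite lee_fin.
    by rewrite nnfun_muleindic_ge0.
apply: eq_fsbigr => r _; rewrite integralZl_indic_nnsfun// integral_indic// setIT.
rewrite -[X in (_ * X)%E = _]/(\int[mu]_(x in h @^-1` [set r]) (f x)%:E)%E.
have [r0|r0] := ltP r 0.
  have -> : h @^-1` [set r] = set0 by exact: preimage_nnfun0.
  rewrite integral_set0 mule0 integral0_eq// => x _.
  by rewrite indic0/= mulr0 mul0e.
rewrite [in LHS]integral_mkcond -ge0_integralZl//.
- apply: eq_integral => x _; rewrite patchE indicE.
  by case: ifPn => _; rewrite ?mulr1 ?mulr0 ?mul0e ?mule0.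
- apply/(measurable_restrictT (fun x : T => (f x)%:E) _).1 => //.
  exact: measurable_funTS.
- by move=> x _; rewrite patchE; case: ifPn => // _; rewrite lee_fin.
Qed.

(** Simple functions, then monotone convergence on both sides. *)
Lemma integral_dens (h : T -> \bar R) :
  measurable_fun setT h -> (forall x, 0 <= h x)%E ->
  (\int[dens mf f0]_x h x = \int[mu]_x (h x * (f x)%:E))%E.
Proof.
move=> mh h0.
pose h_ := nnsfun_approx measurableT mh.
have cvgh x : (EFin \o h_ ^~ x) n @[n --> \oo] --> h x.
  by apply: cvg_nnsfun_approx.
transitivity (lim (\int[dens mf f0]_x (h_ n x)%:E @[n --> \oo])%E).
  rewrite -monotone_convergence//=.
  - by apply: eq_integral => x _; apply/esym/cvg_lim => //; exact: cvgh.
  - by move=> n; exact/measurable_EFinP/measurable_funTS.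
  - by move=> n ? _; rewrite lee_fin.
  - by move=> ? _ ? ? mn; rewrite lee_fin; exact/lefP/nd_nnsfun_approx.
rewrite [RHS](_ : _ = lim
    (\int[mu]_x ((h_ n x)%:E * (f x)%:E)%E @[n --> \oo])%E); last first.
  rewrite -monotone_convergence//=.
  - apply: eq_integral => x _; apply/esym/cvg_lim => //.
    by apply: cvgeZr => //; exact: cvgh.
  - move=> n; apply: emeasurable_funM => //.
    exact/measurable_EFinP/measurable_funTS.
  - by move=> n ? _; rewrite -EFinM lee_fin mulr_ge0.
  - move=> x _ ? ? mn; rewrite -!EFinM lee_fin ler_wpM2r//.
    exact/lefP/nd_nnsfun_approx.
by apply: congr_lim; apply/funext => n /=; exact: integral_dens_nnsfun.
Qed.

End density.

Section sub_sigma_algebra.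
Context d (T : measurableType d) (R : realType).
Variables (F : set (set T)).
Hypotheses (sF : sigma_algebra setT F) (Fm : F `<=` measurable).
Implicit Types (f h z : T -> R).

Local Notation gT := (g_sigma_algebraType F).

Lemma measurable_wrtP z : measurable_wrt F z <-> measurable_fun setT (z : gT -> R).
Proof.
split=> mz.
  by move=> _ C mC; rewrite setTI; apply: sub_sigma_algebra; exact: mz.
move=> C mC; rewrite -[X in F X]setTI.
by have /= := mz measurableT _ mC; rewrite measurable_g_measurableTypeE.
Qed.

Lemma measurable_wrt_meas z : measurable_wrt F z -> measurable_fun setT z.
Proof. by move=> mz _ C mC; rewrite setTI; apply: Fm; exact: mz. Qed.

Lemma measurable_id_sub : measurable_fun setT (id : T -> gT).
Proof.
move=> _ B mB; rewrite setTI preimage_id; apply: Fm.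
by rewrite -(sigma_algebra_id sF).
Qed.

(** Both measures are pushed by the identity to the sigma-algebra [F], where they coincide. *)
Lemma eq_integral_sub (m1 m2 : {measure set T -> \bar R}) (z : T -> R) :
  (forall A, F A -> m1 A = m2 A) -> measurable_wrt F z -> (forall x, 0 <= z x) ->
  (\int[m1]_x (z x)%:E = \int[m2]_x (z x)%:E)%E.
Proof.
move=> m12 /measurable_wrtP mz z0.
have := @ge0_integral_pushforward _ _ T gT R id measurable_id_sub m1 setT
  (EFin \o z) measurableT.
move=> <- //; [|exact/measurable_EFinP|by move=> y _; rewrite lee_fin].
have := @ge0_integral_pushforward _ _ T gT R id measurable_id_sub m2 setT
  (EFin \o z) measurableT.
move=> <- //; [|exact/measurable_EFinP|by move=> y _; rewrite lee_fin].
pose idm := isMeasurableFun.Build _ _ _ _ _ measurable_id_sub.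
pose idf : {mfun T >-> gT} := HB.pack (id : T -> gT) idm.
apply: (@eq_measure_integral _ gT R setT (pushforward m2 idf) (pushforward m1 idf)).
move=> B mB _; apply: m12; rewrite preimage_id.
by move: mB; rewrite measurable_g_measurableTypeE.
Qed.

Variable P : probability T R.

(** The positive and negative parts of [h] are densities of two measures that agree on [F], so they
    give the same integral to [z]. This is used in place of conditional expectations. *)
Let cond_orth_ge0 h z : intg P h -> (forall A, F A -> \int[P]_(w in A) h w = 0) ->
  measurable_wrt F z -> (forall x, 0 <= z x) -> intg P (fun w => z w * h w) ->
  \int[P]_w (z w * h w) = 0.
Proof.
move=> ih h0 mz z0 izh; have mh := intg_meas ih.
pose hp w := Num.max (h w) 0; pose hn w := Num.max (- h w) 0.
have mhp : measurable_fun setT hp by apply: measurable_maxr.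
have mhn : measurable_fun setT hn.
  by apply: measurable_maxr => //; exact: measurableT_comp.
have hp0 w : 0 <= hp w by rewrite le_max lexx orbT.
have hn0 w : 0 <= hn w by rewrite le_max lexx orbT.
have hE w : h w = hp w - hn w.
  rewrite /hp /hn; have [w0|/ltW w0] := lerP 0 (h w).
    by rewrite max_r ?oppr_le0// subr0.
  by rewrite max_l ?oppr_ge0// sub0r opprK.
have hple w : hp w <= `|h w| by rewrite ge_max ler_norm normr_ge0.
have hnle w : hn w <= `|h w| by rewrite ge_max -normrN ler_norm normr_ge0.
have ihp : intg P hp.
  by apply: (intg_le mhp ih) => w; rewrite ger0_norm.
have ihn : intg P hn.
  by apply: (intg_le mhn ih) => w; rewrite ger0_norm.
have mz' := measurable_wrt_meas mz.
have izp : intg P (fun w => z w * hp w).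
  apply: (intg_le _ izh); first exact: measurable_funM.
  by move=> w; rewrite !normrM ler_wpM2l// ger0_norm.
have izn : intg P (fun w => z w * hn w).
  apply: (intg_le _ izh); first exact: measurable_funM.
  by move=> w; rewrite !normrM ler_wpM2l// ger0_norm.
have agree A : F A -> dens P mhp hp0 A = dens P mhn hn0 A.
  move=> FA; have mA := Fm FA; rewrite /dens.
  have iA g : intg P g -> P.-integrable A (EFin \o g).
    by move=> ig; apply: integrableS ig.
  have := h0 _ FA; under eq_Rintegral do rewrite hE.
  rewrite RintegralB//; [|exact: iA..].
  move=> /eqP; rewrite subr_eq0 => /eqP e.
  rewrite -[LHS]fineK; last by apply: integrable_fin_num => //; exact: iA.
  rewrite -[RHS]fineK; last by apply: integrable_fin_num => //; exact: iA.
  by congr (_%:E).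
have := eq_integral_sub agree mz z0.
rewrite !integral_dens//; [|exact/measurable_EFinP|exact/measurable_EFinP].
move=> e; under eq_Rintegral do rewrite hE mulrBr.
by rewrite RintB// /Rintegral -e subrr.
Qed.

Lemma Rint_sub_orth h z : intg P h ->
  (forall A, F A -> \int[P]_(w in A) h w = 0) ->
  measurable_wrt F z -> intg P (fun w => z w * h w) ->
  \int[P]_w (z w * h w) = 0.
Proof.
move=> ih h0 mz izh; have mh := intg_meas ih.
have mz' := measurable_wrt_meas mz.
pose zp w := Num.max (z w) 0; pose zn w := Num.max (- z w) 0.
have mzp : measurable_wrt F zp.
  by apply/measurable_wrtP; apply: measurable_maxr => //; exact/measurable_wrtP.
have mzn : measurable_wrt F zn.
  apply/measurable_wrtP; apply: measurable_maxr => //.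
  by apply: measurableT_comp => //; exact/measurable_wrtP.
have zp0 w : 0 <= zp w by rewrite le_max lexx orbT.
have zn0 w : 0 <= zn w by rewrite le_max lexx orbT.
have zE w : z w = zp w - zn w.
  rewrite /zp /zn; have [w0|/ltW w0] := lerP 0 (z w).
    by rewrite max_r ?oppr_le0// subr0.
  by rewrite max_l ?oppr_ge0// sub0r opprK.
have zple w : zp w <= `|z w| by rewrite ge_max ler_norm normr_ge0.
have znle w : zn w <= `|z w| by rewrite ge_max -normrN ler_norm normr_ge0.
have izp : intg P (fun w => zp w * h w).
  apply: (intg_le _ izh); first by apply: measurable_funM => //; exact: measurable_wrt_meas.
  by move=> w; rewrite !normrM ler_wpM2r// ger0_norm.
have izn : intg P (fun w => zn w * h w).
  apply: (intg_le _ izh); first by apply: measurable_funM => //; exact: measurable_wrt_meas.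
  by move=> w; rewrite !normrM ler_wpM2r// ger0_norm.
under eq_Rintegral do rewrite zE mulrBl.
by rewrite RintB// !cond_orth_ge0// subrr.
Qed.

End sub_sigma_algebra.

(** * Increments of a Brownian motion *)


Section law_integral.
Context d (T : measurableType d) (R : realType).
Variables (m : {measure set T -> \bar R}) (X : T -> R).
Variable nu : {measure set (measurableTypeR R) -> \bar R}.
Hypothesis mX : measurable_fun setT X.
Hypothesis lawX : forall C : set R, measurable C -> nu C = m (X @^-1` C).

Lemma ge0_integral_law (h : R -> \bar R) : measurable_fun setT h ->
  (forall x, 0 <= h x)%E -> (\int[nu]_x h x = \int[m]_w h (X w))%E.
Proof.
move=> mh h0.
pose Xm := isMeasurableFun.Build _ _ T (measurableTypeR R) X mX.
pose Xf : {mfun T >-> measurableTypeR R} := HB.pack X Xm.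
transitivity (\int[pushforward m Xf]_x h x)%E.
  apply: (@eq_measure_integral _ (measurableTypeR R) R setT (pushforward m Xf) nu h).
  by move=> A mA _; exact: lawX.
have := @ge0_integral_pushforward _ _ T (measurableTypeR R) R X mX m setT h
  measurableT mh.
by rewrite preimage_setT; apply => y _.
Qed.

End law_integral.

Section normal_moments.
Context (R : realType).
Local Notation leb := (@lebesgue_measure R).

Lemma integral_normal (s : R) (h : R -> R) : s != 0 -> measurable_fun setT h ->
  (forall x, 0 <= h x) ->
  (\int[normal_prob 0 s]_x (h x)%:E = \int[leb]_x (h x * normal_pdf 0 s x)%:E)%E.
Proof.
move=> s0 mh h0.
have mp := measurable_normal_pdf (0 : R) s.
rewrite -(@eq_measure_integral _ _ _ _ (normal_prob 0 s) (dens leb mp (normal_pdf_ge0 0 s)))//.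
by rewrite integral_dens//; exact/measurable_EFinP.
Qed.

(** The integrand is dominated by a multiple of the normal density of standard deviation
    [sqrt 2 * s]: half of the exponent absorbs [x ^+ 2]. *)
Lemma normal_moment2_lty (s : R) : s != 0 ->
  (\int[normal_prob 0 s]_x (x ^+ 2)%:E < +oo)%E.
Proof.
move=> s0; rewrite integral_normal//; last by move=> x; exact: sqr_ge0.
pose r := Num.sqrt 2 * s : R.
have r0 : r != 0 by rewrite mulf_neq0// gt_eqF// sqrtr_gt0.
have r2 : r ^+ 2 = 2 * s ^+ 2 by rewrite exprMn sqr_sqrtr.
pose c := normal_peak s * (4 * s ^+ 2) * (normal_peak r)^-1.
have c0 : 0 <= c.
  rewrite /c mulr_ge0 ?invr_ge0 ?normal_peak_ge0// mulr_ge0 ?normal_peak_ge0//.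
  by rewrite mulr_ge0 ?sqr_ge0.
apply: (@le_lt_trans _ _ (\int[leb]_x (c%:E * (normal_pdf 0 r x)%:E))%E).
  apply: ge0_le_integral => //.
  - by move=> x _; rewrite lee_fin mulr_ge0 ?sqr_ge0 ?normal_pdf_ge0.
  - apply/measurable_EFinP; apply: measurable_funM => //.
    exact: measurable_normal_pdf.
  - apply: emeasurable_funM => //; apply/measurable_EFinP.
    exact: measurable_normal_pdf.
  - move=> x _; rewrite -EFinM lee_fin !normal_pdfE// /normal_fun subr0.
    rewrite (_ : c * _ = normal_peak s * (4 * s ^+ 2 * expR (- x ^+ 2 / (r ^+ 2 *+ 2)))); last first.
      by rewrite /c; field; rewrite gt_eqF// normal_peak_gt0.
    rewrite mulrCA; apply: ler_wpM2l; first exact: normal_peak_ge0.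
    have s2 : 0 < s ^+ 2 by rewrite exprn_even_gt0.
    pose u := x ^+ 2 / (4 * s ^+ 2).
    rewrite (_ : - x ^+ 2 / (s ^+ 2 *+ 2) = - u - u); last by rewrite /u; field.
    rewrite (_ : - x ^+ 2 / (r ^+ 2 *+ 2) = - u); last by rewrite /u r2; field.
    rewrite expRD mulrA; apply: ler_wpM2r; first exact: expR_ge0.
    rewrite (_ : x ^+ 2 = 4 * s ^+ 2 * u); last by rewrite /u; field.
    have u1 : u * expR (- u) <= 1.
      rewrite expRN ler_pdivrMr ?expR_gt0// mul1r.
      by apply: le_trans (expR_ge1Dx u); rewrite lerDr.
    by rewrite -(mulrA (4 * s ^+ 2)); apply: ler_piMr => //; rewrite mulr_ge0// ltW.
rewrite ge0_integralZl//.
- by rewrite integral_normal_pdf// mule1 ltry.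
- by apply/measurable_EFinP; exact: measurable_normal_pdf.
- by move=> x _; rewrite lee_fin normal_pdf_ge0.
Qed.

Lemma normal_symmetric (s : R) (h : R -> R) : s != 0 -> measurable_fun setT h ->
  (forall x, 0 <= h x) ->
  (\int[normal_prob 0 s]_x (h x)%:E = \int[normal_prob 0 s]_x (h (- x))%:E)%E.
Proof.
move=> s0 mh h0.
pose opp : R -> R := fun x => - x.
have mN : measurable_fun setT opp by exact: oppr_measurable.
rewrite !integral_normal//; last exact: measurableT_comp.
have mg : measurable_fun setT (fun x => (h x * normal_pdf 0 s x)%:E).
  apply/measurable_EFinP; apply: measurable_funM => //.
  exact: measurable_normal_pdf.
rewrite (@ge0_integral_law _ (measurableTypeR R) R leb opp leb mN _ _ mg).
- apply: eq_integral => x _ /=; congr ((_ * _)%:E).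
  by rewrite !normal_pdfE// /normal_fun !subr0 sqrrN.
- by move=> A mA; rewrite -[LHS](lebesgue_measureN mA); congr (lebesgue_measure _).
- by move=> y; rewrite lee_fin mulr_ge0 ?normal_pdf_ge0.
Qed.

End normal_moments.

Section independent_variable.
Context d (T : measurableType d) (R : realType) (P : probability T R).
Variables (A : set T) (X : T -> R) (nu : probability (measurableTypeR R) R).
Hypotheses (mA : measurable A) (mX : measurable_fun setT X).
Hypothesis indep : forall C : set R, measurable C ->
  P (A `&` X @^-1` C) = (P A * nu C)%E.

(** Restricted to [A], the variable [X] has the law [nu] scaled by the mass of [A]; the restriction
    is encoded as the density [\1_A]. *)
Lemma integral_indep (h : R -> R) : measurable_fun setT h -> (forall x, 0 <= h x) ->
  (\int[P]_(w in A) (h (X w))%:E = P A * \int[nu]_x (h x)%:E)%E.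
Proof.
move=> mh h0.
have mI : measurable_fun setT (\1_A : T -> R) by [].
have I0 w : 0 <= \1_A w :> R by [].
have mhX : measurable_fun setT (fun w => (h (X w))%:E).
  by apply/measurable_EFinP; exact: measurableT_comp.
transitivity (\int[dens P mI I0]_w (h (X w))%:E)%E.
  rewrite integral_dens//; last by move=> w; rewrite lee_fin.
  rewrite [LHS]integral_mkcond; apply: eq_integral => w _.
  by rewrite patchE indicE; case: ifP => _; rewrite ?mule1 ?mule0.
have PA : P A = (fine (P A))%:E.
  by rewrite fineK// ge0_fin_numE// (le_lt_trans (probability_le1 _ mA))// ltry.
have PA0 : 0 <= fine (P A) by exact: fine_ge0.
rewrite PA -(@ge0_integral_mscale _ _ _ nu _ _ (NngNum PA0))//; last 2 first.
- exact/measurable_EFinP.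
- by move=> x _; rewrite lee_fin.
apply/esym/(ge0_integral_law mX) => //.
- move=> C mC; transitivity (P (A `&` X @^-1` C)).
    by rewrite indep// [in RHS]PA.
  have mXC : measurable (X @^-1` C) by rewrite -[X in measurable X]setTI; exact: mX.
  rewrite -[RHS]/(\int[P]_(w in X @^-1` C) (\1_A w)%:E)%E.
  by rewrite integral_indic// setIC.
- exact/measurable_EFinP.
Qed.

End independent_variable.

Section brownian.
Context d (Om : measurableType d) (R : realType) (P : probability Om R) (T : R).
Variables (F : R -> set (set Om)) (B : R -> Om -> R).
Hypotheses (cF : complete_filtration P T F) (bB : brownian_motion P T F B).

Lemma filtration_sub t : 0 <= t <= T -> F t `<=` measurable.
Proof. by case: cF => _ + _ _ => /[apply]. Qed.

Lemma filtration_sigma t : 0 <= t <= T -> sigma_algebra setT (F t).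
Proof. by case: cF => + _ _ _ => /[apply]. Qed.

Lemma filtration_mono s t : 0 <= s -> s <= t -> t <= T -> F s `<=` F t.
Proof. by case: cF => _ _ + _; exact. Qed.

Lemma measurable_wrt_mono s t (X : Om -> R) : 0 <= s -> s <= t -> t <= T ->
  measurable_wrt (F s) X -> measurable_wrt (F t) X.
Proof. by move=> s0 st tT mX C mC; apply: (filtration_mono s0 st tT); exact: mX. Qed.

Lemma brownian_meas t : 0 <= t <= T -> measurable_fun setT (B t).
Proof.
move=> t0; apply: (measurable_wrt_meas (filtration_sub t0)).
by case: bB => _ _ + _; exact.
Qed.

Lemma increment_meas s t : 0 <= s -> s <= t -> t <= T ->
  measurable_fun setT (fun w => B t w - B s w).
Proof.
by move=> s0 st tT; apply: measurable_funB; apply: brownian_meas; lra.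
Qed.

Lemma sqint_increment s t : 0 <= s -> s <= t -> t <= T ->
  sqint P (fun w => B t w - B s w).
Proof.
move=> s0; rewrite le_eqVlt => /predU1P[-> _|st tT].
  by under eq_fun do rewrite subrr; exact: sqint_cst.
have mD := increment_meas s0 (ltW st) tT.
split => //.
have sd0 : Num.sqrt (t - s) != 0 by rewrite gt_eqF// sqrtr_gt0 subr_gt0.
rewrite (@integral_indep _ _ _ P setT _ (normal_prob 0 (Num.sqrt (t - s))) measurableT mD _ (fun x => x ^+ 2))//.
- by rewrite [X in (X * _)%E]probability_setT mul1e; exact: normal_moment2_lty.
- move=> C mC; rewrite setTI [X in (X * _)%E]probability_setT mul1e.
  by case: bB => _ _ _ /(_ s t s0 st tT C mC)[].
- by move=> x; exact: sqr_ge0.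
Qed.

(** The normal law is symmetric, so the positive and negative parts of the increment have equal
    integrals over every event of the past. *)
Lemma increment_mean0 s t A : 0 <= s -> s <= t -> t <= T -> F s A ->
  \int[P]_(w in A) (B t w - B s w) = 0.
Proof.
move=> s0; rewrite le_eqVlt => /predU1P[-> _ _|st tT FA].
  by rewrite /Rintegral integral0_eq// => w _; rewrite subrr.
have mD := increment_meas s0 (ltW st) tT.
have mA : measurable A by apply: (filtration_sub _ FA); lra.
have sd0 : Num.sqrt (t - s) != 0 by rewrite gt_eqF// sqrtr_gt0 subr_gt0.
set N := normal_prob 0 (Num.sqrt (t - s)).
have ind C : measurable C ->
    P (A `&` (fun w => B t w - B s w) @^-1` C) = (P A * N C)%E.
  move=> mC; case: bB => _ _ _ /(_ s t s0 st tT C mC)[NE] /(_ A FA) ->.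
  by rewrite NE.
pose p x : R := Num.max x 0; pose n x : R := Num.max (- x) 0.
have mp : measurable_fun setT p by apply: measurable_maxr.
have mn : measurable_fun setT n by apply: measurable_maxr.
have p0 x : 0 <= p x by rewrite le_max lexx orbT.
have n0 x : 0 <= n x by rewrite le_max lexx orbT.
have pn x : x = p x - n x.
  rewrite /p /n; have [w0|/ltW w0] := lerP 0 x.
    by rewrite max_r ?oppr_le0// subr0.
  by rewrite max_l ?oppr_ge0// sub0r opprK.
have iD : P.-integrable A (EFin \o (fun w => B t w - B s w)).
  apply: (@integrableS _ _ _ _ setT) => //.
  exact: (sqint_intg (sqint_increment s0 (ltW st) tT)).
have ip : P.-integrable A (EFin \o (fun w => p (B t w - B s w))).
  apply: (le_integrable mA _ _ iD).
    by apply: measurable_funTS; apply/measurable_EFinP; exact: measurableT_comp.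
  by move=> w _; rewrite /= lee_fin ger0_norm// ge_max ler_norm normr_ge0.
have i_n : P.-integrable A (EFin \o (fun w => n (B t w - B s w))).
  apply: (le_integrable mA _ _ iD).
    by apply: measurable_funTS; apply/measurable_EFinP; exact: measurableT_comp.
  by move=> w _; rewrite /= lee_fin ger0_norm// ge_max -normrN ler_norm normr_ge0.
under eq_Rintegral do rewrite [_ - _]pn.
rewrite RintegralB//; apply/eqP; rewrite subr_eq0; apply/eqP; congr fine.
rewrite (integral_indep mA mD ind mp p0) (integral_indep mA mD ind mn n0).
by congr (_ * _)%E; rewrite (normal_symmetric sd0 mp p0).
Qed.

Lemma increment_orth s t z : 0 <= s -> s <= t -> t <= T ->
  measurable_wrt (F s) z -> sqint P z ->
  \int[P]_w (z w * (B t w - B s w)) = 0.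
Proof.
move=> s0 st tT mz sz.
have s1 : 0 <= s <= T by lra.
apply: (Rint_sub_orth (filtration_sigma s1) (filtration_sub s1)) => //.
- exact/sqint_intg/sqint_increment.
- by move=> A FA; exact: increment_mean0.
- exact: sqintM sz (sqint_increment s0 st tT).
Qed.

Lemma sqint_brownian t : 0 <= t <= T -> sqint P (B t).
Proof.
move=> t0; have t1 : 0 <= t /\ t <= T by lra.
apply: (@sqint_ae _ _ _ _ _ (fun w => B t w - B 0 w)).
- exact: brownian_meas.
- by apply: sqint_increment; lra.
- by case: bB => B0 _ _ _; apply: filterS B0 => w ->; rewrite subr0.
Qed.

End brownian.

(** * Progressive processes and their time integrals *)


Section uniform_time.
Context (R : realType) (T : R) (T0 : 0 < T).
Local Notation leb := (@lebesgue_measure R).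

(** Time is made a probability space, so that processes are functions on a product of probabilities;
    the factor [T] in the formulas below undoes the normalisation. *)
Definition unifT : probability (measurableTypeR R) R := uniform_prob T0.

Lemma ge0_integral_unifT (f : R -> \bar R) : measurable_fun setT f ->
  (forall x, 0 <= f x)%E ->
  (\int[leb]_(x in `[0%R, T]) f x = T%:E * \int[unifT]_x f x)%E.
Proof.
move=> mf f0; rewrite /unifT integral_uniform// subr0 muleA -EFinM mulfV ?gt_eqF//.
by rewrite mul1e.
Qed.

Lemma Rintegral_unifT (f : R -> R) : intg unifT f ->
  \int[leb]_(x in `[0, T]) f x = T * \int[unifT]_x f x.
Proof.
move=> fi; have mf : measurable_fun setT (EFin \o f) by exact: measurable_int fi.
have Tfin : T%:E \is a fin_num by [].
have fip := integrable_pos_fin_num measurableT fi.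
have fin := integrable_neg_fin_num measurableT fi.
rewrite /Rintegral.
have -> : (\int[leb]_(x in `[0%R, T]) (f x)%:E = T%:E * \int[unifT]_x (f x)%:E)%E.
  rewrite [in RHS]integralE muleBr//; last by rewrite fin_num_adde_defl// fin_numN.
  rewrite [LHS]integralE; congr (_ - _)%E.
    exact: (ge0_integral_unifT (measurable_funepos mf) (funepos_ge0 _)).
  exact: (ge0_integral_unifT (measurable_funeneg mf) (funeneg_ge0 _)).
by rewrite fineM//; exact: integrable_fin_num.
Qed.

End uniform_time.

Section processes.
Context d (Om : measurableType d) (R : realType) (P : probability Om R).
Variables (T : R) (F : R -> set (set Om)).
Hypotheses (T0 : 0 < T) (cF : complete_filtration P T F).
Implicit Types (a b : R -> Om -> R) (s t l r : R).
Local Notation leb := (@lebesgue_measure R).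
Local Notation mR := (measurableTypeR R).
Local Notation gF t := (g_sigma_algebraType (F t)).
Local Notation Q := (pprod (unifT T0) P).

(** Extension by 0 outside [[0, t]]: progressive measurability becomes measurability of functions on
    the full product, see [progressiveP]. *)
Definition tcut t a (z : mR * Om) : R := if 0 <= z.1 <= t then a z.1 z.2 else 0.

Definition tint a (w : Om) : R := \int[leb]_(s in `[0, T]) a s w.

(** The scalar product [E int_0^T a b dt] of controls. *)
Definition inner a b : R := T * \int[Q]_z (tcut T a z * tcut T b z).

Lemma measurable_strip d' (U : measurableType d') t :
  measurable [set z : mR * U | 0 <= z.1 <= t].
Proof.
rewrite (_ : [set z | _] = (`[0, t]%classic : set mR) `*` setT).
  exact: measurableX.
by apply/seteqP; split => [z|z []] /=; rewrite in_itv/=.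
Qed.

Lemma progressiveP a : progressive T F a <->
  forall t, 0 <= t <= T -> measurable_fun setT (tcut t a : (mR * gF t)%type -> R).
Proof.
have prodE t : 0 <= t <= T -> @measurable _ (mR * gF t)%type =
    <<s [set A `*` B | A in (@measurable _ mR) & B in F t] >>.
  move=> tT; rewrite measurable_prod_measurableType//.
  by rewrite (measurable_g_measurableTypeE (filtration_sigma cF tT)).
split=> pa t tT; last first.
  move=> C mC; rewrite -prodE//.
  have := @measurable_strip _ (gF t) t => mS.
  have mC' : measurable (tcut t a @^-1` C : set (mR * gF t)).
    by rewrite -[X in measurable X]setTI; exact: pa.
  rewrite (_ : [set z | _] = [set z : mR * gF t | 0 <= z.1 <= t] `&` tcut t a @^-1` C).
    exact: measurableI.
  by apply/seteqP; split => z /=; rewrite /tcut/= => -[-> ?].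
move=> _ C mC; rewrite setTI.
have := pa t tT C mC; rewrite -prodE// => mA.
have := @measurable_strip _ (gF t) t => mS.
(* Outside the strip the cut process is 0, so the complement of the strip belongs to the preimage
   exactly if [C] contains 0. *)
have [C0|C0] := pselect (C 0).
  rewrite (_ : _ @^-1` _ = [set z : mR * gF t | 0 <= z.1 <= t /\ C (a z.1 z.2)]
     `|` ~` [set z : mR * gF t | 0 <= z.1 <= t]).
    by apply: measurableU => //; exact: measurableC.
  apply/seteqP; split => z /=; rewrite /tcut; case: ifPn => // zt.
  - by left.
  - by right; exact/negP.
  - by case=> [[]|].
rewrite (_ : _ @^-1` _ = [set z : mR * gF t | 0 <= z.1 <= t /\ C (a z.1 z.2)])//.
by apply/seteqP; split => z /=; rewrite /tcut; case: ifPn => // zt; case.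
Qed.

Lemma progressive_meas a : progressive T F a -> measurable_fun setT (tcut T a).
Proof.
move=> /progressiveP/(_ T); rewrite lexx andbT => /(_ (ltW T0)) mc.
have tT : 0 <= T <= T by rewrite lexx ltW.
have mi : measurable_fun setT (fun z : mR * Om => (z.1, z.2) : (mR * gF T)%type).
  apply: measurable_fun_pair; first exact: measurable_fst.
  exact: (measurableT_comp (measurable_id_sub (filtration_sigma cF tT)
    (filtration_sub cF tT)) measurable_snd).
have e : tcut T a \o (fun z : mR * Om => (z.1, z.2)) = tcut T a.
  by apply/funext => -[].
by rewrite -e; exact: (measurableT_comp mc mi).
Qed.

Lemma progressive_section a t : progressive T F a -> 0 <= t <= T ->
  measurable_wrt (F t) (a t).
Proof.
move=> pa tT; apply/(measurable_wrtP (filtration_sigma cF tT)).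
move: pa => /progressiveP/(_ t tT) mc.
rewrite (_ : a t = fun w => tcut t a (t, w)).
  exact: (measurable_fun_pair2 (t : mR)).
by apply/funext => w; rewrite /tcut/= lexx andbT; case/andP: tT => ->.
Qed.

Lemma cut_lin t a b c (z : mR * Om) :
  tcut t (fun t w => a t w + c * b t w) z = tcut t a z + c * tcut t b z.
Proof. by rewrite /tcut; case: ifP => //; rewrite mulr0 addr0. Qed.

Lemma progressive_lin a b c : progressive T F a -> progressive T F b ->
  progressive T F (fun t w => a t w + c * b t w).
Proof.
move=> /progressiveP pa /progressiveP pb; apply/progressiveP => t tT.
rewrite (_ : tcut _ _ = fun z => tcut t a z + c * tcut t b z).
  by apply: measurable_funD; [exact: pa|apply: measurable_funM => //; exact: pb].
by apply/funext => z; exact: cut_lin.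
Qed.

Definition restr l r a : R -> Om -> R := fun t w => (l < t <= r)%R%:R * a t w.

(** The control equal to [z] on []l, r]] and to 0 elsewhere: the elementary deviation with which the
    first order condition is tested. *)
Definition step l r (z : Om -> R) : R -> Om -> R := restr l r (fun=> z).

Lemma measurable_window d' (U : measurableType d') l r :
  measurable_fun setT (fun z : mR * U => (l < z.1 <= r)%R%:R : R).
Proof.
pose S : set (mR * U) := [set` `]l, r]] `*` setT.
rewrite (_ : (fun z => _) = \1_S).
  by apply: measurable_indic; apply: measurableX => //; exact: measurable_itv.
apply/funext => z; rewrite indicE; have [h|h] := boolP (l < z.1 <= r).
  by rewrite mem_set// /S; split => //=; rewrite in_itv.
by rewrite memNset// => -[]; rewrite /= in_itv/= (negbTE h).
Qed.

Lemma progressive_restr l r a : progressive T F a -> progressive T F (restr l r a).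
Proof.
move=> /progressiveP pa; apply/progressiveP => t tT.
rewrite (_ : tcut _ _ = fun z => (l < z.1 <= r)%R%:R * tcut t a z).
  by apply: measurable_funM; [exact: measurable_window|exact: pa].
by apply/funext => z; rewrite /tcut /restr; case: ifP => //; rewrite mulr0.
Qed.

Lemma progressive_step l r z : 0 <= l -> measurable_wrt (F l) z ->
  progressive T F (step l r z).
Proof.
move=> l0 mz; apply/progressiveP => t tT.
(* Up to time [l] the process vanishes; afterwards [F l] is contained in [F t]. *)
have [tl|lt] := leP t l.
  rewrite (_ : tcut t (step l r z) = fun=> 0)//; apply/funext => x; rewrite /tcut /step /restr.
  case: ifP => // /andP[_ xt]; rewrite ltNge (le_trans xt tl)/= mul0r//.
rewrite (_ : tcut t (step l r z) = fun x : mR * gF t =>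
  \1_[set z : mR * gF t | 0 <= z.1 <= t] x * ((l < x.1 <= r)%R%:R * z x.2)).
  apply: measurable_funM; first exact: (measurable_indic (@measurable_strip _ (gF t) t)).
  apply: measurable_funM; first exact: measurable_window.
  have tT' : t <= T by case/andP: tT.
  have mzt : measurable_fun setT (z : gF t -> R).
    apply/(measurable_wrtP (filtration_sigma cF tT)).
    exact: (measurable_wrt_mono cF l0 (ltW lt) tT' mz).
  exact: (measurableT_comp mzt measurable_snd).
apply/funext => x; rewrite indicE /tcut /step /restr; case: ifPn => xt.
  by rewrite mem_set ?mul1r.
by rewrite memNset ?mul0r//=; exact/negP.
Qed.

(** By Tonelli the iterated integral in [H2] is [T] times an integral over the product, so that
    controls are handled as square integrable functions. *)
Lemma H2P a : H2 P T F a <-> progressive T F a /\ sqint Q (tcut T a).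
Proof.
suff key : progressive T F a ->
  (\int[P]_w \int[leb]_(t in `[0%R, T]) ((a t w) ^+ 2)%:E
    = T%:E * \int[Q]_z ((tcut T a z) ^+ 2)%:E)%E.
  split=> -[pa ia]; split=> //.
  - split; first exact: progressive_meas.
    move: ia; rewrite key// => ia; rewrite ltey; apply/eqP => e; move: ia.
    by rewrite e gt0_muley ?lte_fin// ltxx.
  - rewrite key//; case: ia => _ ia.
    by rewrite lte_mul_pinfty// lee_fin ltW.
move=> pa; have mc := progressive_meas pa.
have mc2 : measurable_fun setT (fun z => ((tcut T a z) ^+ 2)%:E).
  exact/measurable_EFinP/measurable_funX.
have -> : (\int[Q]_z ((tcut T a z) ^+ 2)%:E =
    \int[P]_w \int[unifT T0]_t ((tcut T a (t, w)) ^+ 2)%:E)%E.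
  apply: (etrans (fubini_tonelli1 (m1 := unifT T0) (m2 := P) _ mc2 _)).
    by move=> z; rewrite lee_fin sqr_ge0.
  apply: fubini_tonelli => //.
  by move=> z; rewrite lee_fin sqr_ge0.
rewrite -ge0_integralZl//; last 3 first.
- apply: (measurable_fun_fubini_tonelli_G (m1 := unifT T0) _ mc2).
  by move=> z; rewrite lee_fin sqr_ge0.
- by move=> w _; apply: integral_ge0 => t _; rewrite lee_fin sqr_ge0.
- by rewrite lee_fin ltW.
apply: eq_integral => w _; rewrite -ge0_integral_unifT//.
- apply: eq_integral => t; rewrite inE/= in_itv/= => tT.
  by rewrite /tcut/= tT.
- exact: (measurableT_comp mc2 (pair2_measurable w)).
- by move=> t; rewrite lee_fin sqr_ge0.
Qed.

Lemma H2_lin a b c : H2 P T F a -> H2 P T F b ->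
  H2 P T F (fun t w => a t w + c * b t w).
Proof.
move=> /H2P[pa sa] /H2P[pb sb]; apply/H2P; split; first exact: progressive_lin.
rewrite (_ : tcut T _ = fun z => tcut T a z + c * tcut T b z); last first.
  by apply/funext => z; exact: cut_lin.
exact/sqintD/sqintZ.
Qed.

Lemma cut_restr l r a z : tcut T (restr l r a) z = (l < z.1 <= r)%R%:R * tcut T a z.
Proof. by rewrite /tcut /restr; case: ifP => //; rewrite mulr0. Qed.

Lemma H2_restr l r a : H2 P T F a -> H2 P T F (restr l r a).
Proof.
move=> /H2P[pa sa]; apply/H2P; split; first exact: progressive_restr.
rewrite (_ : tcut T _ = fun z => (l < z.1 <= r)%R%:R * tcut T a z); last first.
  by apply/funext => z; exact: cut_restr.
apply: (@sqintMb _ _ _ _ _ _ 1) => //; first exact: measurable_window.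
by move=> z; case: (_ < _ <= _); rewrite ?normr1 ?normr0.
Qed.

Lemma H2_step l r z : 0 <= l -> measurable_wrt (F l) z -> sqint P z ->
  H2 P T F (step l r z).
Proof.
move=> l0 mz sz; have ps := progressive_step r l0 mz; apply/H2P; split => //.
apply: (sqint_le (progressive_meas ps) (sqint_snd (unifT T0) sz)) => x.
rewrite /tcut /step /restr; case: ifP; last by rewrite normr0.
by case: (_ < _ <= _); rewrite ?mul1r// mul0r normr0.
Qed.

Lemma H2_sqint_section a : H2 P T F a ->
  {ae P, forall w, sqint (unifT T0) (fun s => tcut T a (s, w))}.
Proof. by move=> /H2P[_] /sqint_section2. Qed.

Lemma tint_avg a : H2 P T F a ->
  {ae P, forall w, tint a w = T * \int[unifT T0]_s tcut T a (s, w)}.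
Proof.
move=> /H2_sqint_section; apply: filterS => w sw.
rewrite -Rintegral_unifT; last exact: sqint_intg.
by apply: eq_Rintegral => t; rewrite inE/= in_itv/= /tcut/= => ->.
Qed.

Lemma measurable_tint_wrt a t : progressive T F a -> 0 <= t <= T ->
  measurable_wrt (F t) (fun w => \int[leb]_(s in `[0, t]) a s w).
Proof.
move=> pa tT; apply/(measurable_wrtP (filtration_sigma cF tT)).
move: pa => /progressiveP/(_ t tT) mc.
rewrite (_ : (fun w => _) = fun w => \int[leb]_s tcut t a (s, w)).
  exact: (measurable_Rintegral2 leb mc).
apply/funext => w; rewrite Rintegral_mkcond; apply: eq_Rintegral => s _.
rewrite patchE /tcut/=; case: ifPn; first by rewrite inE/= in_itv/= => ->.
by rewrite notin_setE/= in_itv/= => /negP/negbTE ->.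
Qed.

Lemma measurable_tint a : progressive T F a -> measurable_fun setT (tint a).
Proof.
move=> pa; have tT : 0 <= T <= T by rewrite lexx ltW.
exact: (measurable_wrt_meas (filtration_sub cF tT) (measurable_tint_wrt pa tT)).
Qed.

Lemma sqint_tint a : H2 P T F a -> sqint P (tint a).
Proof.
move=> /[dup] Ha /H2P[pa /sqint_average2[sa _]].
apply: (sqint_ae _ _ (tint_avg Ha)); first exact: measurable_tint.
exact: sqintZ.
Qed.

Lemma tint_lin a b c : H2 P T F a -> H2 P T F b ->
  {ae P, forall w, tint (fun t w => a t w + c * b t w) w = tint a w + c * tint b w}.
Proof.
move=> Ha Hb.
apply: filterS3 (H2_sqint_section Ha) (H2_sqint_section Hb) (filterI (tint_avg Ha) (filterI (tint_avg Hb) (tint_avg (H2_lin c Ha Hb)))) => w sa sb [-> [-> ->]].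
under eq_Rintegral do rewrite cut_lin.
by rewrite RintD ?RintZ//; [ring|exact: sqint_intg..|exact/intgZ/sqint_intg].
Qed.

(** Fubini: pairing a terminal variable with an integrated control amounts to pairing it with the
    control at every time. Seen as a process constant in time, [z] is in general not adapted. *)
Lemma tint_inner a (z : Om -> R) : H2 P T F a -> sqint P z ->
  \int[P]_w (z w * tint a w) = T * \int[Q]_x (z x.2 * tcut T a x).
Proof.
move=> Ha sz; have [pa sa] := (H2P a).1 Ha.
have [sA _] := sqint_average2 sa.
rewrite -average2M// -RintZ; last exact: sqintM.
apply: Rint_ae.
- apply: measurable_funM; [exact: sqint_meas sz|exact: measurable_tint].
- apply: measurable_funM => //; apply: measurable_funM; first exact: sqint_meas sz.
  exact: sqint_meas sA.
- by apply: filterS (tint_avg Ha) => w ->; ring.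
Qed.

Lemma inner_sym a b : inner a b = inner b a.
Proof. by rewrite /inner; under eq_Rintegral do rewrite mulrC. Qed.

Lemma inner_ge0 a : 0 <= inner a a.
Proof.
apply: mulr_ge0; first exact: ltW.
by apply: Rintegral_ge0 => z _; rewrite -expr2 sqr_ge0.
Qed.

Lemma inner_linr a b c e : H2 P T F a -> H2 P T F b -> H2 P T F e ->
  inner e (fun t w => a t w + c * b t w) = inner e a + c * inner e b.
Proof.
move=> /H2P[_ sa] /H2P[_ sb] /H2P[_ se]; rewrite /inner.
under eq_Rintegral do rewrite cut_lin mulrDr mulrCA.
by rewrite RintD ?RintZ; [ring|exact: sqintM..|exact/intgZ/sqintM].
Qed.

(** Jensen's inequality for the uniform law in time. It lets the running cost of a deviation
    dominate the displacement that the deviation causes. *)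
Lemma tint_sqr_le a : H2 P T F a -> \int[P]_w (tint a w ^+ 2) <= T * inner a a.
Proof.
move=> Ha; have [pa sa] := (H2P a).1 Ha; have [sA le1] := sqint_average2 sa.
rewrite (_ : \int[P]_w _ = T ^+ 2 * \int[P]_w ((\int[unifT T0]_s tcut T a (s, w)) ^+ 2)).
  rewrite /inner mulrA -expr2; apply: ler_wpM2l; first exact: sqr_ge0.
  by under [leRHS]eq_Rintegral do rewrite -expr2.
rewrite -RintZ; last exact: sqint_intg2.
apply: Rint_ae.
- exact/measurable_funX/measurable_tint.
- by apply: measurable_funM => //; apply: measurable_funX; exact: sqint_meas sA.
- by apply: filterS (tint_avg Ha) => w ->; rewrite exprMn.
Qed.

Lemma inner_step a l r z : 0 <= l -> measurable_wrt (F l) z -> sqint P z ->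
  H2 P T F a -> inner (step l r z) a = \int[P]_w (z w * tint (restr l r a) w).
Proof.
move=> l0 mz sz Ha; rewrite (tint_inner (H2_restr l r Ha) sz).
rewrite /inner; congr (_ * _); apply: eq_Rintegral => x _.
rewrite cut_restr /tcut /step /restr; case: ifP => _; last by rewrite !mulr0.
by ring.
Qed.

Lemma inner_restr a l r : inner a (restr l r a) = inner (restr l r a) (restr l r a).
Proof.
rewrite /inner; congr (_ * _); apply: eq_Rintegral => x _; rewrite !cut_restr.
by case: (_ < _ <= _); rewrite ?mul1r ?mul0r// mulr0.
Qed.

Lemma tint_restr l r a w : 0 <= l -> l <= r -> r <= T ->
  tint (restr l r a) w = \int[leb]_(s in `]l, r]) a s w.
Proof.
move=> l0 lr rT; rewrite /tint Rintegral_mkcond [RHS]Rintegral_mkcond.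
apply: eq_Rintegral => s _; rewrite !patchE /restr.
have [h|h] := boolP (l < s <= r).
  rewrite !mem_set ?mul1r//= in_itv//=; lra.
rewrite mul0r if_same memNset//= in_itv/=; exact/negP.
Qed.

Lemma tint_step l r z w : 0 <= l -> l <= r -> r <= T ->
  tint (step l r z) w = (r - l) * z w.
Proof.
move=> l0 lr rT; rewrite tint_restr// Rintegral_cst//.
rewrite [X in fine X](_ : _ = (r - l)%:E).
  by rewrite mulrC.
apply: etrans (lebesgue_measure_itv _) _; rewrite /= lte_fin.
case: ltP => // rl; congr (_%:E); apply/esym/eqP.
by rewrite subr_eq0 eq_le rl lr.
Qed.

Lemma measurable_tint_restr l r a : 0 <= l -> l <= r -> r <= T ->
  progressive T F a -> measurable_wrt (F r) (tint (restr l r a)).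
Proof.
move=> l0 lr rT pa; have r0 : 0 <= r <= T by rewrite rT (le_trans l0).
have := measurable_tint_wrt (progressive_restr l r pa) r0.
congr (measurable_wrt _ _); apply/funext => w; rewrite tint_restr//.
rewrite Rintegral_mkcond [RHS]Rintegral_mkcond.
apply: eq_Rintegral => s _; rewrite !patchE /restr.
have [h|h] := boolP (l < s <= r).
  rewrite !mem_set ?mul1r//= in_itv//=; lra.
rewrite mul0r if_same memNset//= in_itv/=; exact/negP.
Qed.

End processes.

(** * Laws and the Wasserstein distance *)


Lemma sub_sigma_of (T : Type) (G M : set (set T)) : sigma_algebra setT M ->
  G `<=` M -> <<s G >> `<=` M.
Proof. by move=> sM GM A; apply; split. Qed.

Lemma sigma_algebra_gen (T : Type) (G : set (set T)) : sigma_algebra setT <<s G >>.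
Proof. exact: smallest_sigma_algebra. Qed.

Lemma pi_lambda (T : Type) (G : set (set T)) (M : set (set T)) :
  setI_closed G -> dynkin M -> G `<=` M -> <<s G >> `<=` M.
Proof.
move=> GI dM GM; rewrite -(setI_closed_g_dynkin_g_sigma_algebra GI).
by move=> A; apply; split.
Qed.

Section pi_ext.
Context d (T : measurableType d) (R : realType).
Variables (m1 m2 : {measure set T -> \bar R}) (G : set (set T)).
Hypotheses (GI : setI_closed G) (Gm : G `<=` measurable).
Hypotheses (mT : m1 setT = m2 setT) (m1y : (m1 setT < +oo)%E).
Hypothesis mG : forall A, G A -> m1 A = m2 A.

Lemma pi_ext A : <<s G >> A -> m1 A = m2 A.
Proof.
pose M : set (set T) := [set A | measurable A /\ m1 A = m2 A].
have m2y : (m2 setT < +oo)%E by rewrite -mT.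
suff dM : dynkin M.
  move=> sA; suff [] : M A by [].
  by apply: (pi_lambda GI dM) sA => B GB; split; [exact: Gm|exact: mG].
split.
- by split.
- move=> B [mB e]; split; first exact: measurableC.
  rewrite -setTD (@measureD _ _ _ m1)// (@measureD _ _ _ m2)// !setTI.
  by congr (_ - _)%E; [exact: mT|exact: e].
- move=> B tB MB; split.
    by apply: bigcupT_measurable => i; case: (MB i).
  have mB i : measurable (B i) by case: (MB i).
  have mUB : measurable (\bigcup_i B i) by exact: bigcupT_measurable.
  have c1 := @measure_semi_sigma_additive _ _ _ m1 B mB tB mUB.
  have c2 := @measure_semi_sigma_additive _ _ _ m2 B mB tB mUB.
  have e : (fun n => \sum_(0 <= i < n) m1 (B i))%E = (fun n => \sum_(0 <= i < n) m2 (B i))%E.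
    by apply/funext => n; apply: eq_bigr => i _; case: (MB i).
  by move: c1; rewrite e => c1; exact: (cvg_unique _ c1 c2).
Qed.

End pi_ext.

Section independence.
Context d (T : measurableType d) (R : realType) (P : probability T R).

(** The trace of [P] on [A] and the multiple of [P] by the mass of [A] are finite measures of equal
    mass that agree on a pi-system. *)
Lemma pi_indep (A : set T) (G : set (set T)) : measurable A -> setI_closed G ->
  G `<=` measurable -> (forall B, G B -> P (A `&` B) = (P A * P B)%E) ->
  forall B, <<s G >> B -> P (A `&` B) = (P A * P B)%E.
Proof.
move=> mA GI Gm PG B sB.
have PA : P A = (fine (P A))%:E.
  by rewrite fineK// ge0_fin_numE// (le_lt_trans (probability_le1 _ mA))// ltry.
have PA0 : 0 <= fine (P A) by exact: fine_ge0.
have rE C : mrestr P mA C = P (A `&` C) by rewrite /mrestr setIC.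
have sE C : mscale (NngNum PA0) P C = (P A * P C)%E by rewrite [in RHS]PA.
rewrite -rE -sE; apply: (pi_ext GI Gm) sB.
- apply: etrans (rE _) _; apply: etrans _ (esym (sE _)).
  by rewrite setIT [X in (_ * X)%E](@probability_setT _ _ _ P) mule1.
- by rewrite [X in (X < _)%E](rE _) setIT (le_lt_trans (probability_le1 _ mA))// ltry.
- by move=> C GC; apply: etrans (rE _) _; apply: etrans _ (esym (sE _)); exact: PG.
Qed.

End independence.

Section laws_of_variables.
Context (R : realType).
Local Notation mR := (measurableTypeR R).

Lemma exists_law d (T : measurableType d) (P : probability T R) (X : T -> R) :
  sqint P X -> exists m : P2 R, has_law P X m.
Proof.
move=> [mX sX].
pose Xm := isMeasurableFun.Build _ _ T mR X mX.
pose Xf : {mfun T >-> mR} := HB.pack X Xm.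
pose nu : probability mR R := distribution P Xf.
have nuE C : measurable C -> nu C = P (X @^-1` C) by [].
have nu2 : (\int[nu]_x (x ^+ 2)%:E < +oo)%E.
  rewrite (ge0_integral_law mX nuE)//.
    exact/measurable_EFinP/measurable_funX.
  by move=> x; rewrite lee_fin sqr_ge0.
by exists (MkP2 nu2).
Qed.

(** Total, with the law of the constant 0 as default: it is applied to all sections of a square
    integrable function, only almost all of which are square integrable. *)
Definition law_of d (T : measurableType d) (P : probability T R) (X : T -> R) : P2 R :=
  if pselect (sqint P X) is left h then projT1 (cid (exists_law h))
  else projT1 (cid (exists_law (sqint_cst P 0))).

Lemma law_ofP d (T : measurableType d) (P : probability T R) (X : T -> R) :
  sqint P X -> has_law P X (law_of P X).
Proof. by move=> sX; rewrite /law_of; case: pselect => // h; case: cid. Qed.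

Lemma law_of0 d (T : measurableType d) (P : probability T R) (X : T -> R) :
  ~ sqint P X -> law_of P X = law_of P (fun=> 0).
Proof.
move=> nX; rewrite /law_of; case: pselect => // _.
by case: pselect => [h|/(_ (sqint_cst P 0))//]; congr (projT1 (cid _)); exact: Prop_irrelevance.
Qed.

(** The joint law of [X] and [Y] is one of the couplings in the infimum. *)
Lemma W2_le d (T : measurableType d) (P : probability T R) (X Y : T -> R) (m m' : P2 R) :
  sqint P X -> sqint P Y -> has_law P X m -> has_law P Y m' ->
  W2 m m' <= Num.sqrt (\int[P]_w ((X w - Y w) ^+ 2)).
Proof.
move=> sX sY lX lY; have sXY := sqintB sX sY.
have mX := sqint_meas sX; have mY := sqint_meas sY.
have mXY : measurable_fun setT (fun w => (X w, Y w) : (mR * mR)%type).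
  by apply: measurable_fun_pair.
pose Zm := isMeasurableFun.Build _ _ T (mR * mR)%type (fun w => (X w, Y w)) mXY.
pose Zf : {mfun T >-> (mR * mR)%type} := HB.pack (fun w => (X w, Y w) : (mR * mR)%type) Zm.
pose gam : probability (mR * mR)%type R := distribution P Zf.
have cgam : coupling m m' gam.
  move=> C mC; split.
    rewrite lX// -[LHS]/(P (Zf @^-1` (C `*` setT))); congr (P _).
    by apply/seteqP; split => [w []|w].
  rewrite lY// -[LHS]/(P (Zf @^-1` (setT `*` C))); congr (P _).
  by apply/seteqP; split => [w []|w].
have mh : measurable_fun setT (fun z : (mR * mR)%type => ((z.1 - z.2) ^+ 2)%:E).
  apply/measurable_EFinP/measurable_funX; apply: measurable_funB.
    exact: measurable_fst.
  exact: measurable_snd.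
have e : (\int[gam]_z ((z.1 - z.2) ^+ 2)%:E = \int[P]_w ((X w - Y w) ^+ 2)%:E)%E.
  have := @ge0_integral_pushforward _ _ T (mR * mR)%type R _ mXY P setT _ measurableT mh.
  by rewrite preimage_setT; apply => z _; rewrite lee_fin sqr_ge0.
rewrite /W2 ler_sqrt; last by apply: Rint_ge0 => w; exact: sqr_ge0.
have fin : (\int[P]_w ((X w - Y w) ^+ 2)%:E)%E \is a fin_num.
  by apply: (@integrable_fin_num _ _ _ P setT) => //; exact: sqint_intg2.
have inf_le : (ereal_inf [set (\int[gam]_z ((z.1 - z.2) ^+ 2)%:E)%E | gam in coupling m m']
    <= \int[P]_w ((X w - Y w) ^+ 2)%:E)%E.
  by apply: ereal_inf_lbound; exists gam.
have inf_ge : (0 <= ereal_inf [set (\int[gam]_z ((z.1 - z.2) ^+ 2)%:E)%E | gam in coupling m m'])%E.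
  apply: le_ereal_inf_tmp => _ [g' _ <-]; apply: integral_ge0 => z _.
  by rewrite lee_fin sqr_ge0.
apply: fine_le => //.
rewrite ge0_fin_numE//; apply: (le_lt_trans inf_le).
by rewrite -ge0_fin_numE// (le_trans inf_ge).
Qed.

Lemma W2_ge0 (m m' : P2 R) : 0 <= W2 m m'.
Proof. exact: sqrtr_ge0. Qed.

Lemma W2_same_law d (T : measurableType d) (P : probability T R) (X : T -> R) (m m' : P2 R) :
  sqint P X -> has_law P X m -> has_law P X m' -> W2 m m' = 0.
Proof.
move=> sX lX lX'; apply/eqP; rewrite eq_le W2_ge0 andbT.
apply: (le_trans (W2_le sX sX lX lX')).
under eq_Rintegral do rewrite subrr expr0n/=.
by rewrite Rint_cst sqrtr0.
Qed.

End laws_of_variables.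

(** * Path space *)


Section sub_sigma_algebra_closure.
Context (T : pointedType) (R : realType) (F : set (set T)).
Hypothesis sF : sigma_algebra setT F.

Lemma sigma_setI A B : F A -> F B -> F (A `&` B).
Proof.
rewrite -(measurable_g_measurableTypeE sF) => mA mB.
exact: (@measurableI _ (g_sigma_algebraType F)).
Qed.

Lemma sigma_setT : F setT.
Proof.
by rewrite -(measurable_g_measurableTypeE sF); exact: (@measurableT _ (g_sigma_algebraType F)).
Qed.

Lemma sigma_set0 : F set0.
Proof. by case: sF. Qed.

End sub_sigma_algebra_closure.

Section measurable_wrt_closure.
Context d (T : measurableType d) (R : realType) (F : set (set T)).
Hypothesis sF : sigma_algebra setT F.

Lemma measurable_wrtD (X Y : T -> R) : measurable_wrt F X -> measurable_wrt F Y ->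
  measurable_wrt F (fun w => X w + Y w).
Proof.
move=> /(measurable_wrtP sF) mX /(measurable_wrtP sF) mY.
by apply/(measurable_wrtP sF); exact: measurable_funD.
Qed.

Lemma measurable_wrtB (X Y : T -> R) : measurable_wrt F X -> measurable_wrt F Y ->
  measurable_wrt F (fun w => X w - Y w).
Proof.
move=> /(measurable_wrtP sF) mX /(measurable_wrtP sF) mY.
by apply/(measurable_wrtP sF); exact: measurable_funB.
Qed.

Lemma measurable_wrt_cst (c : R) : measurable_wrt F (fun=> c).
Proof. by apply/(measurable_wrtP sF); exact: measurable_cst. Qed.

End measurable_wrt_closure.

Lemma sub_measurable_wrt d (T : measurableType d) (R : realType)
  (F F' : set (set T)) (X : T -> R) :
  F `<=` F' -> measurable_wrt F X -> measurable_wrt F' X.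
Proof. by move=> FF' mX C mC; apply: FF'; exact: mX. Qed.

Section path_space_theory.
Context (R : realType) (T : R) (T0 : 0 < T).
Local Notation PS := (path_space T).
Implicit Types (w v : PS) (s t u : R) (L : seq R).

Definition clip s : R := Num.min T (Num.max 0 s).

Lemma clip_itv s : 0 <= clip s <= T.
Proof. by rewrite /clip le_min ltW//= le_max lexx/= ge_min lexx. Qed.

Lemma clip_id s : 0 <= s <= T -> clip s = s.
Proof. by case/andP => s0 sT; rewrite /clip max_r// min_r. Qed.

Lemma path_le0 w s : s <= 0 -> w s = 0.
Proof.
by move=> s0; rewrite path_stopped (_ : Num.min _ _ = 0) ?path_start// max_l// min_r// ltW.
Qed.

Lemma path_geT w s : T <= s -> w s = w T.
Proof.
move=> Ts; rewrite path_stopped (_ : Num.min _ _ = T)// max_r ?min_l//.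
exact: le_trans (ltW T0) Ts.
Qed.

Lemma measurable_eval s : measurable_fun setT (fun w => w s).
Proof.
rewrite (_ : (fun w => w s) = (fun w => w (clip s))).
  move=> _ C mC; rewrite setTI; apply: sub_sigma_algebra.
  by exists (clip s), C; split => //; exact: clip_itv.
by apply/funext => w; rewrite path_stopped.
Qed.

Lemma measurable_to_path d (U : measurableType d) (f : U -> PS) :
  (forall s, 0 <= s <= T -> measurable_fun setT (fun x => f x s)) ->
  measurable_fun setT f.
Proof.
move=> mf; apply: (measurability (coordinate_sets (T := T))) => //.
move=> _ [_ [s [C [sT mC ->]]] <-]; rewrite setTI.
by have := mf s sT measurableT C mC; rewrite setTI.
Qed.

Section concatenation.
Variables (t : R) (t0 : 0 <= t <= T).

(** The path [w] up to time [t], continued by the increments of [v]. Minimum and maximum avoid a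
    case distinction and make continuity immediate. *)
Definition concat_fun w v : R -> R :=
  fun s => w (Num.min s t) + (v (Num.max s t) - v t).

Let concat_continuous w v : continuous (concat_fun w v).
Proof.
have cmin : continuous (fun s : R => Num.min s t).
  by move=> s; apply: continuous_min; [exact: cvg_id|exact: cvg_cst].
have cmax : continuous (fun s : R => Num.max s t).
  by move=> s; apply: continuous_max; [exact: cvg_id|exact: cvg_cst].
move=> s; apply: cvgD.
  apply: (continuous_comp (f := fun s : R => Num.min s t) (g := w)); first exact: cmin.
  exact: path_continuous.
apply: cvgB; last exact: cvg_cst.
apply: (continuous_comp (f := fun s : R => Num.max s t) (g := v)); first exact: cmax.
exact: path_continuous.
Qed.

Let concat_start w v : concat_fun w v 0 = 0.
Proof.
case/andP: t0 => t1 t2.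
by rewrite /concat_fun min_l// max_r// path_start subrr addr0.
Qed.

Let concat_stopped w v s : concat_fun w v s = concat_fun w v (clip s).
Proof.
case/andP: t0 => t1 t2; have [s0|s0] := leP s 0.
  have s_t := le_trans s0 t1.
  have -> : clip s = 0 by rewrite /clip max_l// min_r// ltW.
  by rewrite concat_start /concat_fun min_l// max_r// path_le0// subrr addr0.
have [sT|Ts] := leP s T; first by rewrite clip_id// ltW.
have -> : clip s = T by rewrite /clip max_r ?(ltW s0)// min_l// ltW.
have ts := le_trans t2 (ltW Ts).
by rewrite /concat_fun min_r// max_l// min_r// max_l// (path_geT _ (ltW Ts)).
Qed.

Definition concat w v : PS :=
  MkPath (@concat_continuous w v) (concat_start w v) (concat_stopped w v).

Lemma concat_before w v s : s <= t -> concat w v s = w s.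
Proof. by move=> st; rewrite /= /concat_fun min_l// max_r// subrr addr0. Qed.

Lemma concat_after w v s : t <= s -> concat w v s = w t + (v s - v t).
Proof. by move=> ts; rewrite /= /concat_fun min_r// max_l. Qed.

Lemma concat_congr w w' v : (forall s, s <= t -> w s = w' s) -> concat w v = concat w' v.
Proof.
move=> ww'; have e : concat_fun w v = concat_fun w' v.
  by apply/funext => s; rewrite /concat_fun ww'// ge_min lexx orbT.
rewrite /concat; move: (@concat_continuous w v) (concat_start w v) (concat_stopped w v).
rewrite e => a b c; congr MkPath; exact: Prop_irrelevance.
Qed.

Lemma measurable_concat :
  measurable_fun setT (fun z : PS * PS => concat z.1 z.2).
Proof.
apply: measurable_to_path => s sT; rewrite /= /concat_fun.
apply: measurable_funD.
  by apply: (measurableT_comp (measurable_eval _)); exact: measurable_fst.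
apply: measurable_funB.
  by apply: (measurableT_comp (measurable_eval _)); exact: measurable_snd.
by apply: (measurableT_comp (measurable_eval _)); exact: measurable_snd.
Qed.

End concatenation.

Definition past s : set (set PS) :=
  <<s [set A | exists r C, [/\ 0 <= r <= s, measurable (C : set R) &
                 A = [set w : PS | C (w r)]]] >>.

Lemma sigma_past s : sigma_algebra setT (past s).
Proof. exact: sigma_algebra_gen. Qed.

Lemma past_eval s r : 0 <= r <= s -> measurable_wrt (past s) (fun w => w r).
Proof. by move=> rs C mC; apply: sub_sigma_algebra; exists r, C. Qed.

Lemma past_sub s s' : s <= s' -> past s `<=` past s'.
Proof.
move=> ss'; apply: sub_sigma_of; first exact: sigma_past.
move=> _ [r [C [/andP[r0 rs] mC ->]]]; apply: past_eval => //.
by rewrite r0 (le_trans rs).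
Qed.

Lemma past_measurable s : past s `<=` measurable.
Proof.
apply: sub_sigma_of; first exact: sigma_algebra_measurable.
move=> _ [r [C [_ mC ->]]]; rewrite -[X in measurable X]setTI.
exact: measurable_eval.
Qed.

Variables (Pt : probability PS R).
Hypothesis increments : forall s u, 0 <= s -> s < u -> u <= T ->
  forall A, past s A -> forall C : set R, measurable C ->
  Pt (A `&` [set w : PS | C (w u - w s)%R]) = (Pt A * Pt [set w : PS | C (w u - w s)%R])%E.

Lemma increments_le s u : 0 <= s -> s <= u -> u <= T ->
  forall A, past s A -> forall C : set R, measurable C ->
  Pt (A `&` [set w : PS | C (w u - w s)%R]) = (Pt A * Pt [set w : PS | C (w u - w s)%R])%E.
Proof.
move=> s0; rewrite le_eqVlt => /predU1P[<- _|su uT]; last exact: increments.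
move=> A pA C mC; have [C0|C0] := pselect (C 0).
  rewrite (_ : [set w : PS | C (w s - w s)%R] = setT).
    by rewrite setIT [X in (_ * X)%E]probability_setT mule1.
  by apply/seteqP; split => w //= _; rewrite subrr.
rewrite (_ : [set w : PS | C (w s - w s)%R] = set0).
  by rewrite setI0 measure0 mule0.
by apply/seteqP; split => w //=; rewrite subrr.
Qed.

Section future.
Variables (t : R) (t0 : 0 <= t).

(** Sigma-algebra of the increments after [t] along a list of times, the latest one first. Each time
    adjoins one increment to the earlier ones, which suits a proof of independence by induction. *)
Fixpoint future L : set (set PS) :=
  if L is u :: L' then
    <<s [set A | exists B C, [/\ future L' B, measurable (C : set R) &
           A = B `&` [set w : PS | C (w u - w (head t L'))%R]]] >>
  else <<s set0 >>.

Fixpoint future_ok L : bool :=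
  if L is u :: L' then (head t L' <= u) && (u <= T) && future_ok L' else true.

Lemma sigma_future L : sigma_algebra setT (future L).
Proof. by case: L => [|u L]; exact: sigma_algebra_gen. Qed.

Lemma future_ok_head L : future_ok L -> t <= head t L.
Proof.
elim: L => //= u L IH /andP[/andP[hu uT] /IH th]; exact: le_trans th hu.
Qed.

Lemma future_past L : future_ok L -> future L `<=` past (head t L).
Proof.
elim: L => [_|u L IH /= /andP[/andP[hu uT] ok]].
  by apply: sub_sigma_of => //; exact: sigma_past.
apply: sub_sigma_of; first exact: sigma_past.
move=> _ [B [C [fB mC ->]]]; apply: (sigma_setI (sigma_past _)).
  by apply: (past_sub hu); exact: IH.
have h0 : 0 <= head t L by exact: le_trans t0 (future_ok_head ok).
have := @measurable_wrtB _ _ R _ (sigma_past u) (fun w => w u) (fun w => w (head t L)).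
apply=> //; apply: past_eval; first by rewrite lexx (le_trans h0).
by rewrite h0.
Qed.

(** The intersection of [A] with an event of the earlier increments belongs to the past of the
    preceding time, so the last increment splits off and the induction hypothesis treats the
    rest. *)
Lemma future_indep L : future_ok L -> forall A B, past t A -> future L B ->
  Pt (A `&` B) = (Pt A * Pt B)%E.
Proof.
elim: L => [_ A B pA|u L IH /= /andP[/andP[hu uT] ok] A B pA].
  apply: pi_indep => //; exact: past_measurable pA.
have th := future_ok_head ok.
have h0 : 0 <= head t L by exact: le_trans t0 th.
apply: pi_indep; first exact: past_measurable pA.
- move=> _ _ [B1 [C1 [fB1 mC1 ->]]] [B2 [C2 [fB2 mC2 ->]]].
  exists (B1 `&` B2), (C1 `&` C2); split.
  + exact: (sigma_setI (sigma_future L)).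
  + exact: measurableI.
  + by rewrite setIACA.
- move=> _ [B1 [C1 [fB1 mC1 ->]]]; apply: measurableI.
    exact: (past_measurable (future_past ok fB1)).
  rewrite -[X in measurable X]setTI.
  by apply: measurable_funB => //; exact: measurable_eval.
- move=> _ [B1 [C1 [fB1 mC1 ->]]].
  have pB1 := future_past ok fB1.
  rewrite setIA !increments_le//.
    by rewrite (IH ok)// muleA.
  by apply: (sigma_setI (sigma_past _)) => //; exact: past_sub th _ pA.
Qed.

Lemma future_eval L s : future_ok L -> s \in t :: L ->
  measurable_wrt (future L) (fun w => w s - w t).
Proof.
elim: L s => [|u L IH] s.
  rewrite mem_seq1 => _ /eqP ->.
  under eq_fun do rewrite subrr.
  exact: (measurable_wrt_cst (sigma_future [::])).
move=> /= /andP[/andP[hu uT] ok] sL.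
have sub : future L `<=` future (u :: L).
  move=> B fB; apply: sub_sigma_algebra; exists B, setT; split => //.
  by rewrite (_ : [set w | _] = setT) ?setIT//; apply/seteqP; split.
have hin : head t L \in t :: L by case: (L) => [|x L']; rewrite /= !inE eqxx// orbT.
have [sL'|sL'] := boolP (s \in t :: L).
  exact: (sub_measurable_wrt sub (IH _ ok sL')).
have -> : s = u.
  by move: sL sL'; rewrite !inE => /or3P[->|/eqP//|->]//; rewrite orbT.
have := @measurable_wrtD _ _ R _ (sigma_future (u :: L))
  (fun w => w u - w (head t L)) (fun w => w (head t L) - w t).
rewrite (_ : (fun w : PS => w u - w (head t L) + (w (head t L) - w t)) = (fun w => w u - w t)); last first.
  by apply/funext => w; rewrite addrA subrK.
apply; last exact: (sub_measurable_wrt sub (IH _ ok hin)).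
move=> C mC; apply: sub_sigma_algebra; exists setT, C; split => //.
  exact: (sigma_setT (sigma_future _)).
by rewrite setTI.
Qed.

(** Cylinders in the increments counted from [t], at arbitrary times. They are stable under
    intersection, and sorting the times places each of them in some [future L]. *)
Definition future_cyl (l : seq (R * set R)) : set PS :=
  foldr (fun p A => [set w : PS | p.2 (w p.1 - w t)] `&` A) setT l.

Definition cyl_ok (l : seq (R * set R)) : Prop :=
  forall p, List.In p l -> t <= p.1 <= T /\ measurable p.2.

Lemma future_cyl_cat l1 l2 : future_cyl (l1 ++ l2) = future_cyl l1 `&` future_cyl l2.
Proof. by elim: l1 => [|p l1 IH] /=; rewrite ?setTI// IH setIA. Qed.

Lemma sorted_future_ok L : sorted >=%R L -> {in L, forall s, t <= s <= T} ->
  future_ok L.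
Proof.
elim: L => //= u L IH sL inL.
have /andP[tu uT] : t <= u <= T by apply: inL; rewrite mem_head.
rewrite uT andbT IH ?andbT//.
- by case: L sL {IH inL} => //= v L /andP[].
- exact: path_sorted sL.
- by move=> s sL'; apply: inL; rewrite inE sL' orbT.
Qed.

Lemma cyl_ok_time l : cyl_ok l -> {in [seq p.1 | p <- l], forall s, t <= s <= T}.
Proof.
elim: l => //= p l IH okl s; rewrite inE => /predU1P[->|].
  by case: (okl p (or_introl erefl)).
by apply: IH => q ql; apply: okl; right.
Qed.

Lemma future_cyl_sub L l : future_ok L -> cyl_ok l ->
  {subset [seq p.1 | p <- l] <= L} -> future L (future_cyl l).
Proof.
move=> ok; elim: l => [|p l IH] okl sub /=.
  exact: (sigma_setT (sigma_future L)).
apply: (sigma_setI (sigma_future L)).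
  have [_ mp] := okl p (or_introl erefl).
  have pL : p.1 \in t :: L by rewrite inE sub ?orbT//= mem_head.
  exact: (future_eval ok pL mp).
apply: IH; first by move=> q ql; apply: okl; right.
by move=> s sl; apply: sub; rewrite /= inE sl orbT.
Qed.

Lemma future_cyl_future l : cyl_ok l -> exists2 L, future_ok L & future L (future_cyl l).
Proof.
move=> okl; pose L := sort >=%R [seq p.1 | p <- l].
have ok : future_ok L.
  apply: sorted_future_ok; first by apply: sort_sorted => x y; exact: ge_total.
  by move=> s; rewrite mem_sort; exact: cyl_ok_time.
exists L => //; apply: future_cyl_sub => //.
by move=> s; rewrite mem_sort.
Qed.

Definition future_all : set (set PS) := <<s [set A | exists2 l, cyl_ok l & A = future_cyl l] >>.

Lemma future_all_measurable : future_all `<=` measurable.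
Proof.
apply: sub_sigma_of; first exact: sigma_algebra_measurable.
move=> _ [l okl ->]; have [L ok fL] := future_cyl_future okl.
exact: (past_measurable (future_past ok fL)).
Qed.

Lemma future_all_indep A B : past t A -> future_all B -> Pt (A `&` B) = (Pt A * Pt B)%E.
Proof.
move=> pA; apply: pi_indep; first exact: past_measurable pA.
- move=> _ _ [l1 ok1 ->] [l2 ok2 ->]; exists (l1 ++ l2); last by rewrite future_cyl_cat.
  by move=> p /(@List.in_app_or _ _ _ _)[/ok1|/ok2].
- by move=> B' sB'; apply: future_all_measurable; exact: sub_sigma_algebra.
- move=> _ [l okl ->]; have [L ok fL] := future_cyl_future okl.
  exact: (future_indep ok).
Qed.

Lemma future_all_eval s : t <= s <= T -> measurable_wrt future_all (fun w => w s - w t).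
Proof.
move=> sT C mC; apply: sub_sigma_algebra; exists [:: (s, C)].
  by move=> p [<-|].
by rewrite /= setIT.
Qed.

End future.

(** Replacing the increments after [t] by those of an independent path preserves the measure. The
    past of [t] and the later increments generate everything, concatenation pulls them back to the
    first and to the second factor, and they are independent under [Pt]. *)
Lemma concat_law t (t0 : 0 <= t <= T) (S : set PS) : measurable S ->
  pprod Pt Pt ((fun z => concat t0 z.1 z.2) @^-1` S) = Pt S.
Proof.
have /andP[t1 t2] := t0.
pose G : set (set PS) := [set A | exists E H, [/\ past t E, future_all t H & A = E `&` H]].
pose k := fun z : PS * PS => concat t0 z.1 z.2.
have mk : measurable_fun setT k by exact: measurable_concat.
pose km := isMeasurableFun.Build _ _ (PS * PS)%type PS k mk.
pose kf : {mfun (PS * PS)%type >-> PS} := HB.pack k km.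
have sA : sigma_algebra setT (future_all t) by exact: sigma_algebra_gen.
have GE E : past t E -> G E.
  by move=> pE; exists E, setT; split; rewrite ?setIT//; exact: (sigma_setT sA).
have GH H : future_all t H -> G H.
  by move=> pH; exists setT, H; split; rewrite ?setTI//; exact: (sigma_setT (sigma_past _)).
have mE : (measurable : set (set PS)) `<=` <<s G >>.
  apply: sub_sigma_of; first exact: sigma_algebra_gen.
  move=> _ [s [C [/andP[s0 sT] mC ->]]].
  suff : measurable_wrt <<s G>> (fun w => w s) by apply.
  have ev r : 0 <= r <= t -> measurable_wrt <<s G>> (fun w => w r).
    by move=> rt D mD; apply: sub_sigma_algebra; apply: GE; exact: past_eval.
  have [st|ts] := leP s t; first by apply: ev; rewrite s0.
  rewrite (_ : (fun w => w s) = (fun w => w t + (w s - w t))); last first.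
    by apply/funext => w; rewrite addrC subrK.
  apply: measurable_wrtD; first exact: sigma_algebra_gen.
    by apply: ev; rewrite lexx t1.
  move=> D mD; apply: sub_sigma_algebra; apply: GH.
  by apply: future_all_eval => //; rewrite (ltW ts).
have kE E : past t E -> k @^-1` E = E `*` setT.
  move: E; apply: sub_sigma_of.
    split.
    - by rewrite preimage_set0 set0X.
    - move=> B e; rewrite setTD -preimage_setC e.
      by apply/seteqP; split => z /=; [move=> h; split => // ?; exact: h|move=> [h _] [? _]; exact: h].
    - move=> B e; rewrite preimage_bigcup setX_bigcupl.
      by apply: eq_bigcupr => i _; exact: e.
  move=> _ [r [C [/andP[r0 rt] mC ->]]].
  by apply/seteqP; split => z; rewrite /k /= -/(concat_fun t z.1 z.2 r) -[concat_fun _ _ _ _]/(concat t0 z.1 z.2 r) concat_before//; case.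
have kH H : future_all t H -> k @^-1` H = setT `*` H.
  move: H; apply: sub_sigma_of.
    split.
    - by rewrite preimage_set0 setX0.
    - move=> B e; rewrite setTD -preimage_setC e.
      by apply/seteqP; split => z /=; [move=> h; split => // ?; exact: h|move=> [_ h] [_ ?]; exact: h].
    - move=> B e; rewrite preimage_bigcup setX_bigcupr.
      by apply: eq_bigcupr => i _; exact: e.
  move=> _ [l okl ->]; elim: l okl => [|p l IH] okl /=.
    by rewrite preimage_setT; apply/seteqP; split => z.
  rewrite preimage_setI IH; last by move=> q ql; apply: okl; right.
  have [/andP[tp pT] _] := okl p (or_introl erefl).
  have inc z : k z p.1 - k z t = z.2 p.1 - z.2 t.
    by rewrite /k concat_after// concat_before// addrAC subrr add0r.
  apply/seteqP; split => z.
    by move=> [/= h [_ h']]; split => //; split => //=; rewrite -inc.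
  by move=> [_ [/= h h']]; split => //=; rewrite inc.
move=> mS; have sS := mE _ mS.
have := @pi_ext _ PS R (pushforward (pprod Pt Pt) kf) Pt G; apply => //.
- move=> _ _ [E1 [H1 [pE1 fH1 ->]]] [E2 [H2 [pE2 fH2 ->]]].
  exists (E1 `&` E2), (H1 `&` H2); split.
  + exact: (sigma_setI (sigma_past t)).
  + exact: (sigma_setI sA).
  + by rewrite setIACA.
- move=> _ [E [H [pE fH ->]]]; apply: measurableI.
    exact: past_measurable pE.
  exact: (future_all_measurable t1 fH).
- exact: (etrans (@probability_setT _ _ _ (pprod Pt Pt)) (esym (@probability_setT _ _ _ Pt))).
- rewrite [X in (X < _)%E](_ : _ = 1%E) ?ltry//.
  exact: (@probability_setT _ _ _ (pprod Pt Pt)).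
- move=> _ [E [H [pE fH ->]]].
  apply: etrans _ (esym (future_all_indep t1 pE fH)).
  rewrite -[LHS]/(pprod Pt Pt (k @^-1` (E `&` H))) preimage_setI kE// kH//.
  rewrite (_ : _ `&` _ = E `*` H).
    by apply: (product_measure1E Pt Pt); [exact: past_measurable pE|exact: (future_all_measurable t1 fH)].
  by apply/seteqP; split => [z [[h _] [_ h']]|z [h h']]; split.
Qed.

End path_space_theory.

(** * Conditional laws given the common noise *)


Section borel_by_rational_rays.
Context (R : realType).

(** A countable pi-system: almost sure equalities tested on it hold outside a single null set. *)
Definition rat_rays : set (set R) := [set A | exists q : rat, A = `]-oo, ratr q[%classic].

Lemma rat_rays_setI : setI_closed rat_rays.
Proof.
move=> _ _ [p ->] [q ->]; exists (Order.min p q); apply/seteqP; split => x /=; rewrite !in_itv/=.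
  by case=> xp xq; case: (leP p q).
case: (leP p q) => pq xp; split => //; apply: (lt_le_trans xp); rewrite ler_rat//.
exact: ltW.
Qed.

Lemma rat_rays_measurable : rat_rays `<=` measurable.
Proof. by move=> _ [q ->]; exact: measurable_itv. Qed.

Lemma rat_rays_gen : (measurable : set (set (measurableTypeR R))) `<=` <<s rat_rays >>.
Proof.
rewrite RGenInftyO.measurableE; apply: sub_sigma_of; first exact: sigma_algebra_gen.
move=> _ [x ->].
rewrite (_ : `]-oo, x[%classic = \bigcup_q [set y | ratr q < x /\ y < ratr q]).
  apply: (@bigcupT_measurable_rat _ (g_sigma_algebraType rat_rays)) => q.
  have [qx|qx] := ltP (ratr q) x.
    apply: sub_sigma_algebra; exists q; apply/seteqP; split => y /=; rewrite in_itv/=.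
      by case.
    by [].
  rewrite (_ : [set y | _] = set0); first exact: measurable0.
  by apply/seteqP; split => y //= [].
apply/seteqP; split => y /=; rewrite in_itv/=.
  by move=> /rat_in_itvoo[q]; rewrite in_itv/= => /andP[yq qx]; exists q.
by case=> q _ [qx yq]; exact: lt_trans qx.
Qed.

Lemma law_by_rays d (T : measurableType d) (P : probability T R) (X : T -> R)
    (m : probability (measurableTypeR R) R) :
  measurable_fun setT X ->
  (forall q : rat, m `]-oo, ratr q[%classic = P (X @^-1` `]-oo, ratr q[%classic)) ->
  forall C : set R, measurable C -> m C = P (X @^-1` C).
Proof.
move=> mX e C mC.
pose Xm := isMeasurableFun.Build _ _ T (measurableTypeR R) X mX.
pose Xf : {mfun T >-> measurableTypeR R} := HB.pack X Xm.
have := @pi_ext _ (measurableTypeR R) R m (pushforward P Xf) rat_rays rat_rays_setI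
  rat_rays_measurable; apply.
- exact: (etrans (@probability_setT _ _ _ m) (esym (@probability_setT _ _ _ P))).
- by rewrite [X in (X < _)%E](@probability_setT _ _ _ m) ltry.
- by move=> _ [q ->]; exact: e.
- exact: rat_rays_gen.
Qed.

End borel_by_rational_rays.

Lemma integral_snd d1 d2 (T1 : measurableType d1) (T2 : measurableType d2) (R : realType)
    (m1 : probability T1 R) (m2 : probability T2 R) (f : T2 -> \bar R) :
  measurable_fun setT f -> (forall x, 0 <= f x)%E ->
  (\int[pprod m1 m2]_z f z.2 = \int[m2]_y f y)%E.
Proof.
move=> mf f0; have mf2 : measurable_fun setT (fun z : T1 * T2 => f z.2).
  by apply: (measurableT_comp mf); exact: measurable_snd.
apply: (etrans (fubini_tonelli1 (m1 := m1) (m2 := m2) (fun z => f z.2) mf2 _)) => //.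
rewrite (eq_integral (fun=> \int[m2]_y f y)%E) => [|//].
by rewrite integral_cst// [X in (_ * X)%E](@probability_setT _ _ _ m1) mule1.
Qed.

Lemma fine_prob d (T : measurableType d) (R : realType) (P : probability T R) A :
  measurable A -> (fine (P A))%:E = P A.
Proof.
by move=> mA; rewrite fineK// ge0_fin_numE// (le_lt_trans (probability_le1 _ mA))// ltry.
Qed.

Section conditional_laws.
Context {R : realType} {T : R} {d0} {Omega0 : measurableType d0}.
Variable G : game T Omega0.
Local Notation Om := (Omega0 * path_space T)%type.
Local Notation PS := (path_space T).
Hypotheses (T0 : 0 < T) (hb : stochastic_basis G).
Local Notation P := (prob G).
Implicit Types (X : Om -> R) (m : Om -> P2 R).

Lemma Ftilde_sub_Filt t : 0 <= t <= T -> Ftilde t `<=` Filt G t.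
Proof.
move=> /andP[t0 tT]; case: hb => cF _ [_ _ aB _] _ _.
have tt : 0 <= t <= T by rewrite t0.
apply: sub_sigma_of; first exact: (filtration_sigma cF tt).
move=> _ [s [C [/andP[s0 st] mC ->]]].
have sT := le_trans st tT.
apply: (filtration_mono cF s0 st tT).
by apply: aB => //; rewrite s0.
Qed.

Lemma sigma_Ftilde t : sigma_algebra setT (Ftilde t : set (set Om)).
Proof. exact: sigma_algebra_gen. Qed.

Lemma Ftilde_measurable t : 0 <= t <= T -> (Ftilde t : set (set Om)) `<=` measurable.
Proof.
move=> tT A /(Ftilde_sub_Filt tT); case: hb => cF _ _ _ _.
exact: (filtration_sub cF tT).
Qed.

Lemma past_Ftilde t (A : set PS) : past t A -> Ftilde t (snd @^-1` A : set Om).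
Proof.
move: A; apply: sub_sigma_of => [|_ [r [C [rt mC ->]]]].
  have := sigma_algebra_image (snd : Om -> PS) (sigma_Ftilde t).
  by rewrite /image_set_system; under eq_fun do rewrite setTI.
by apply: sub_sigma_algebra; exists r, C.
Qed.

Lemma Ftilde_snd t (A : set Om) : 0 <= t <= T -> Ftilde t A ->
  exists2 B : set PS, measurable B & A = snd @^-1` B.
Proof.
move=> tT FA.
have sg := sigma_algebra_preimage setT (snd : Om -> PS) (@sigma_algebra_measurable _ PS).
have : preimage_set_system setT (snd : Om -> PS) measurable A.
  move: A FA; apply: sub_sigma_of => // _ [s [C [/andP[s0 st] mC ->]]].
  exists [set w : PS | C (w s)]; last by rewrite setTI.
  by rewrite -[X in measurable X]setTI; exact: measurable_eval.
by case=> B mB <-; exists B => //; rewrite setTI.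
Qed.

Lemma prob_snd (B : set PS) : measurable B -> P (snd @^-1` B) = Pt G B.
Proof.
move=> mB; rewrite (_ : snd @^-1` B = setT `*` B); last first.
  by apply/seteqP; split => [z|z []].
apply: (etrans (product_measure1E (P0 G) (Pt G) measurableT mB)).
by rewrite [X in (X * _)%E](@probability_setT _ _ _ (P0 G)) mul1e.
Qed.

Lemma Pt_increments s u : 0 <= s -> s < u -> u <= T ->
  forall A, past s A -> forall C : set R, measurable C ->
  Pt G (A `&` [set w : PS | C (w u - w s)%R]) =
    (Pt G A * Pt G [set w : PS | C (w u - w s)%R])%E.
Proof.
move=> s0 su uT A pA C mC.
have mI : measurable [set w : PS | C (w u - w s)%R].
  rewrite -[X in measurable X]setTI.
  by apply: measurable_funB => //; exact: measurable_eval.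
have mA := past_measurable T0 pA.
have sT : 0 <= s <= T by rewrite s0 ltW// (lt_le_trans su).
rewrite -!prob_snd//; last exact: measurableI.
case: hb => _ _ [_ _ _ /(_ s u s0 su uT C mC)[_ +]] _ _.
by move=> /(_ _ (Ftilde_sub_Filt sT (past_Ftilde pA))).
Qed.

(** With the common path frozen, the remaining randomness is the first factor. For a fixed set, both
    sides are measurable in the common noise and have the same integrals over its events; rational
    rays then give one null set for all sets. *)
Lemma cond_law_section X m : measurable_fun setT X ->
  conditional_law P (Ftilde T) X m ->
  {ae P, forall w, has_law (P0 G) (fun w0 => X (w0, w.2)) (m w)}.
Proof.
move=> mX cm.
have TT : 0 <= T <= T by rewrite lexx ltW.
suff key (C : set R) : measurable C ->
    {ae P, forall w, m w C = P0 G ((fun w0 => X (w0, w.2)) @^-1` C)}.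
  have /ae_foralln : forall n, {ae P, forall w, forall q : rat, unpickle n = Some q ->
      m w `]-oo, ratr q[%classic = P0 G ((fun w0 => X (w0, w.2)) @^-1` `]-oo, ratr q[%classic)}.
    move=> n; case: (unpickle n : option rat) => [q|].
      by apply: filterS (key `]-oo, ratr q[%classic (measurable_itv _)) => w e _ [<-].
    by apply: aeW.
  apply: filterS => w e; apply: law_by_rays; first exact: meas_pair2.
  by move=> q; exact: (e (pickle q) q (pickleK q)).
move=> mC.
have mXC : measurable (X @^-1` C) by rewrite -[X in measurable X]setTI; exact: mX.
pose psi (v : PS) : R := \int[P0 G]_w0 \1_(X @^-1` C) (w0, v).
have mI : measurable_fun setT (\1_(X @^-1` C) : Om -> R) by exact: measurable_indic.
have I1 w : `|\1_(X @^-1` C) w : R| <= 1.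
  by rewrite indicE; case: (_ \in _); rewrite ?normr1 ?normr0.
have sI : sqint P (\1_(X @^-1` C)) by apply: (@sqint_bounded _ _ _ _ _ 1).
have psiE v : (psi v)%:E = P0 G ((fun w0 => X (w0, v)) @^-1` C).
  have mS : measurable ((fun w0 => X (w0, v)) @^-1` C).
    by rewrite -[X in measurable X]setTI; exact: (meas_pair2 v mX).
  rewrite -fine_prob// -[in RHS](setIT (_ @^-1` _)) -(@integral_indic _ _ _ (P0 G))//.
have mpsi : measurable_fun setT psi by exact: (measurable_Rintegral2 (P0 G) mI).
have psi01 v : 0 <= psi v <= 1.
  rewrite -!lee_fin psiE measure_ge0/=; apply: probability_le1.
  by rewrite -[X in measurable X]setTI; exact: (meas_pair2 v mX).
have phiE w : (fine (m w C))%:E = m w C by exact: fine_prob.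
pose h (w : Om) := fine (m w C) - psi w.2.
have mphi : measurable_wrt (Ftilde T) (fun w => fine (m w C)) by case: (cm C mC).
have mh : measurable_wrt (Ftilde T) h.
  apply: measurable_wrtB => //; first exact: sigma_Ftilde.
  move=> D mD; apply: (@past_Ftilde T (psi @^-1` D)).
  by have := mpsi measurableT D mD; rewrite setTI.
have mh' := measurable_wrt_meas (Ftilde_measurable TT) mh.
have h1 w : `|h w| <= 1.
  have := psi01 w.2; have : 0 <= fine (m w C) <= 1.
    by rewrite -!lee_fin phiE measure_ge0/= probability_le1.
  by rewrite /h ler_norml => /andP[? ?] /andP[? ?]; lra.
have sh : sqint P h by apply: (@sqint_bounded _ _ _ _ _ 1).
have mphi' := measurable_wrt_meas (Ftilde_measurable TT) mphi.
have sphi : sqint P (fun w => fine (m w C)).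
  apply: (@sqint_bounded _ _ _ _ _ 1) => // w.
  by rewrite -lee_fin ger0_norm ?fine_ge0// phiE probability_le1.
have spsi : sqint P (fun w => psi w.2).
  apply: (@sqint_bounded _ _ _ _ _ 1).
    by apply: (measurableT_comp mpsi); exact: measurable_snd.
  by move=> w; have /andP[p0 p1] := psi01 w.2; rewrite ger0_norm.
have h0 A : Ftilde T A -> \int[P]_(w in A) h w = 0.
  move=> FA; have mA := Ftilde_measurable TT FA.
  have iS f : sqint P f -> P.-integrable A (EFin \o f).
    by move=> sf; apply: integrableS (sqint_intg sf).
  rewrite /h RintegralB//; [|exact: iS..].
  apply/eqP; rewrite subr_eq0; apply/eqP; congr fine.
  under eq_integral do rewrite phiE.
  have [_ /(_ A FA) ->] := cm C mC.
  have [B mB AB] := Ftilde_snd TT FA.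
  have sB : sqint (Pt G) (\1_B : PS -> R).
    apply: (@sqint_bounded _ _ _ _ _ 1) => // w.
    by rewrite indicE; case: (_ \in _); rewrite ?normr1 ?normr0.
  have := average2M sI sB; rewrite -/psi => e.
  have e1 : \int[Pt G]_y (\1_B y * psi y) = \int[P]_(w in A) psi w.2.
    rewrite [RHS]Rintegral_mkcond /Rintegral; congr fine.
    transitivity (\int[P]_w (\1_B w.2 * psi w.2)%:E)%E.
      have := @integral_snd _ _ _ _ R (P0 G) (Pt G) (fun y => (\1_B y * psi y)%:E).
      move=> ->//; first by apply/measurable_EFinP; exact: measurable_funM.
      move=> y; rewrite lee_fin mulr_ge0//; by case/andP: (psi01 y).
    apply: eq_integral => w _; rewrite patchE indicE AB.
    rewrite (_ : (w \in snd @^-1` B) = (w.2 \in B)); last by apply/idP/idP; rewrite !inE.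
    by case: ifP => _; rewrite ?mul1r ?mul0r.
  have e2 : \int[P]_z (\1_B z.2 * \1_(X @^-1` C) z) = fine (P (A `&` X @^-1` C)).
    rewrite -[in RHS](setIT (A `&` _)) -(@integral_indic _ _ _ P)//; last exact: measurableI.
    congr fine; apply: eq_integral => w _; rewrite !indicE AB in_setI.
    rewrite (_ : (w \in snd @^-1` B) = (w.2 \in B)); last by apply/idP/idP; rewrite !inE.
    by case: (_ \in B); case: (_ \in _); rewrite ?mulr1 ?mulr0.
  rewrite -fine_prob; last exact: measurableI.
  rewrite -e2 -[LHS]/((\int[pprod (P0 G) (Pt G)]_z (\1_B z.2 * \1_(X @^-1` C) z))%:E) -e e1.
  by rewrite /Rintegral fineK//; apply: integrable_fin_num => //; exact: iS.
(* The difference [h] is orthogonal to what is measurable for [Ftilde T], in particular to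
   itself. *)
have e0 := @Rint_sub_orth _ _ _ _ (sigma_Ftilde T) (Ftilde_measurable TT) P h h
  (sqint_intg sh) h0 mh (sqintM sh sh).
have /sqr_Rint_eq0 : \int[P]_w (h w ^+ 2) <= 0.
  by under eq_Rintegral do rewrite expr2; rewrite e0.
move=> /(_ sh); apply: filterS => w /eqP; rewrite subr_eq0 => /eqP hw.
by rewrite -phiE hw psiE.
Qed.

Section flow.
Variables (t : R) (t0 : 0 <= t <= T) (X : Om -> R).
Hypothesis sX : sqint P X.

(* Resampling the individual noise and the increments of the common noise after
   time [t] leaves the law unchanged. *)
Definition resample (z : Om * Om) : Om := (z.2.1, concat T0 t0 z.1.2 z.2.2).

(** The regular conditional law of [X] given [Ftilde t]: the common path up to [t] is kept and
    everything else is drawn anew. *)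
Definition flow_law (w : Om) : P2 R := law_of P (fun v => X (resample (w, v))).

Lemma measurable_resample : measurable_fun setT resample.
Proof.
have m12 : measurable_fun setT (fun z : Om * Om => z.1.2).
  by apply: (measurableT_comp measurable_snd); exact: measurable_fst.
have m21 : measurable_fun setT (fun z : Om * Om => z.2.1).
  by apply: (measurableT_comp measurable_fst); exact: measurable_snd.
have m22 : measurable_fun setT (fun z : Om * Om => z.2.2).
  by apply: (measurableT_comp measurable_snd); exact: measurable_snd.
apply: measurable_fun_pair => //.
have mp : measurable_fun setT (fun z : Om * Om => (z.1.2, z.2.2)).
  exact: measurable_fun_pair.
exact: (measurableT_comp (measurable_concat T0 t0) mp).
Qed.

(** On rectangles the fresh individual noise factors out, and the common path is handled by
    [concat_law]. *)
Lemma resample_law (S : set Om) : measurable S -> pprod P P (resample @^-1` S) = P S.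
Proof.
move=> mS.
pose rm := isMeasurableFun.Build _ _ (Om * Om)%type Om resample measurable_resample.
pose rf : {mfun (Om * Om)%type >-> Om} := HB.pack resample rm.
apply/esym; apply: (@product_measure_unique _ _ _ _ R (P0 G) (Pt G) (pushforward (pprod P P) rf)) => // A B mA mB.
have mk := @measurable_concat R T T0 t t0.
pose E : set (PS * PS) := (fun z => concat T0 t0 z.1 z.2) @^-1` B.
have mE : measurable E by rewrite -[X in measurable X]setTI; exact: mk.
transitivity (P0 G A * pprod (Pt G) (Pt G) E)%E; last first.
  by congr (_ * _)%E; exact: (concat_law T0 Pt_increments t0 mB).
have mr : measurable (resample @^-1` (A `*` B)).
  rewrite -[X in measurable X]setTI; apply: measurable_resample => //.
  exact: measurableX.
rewrite -[LHS]/(pprod P P (resample @^-1` (A `*` B))).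
rewrite -[LHS]/(\int[P]_w (P \o xsection (resample @^-1` (A `*` B))) w)%E.
transitivity (\int[P]_w (P0 G A * (Pt G (xsection E w.2))))%E.
  apply: eq_integral => w _ /=.
  rewrite -(product_measure1E (P0 G) (Pt G))//; last exact: measurable_xsection.
  by congr (P _); apply/seteqP; split => v; rewrite /xsection/= !inE.
have mxE := measurable_fun_xsection (Pt G) mE.
rewrite (@integral_snd _ _ _ _ R (P0 G) (Pt G) (fun y => P0 G A * Pt G (xsection E y))%E).
- by rewrite ge0_integralZl.
- exact: emeasurable_funM.
- by move=> y; rewrite mule_ge0.
Qed.

Lemma resample_past A : Ftilde t A -> resample @^-1` A = A `*` setT.
Proof.
move: A; apply: sub_sigma_of.
  split.
  - by rewrite preimage_set0 set0X.
  - move=> B e; rewrite setTD -preimage_setC e.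
    by apply/seteqP; split => z /=; [move=> h; split => // ?; exact: h|move=> [h _] [? _]; exact: h].
  - move=> B e; rewrite preimage_bigcup setX_bigcupl.
    by apply: eq_bigcupr => i _; exact: e.
move=> _ [s [C [/andP[s0 st] mC ->]]].
have e z : (resample z).2 s = z.1.2 s by exact: concat_before.
apply/seteqP; split => z; rewrite /common_noise.
  by move=> h; split => //=; rewrite -e.
by move=> [/= h _]; move: h; rewrite -e.
Qed.

Let Y (z : Om * Om) : R := X (resample z).

Let mY : measurable_fun setT Y.
Proof. exact: (measurableT_comp (sqint_meas sX) measurable_resample). Qed.

Let sY : sqint (pprod P P) Y.
Proof.
split => //.
pose rm := isMeasurableFun.Build _ _ (Om * Om)%type Om resample measurable_resample.
pose rf : {mfun (Om * Om)%type >-> Om} := HB.pack resample rm.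
have mX2 : measurable_fun setT (fun w => ((X w) ^+ 2)%:E).
  by apply/measurable_EFinP/measurable_funX; exact: sqint_meas sX.
have := @ge0_integral_pushforward _ _ _ _ R resample measurable_resample (pprod P P) setT _
  measurableT mX2.
rewrite preimage_setT => <-; last by move=> y _; rewrite lee_fin sqr_ge0.
case: sX => _; congr (_ < _)%E.
apply: (@eq_measure_integral _ _ R setT (pushforward (pprod P P) rf) P).
by move=> S mS _; apply/esym; exact: resample_law.
Qed.

(** Keeps the common path up to [t] and forgets the rest. The resampled variable factors through it,
    which is how [flow_law] is seen to be measurable for [Ftilde t]. *)
Let stop (w : Om) : Om := (point, concat T0 t0 w.2 (zero_path T)).

Let Y_stop w v : Y (stop w, v) = Y (w, v).
Proof.
rewrite /Y /resample/=; congr (X (_, _)); apply: concat_congr => s st.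
exact: concat_before.
Qed.

Let measurable_stop : measurable_fun setT (stop : g_sigma_algebraType (Ftilde t) -> Om).
Proof.
apply: measurable_fun_pair => //.
apply: measurable_to_path => s sT.
have [st|ts] := leP s t.
  under eq_fun do rewrite concat_before//.
  apply/(measurable_wrtP (sigma_Ftilde t)) => C mC.
  apply: sub_sigma_algebra; exists s, C; split => //.
  by case/andP: sT => -> _.
under eq_fun do rewrite concat_after ?(ltW ts)//= subrr addr0.
apply/(measurable_wrtP (sigma_Ftilde t)) => C mC.
apply: sub_sigma_algebra; exists t, C; split => //.
by case/andP: t0 => ->; rewrite lexx.
Qed.

Lemma cond_law_flow : conditional_law P (Ftilde t) X flow_law.
Proof.
move=> C mC.
pose I := fun w => (\int[P]_v ((Y (w, v)) ^+ 2)%:E)%E.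
have mY2 : measurable_fun setT (fun z => ((Y z) ^+ 2)%:E).
  exact/measurable_EFinP/measurable_funX.
have mI : measurable_fun setT I.
  apply: (measurable_fun_fubini_tonelli_F (m2 := P) _ mY2) => z.
  by rewrite lee_fin sqr_ge0.
have mgood : measurable_fun setT (fun w => (I w < +oo)%E).
  apply: (measurable_fun_bool true).
  rewrite (_ : _ @^-1` _ = [set w | (I w < +oo)%E]); last by apply/seteqP; split.
  exact: (emeasurable_fun_infty_o measurableT mI).
have goodP w : sqint P (fun v => Y (w, v)) <-> (I w < +oo)%E.
  by split=> [[]//|h]; split => //; exact: meas_pair1.
have mYC : measurable (Y @^-1` C) by rewrite -[X in measurable X]setTI; exact: mY.
have mYwC w : measurable ((fun v => Y (w, v)) @^-1` C).
  by rewrite -[X in measurable X]setTI; exact: (meas_pair1 w mY).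
pose p w := P ((fun v => Y (w, v)) @^-1` C).
have mp : measurable_fun setT p.
  rewrite (_ : p = P \o xsection (Y @^-1` C)).
    exact: (measurable_fun_xsection P mYC).
  by apply/funext => w; rewrite /p/=; congr (P _); apply/seteqP; split => v; rewrite /xsection/= inE.
(* The value of [flow_law] where the resampled variable is not square integrable: the default of
   [law_of]. *)
pose c0 := fine (law_of P (fun=> 0) C).
have fE w : fine (flow_law w C) = if (I w < +oo)%E then fine (p w) else c0.
  case: ifPn => [/goodP sw|nw].
    by rewrite /flow_law (law_ofP sw).
  by rewrite /flow_law law_of0//; apply/goodP/negP.
split.
  apply/(measurable_wrtP (sigma_Ftilde t)).
  rewrite (_ : (fun w => _) = (fun w => if (I w < +oo)%E then fine (p w) else c0) \o stop).
    apply: (measurableT_comp _ measurable_stop).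
    by apply: measurable_fun_ifT => //; exact: measurableT_comp.
  apply/funext => w; rewrite fE /=.
  have -> : I (stop w) = I w by apply: eq_integral => v _; rewrite Y_stop.
  have -> : p (stop w) = p w.
    by rewrite /p; congr (P _); apply/seteqP; split => v /=; rewrite Y_stop.
  by [].
move=> A FA; have mA := Ftilde_measurable t0 FA.
have mXC : measurable (X @^-1` C) by rewrite -[X in measurable X]setTI; exact: (sqint_meas sX).
rewrite -[RHS]resample_law; last exact: measurableI.
rewrite preimage_setI resample_past//.
rewrite -[RHS]/(\int[P]_w (P \o xsection (A `*` setT `&` Y @^-1` C)) w)%E.
rewrite integral_mkcond.
have mflow : measurable_fun setT (fun w => flow_law w C).
  rewrite (_ : (fun w => _) = (fun w => (if (I w < +oo)%E then fine (p w) else c0)%:E)).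
    apply/measurable_EFinP.
    by apply: measurable_fun_ifT => //; exact: measurableT_comp.
  by apply/funext => w; rewrite -fE fine_prob.
apply: ae_eq_integral => //.
- apply/(measurable_restrictT (fun w => flow_law w C) mA).
  exact: (measurable_funTS mflow).
- apply: (measurable_fun_xsection P); apply: measurableI => //.
  exact: measurableX.
- have := sqint_section1 sY; apply: filterS => w sw _ /=.
  rewrite patchE; case: ifPn => wA.
    rewrite /flow_law (law_ofP sw)//; congr (P _).
    rewrite inE in wA.
    by apply/seteqP; split => v; rewrite /xsection/= inE//=; case.
  rewrite (_ : xsection _ _ = set0) ?measure0//.
  apply/seteqP; split => v //; rewrite /xsection/= inE/= => -[[wA' _] _].
  by move: wA; rewrite notin_setE => /(_ wA').
Qed.

End flow.

End conditional_laws.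

(** * The cost of a deviation *)


Section norm2.
Context d (T : measurableType d) (R : realType) (P : probability T R).

Lemma norm2E (X : T -> R) : sqint P X ->
  norm2 P X = (Num.sqrt (\int[P]_w (X w ^+ 2)))%:E.
Proof.
move=> sX; rewrite /norm2 unlock.
have -> : (\int[P]_x `|(EFin \o X) x| `^ 2 = (\int[P]_w (X w ^+ 2))%:E)%E.
  rewrite /Rintegral fineK; last first.
    by apply: (@integrable_fin_num _ _ _ P setT) => //; exact: sqint_intg2.
  apply: eq_integral => w _ /=; congr (_%:E).
  by rewrite powR_mulrn// real_normK// num_real.
rewrite poweR_EFin powR12_sqrt//.
by apply: Rint_ge0 => w; exact: sqr_ge0.
Qed.

Lemma L2_sqint (X : T -> R) : L2 P X -> sqint P X.
Proof.
move=> [mX lX]; apply: intg2_sqint => //.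
by apply: Lfun2_integrable_sqr; rewrite inE; apply/andP; split; rewrite inE.
Qed.

End norm2.

Section convex_function.
Context (R : realType) (f : R -> R) (K : R).
Hypothesis df : forall x, derivable f x 1.
Hypothesis lip : forall x y, `|derive1 f x - derive1 f y| <= K * `|x - y|.
Hypothesis mono : forall x y, 0 <= (derive1 f x - derive1 f y) * (x - y).

Lemma derive1_mono x y : x <= y -> derive1 f x <= derive1 f y.
Proof.
rewrite le_eqVlt => /predU1P[->//|xy]; have := mono y x.
by rewrite pmulr_lge0 ?subr_gt0// subr_ge0.
Qed.

Lemma mean_value x y : exists2 c, Num.min x y <= c <= Num.max x y &
  f y - f x = derive1 f c * (y - x).
Proof.
have d1 (z : R) : is_derive z 1 f (derive1 f z) by rewrite derive1E; exact: DeriveDef.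
have cf a b : {within `[a, b], continuous f}.
  by apply: derivable_within_continuous => z _; exact: df.
have [xy|yx] := leP x y.
  have [c] := MVT_segment xy (fun z _ => d1 z) (cf x y).
  by rewrite in_itv/= => cxy e; exists c.
have [c] := MVT_segment (ltW yx) (fun z _ => d1 z) (cf y x).
rewrite in_itv/= => cxy e; exists c => //.
by rewrite -opprB e -mulrN opprB.
Qed.

Lemma convex_lower x y : derive1 f x * (y - x) <= f y - f x.
Proof.
have [c cxy ->] := mean_value x y.
have [xy|yx] := leP x y.
  move: cxy; rewrite min_l// max_r// => /andP[xc cy].
  by apply: ler_wpM2r; [rewrite subr_ge0|exact: derive1_mono].
move: cxy; rewrite min_r ?(ltW yx)// max_l ?(ltW yx)// => /andP[xc cy].
apply: ler_wnM2r; first by rewrite subr_le0 ltW.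
exact: derive1_mono.
Qed.

(** The tangent inequality at [y] and the Lipschitz bound on the derivative. The constant [K] is
    twice the sharp one, but only the order of the remainder matters. *)
Lemma convex_upper x y : f y - f x <= derive1 f x * (y - x) + K * (y - x) ^+ 2.
Proof.
have h1 := convex_lower y x; have h2 := lip y x.
have h3 : (derive1 f y - derive1 f x) * (y - x) <= K * (y - x) ^+ 2.
  apply: le_trans (ler_norm _) _; rewrite normrM.
  rewrite (_ : (y - x) ^+ 2 = `|y - x| * `|y - x|).
    by rewrite mulrA; apply: ler_wpM2r.
  by rewrite -normrM ger0_norm -?expr2 ?sqr_ge0.
lra.
Qed.

Lemma lipschitz_const_ge0 : 0 <= K.
Proof.
have := lip 1 0; rewrite subr0 normr1 mulr1; exact: le_trans.
Qed.

(** Difference quotients along a sequence, since measurability passes to limits of sequences. *)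
Lemma derive1_seq x : (n.+1%:R * (f (n.+1%:R^-1 + x) - f x)) @[n --> \oo] --> derive1 f x.
Proof.
have c1 : (fun h : R => h^-1 *: (f (h + x) - f x)) @ 0^' --> derive1 f x.
  have c0 : derivable f x 1 by exact: df.
  move: c0; rewrite /derivable /derive1.
  by under eq_fun do rewrite /= /shift/= [_ *: 1]mulr1.
have /cvgr_dnbhsP h := c1.
have u0 : (forall n, (fun n => n.+1%:R^-1 : R) n != 0) /\
    (n.+1%:R^-1 : R) @[n --> \oo] --> (0 : R).
  split; first by move=> n; rewrite invr_eq0.
  exact: cvg_harmonic.
by have := h _ u0; under eq_fun do rewrite invrK.
Qed.

End convex_function.

Section game_costs.
Context {R : realType} {T : R} {d0} {Omega0 : measurableType d0}.
Variable G : game T Omega0.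
Local Notation Om := (Omega0 * path_space T)%type.
Local Notation PS := (path_space T).
Local Notation P := (prob G).
Local Notation F := (Filt G).
Local Notation gg := (g G).
Hypotheses (T0 : 0 < T) (hb : stochastic_basis G).
Variable K : R.
Hypotheses (a1 : A1 K gg) (a2 : A2 gg) (a3 : A3 K gg).
Hypothesis cwd : cost_well_defined G.
Implicit Types (a b c : R -> Om -> R) (m : R -> Om -> P2 R) (eps : R).

Let cF : complete_filtration P T F.
Proof. by case: hb. Qed.

Lemma horizon : 0 <= T <= T.
Proof. by rewrite lexx ltW. Qed.

Definition noise eps (w : Om) : R :=
  xi0 G w.1 + sigma G * individual_noise G T w + eps * common_noise T w.

Lemma sqint_common : sqint P (common_noise T : Om -> R).
Proof. by case: hb => cF' _ bB _ _; exact: (sqint_brownian cF' bB horizon). Qed.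

Lemma sqint_noise eps : sqint P (noise eps).
Proof.
case: hb => cF' bW bB _ lx.
apply: sqintD; last by apply: sqintZ; exact: sqint_common.
apply: sqintD; first exact: L2_sqint.
by apply: sqintZ; exact: (sqint_brownian cF' bW horizon).
Qed.

Lemma stateE eps a w : state G eps a T w = noise eps w + tint T a w.
Proof. by rewrite /state /noise /tint; ring. Qed.

Lemma sqint_state eps a : admissible G a -> sqint P (state G eps a T).
Proof.
move=> Ha; rewrite (_ : state G eps a T = fun w => noise eps w + tint T a w).
  by apply: sqintD; [exact: sqint_noise|exact: (sqint_tint T0 cF Ha)].
by apply/funext => w; exact: stateE.
Qed.

Lemma state_lin eps a c h : admissible G a -> admissible G c ->
  {ae P, forall w, state G eps (fun t w => a t w + h * c t w) T w =
     state G eps a T w + h * tint T c w}.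
Proof.
move=> Ha Hc; apply: filterS (tint_lin T0 cF h Ha Hc) => w e.
by rewrite !stateE e; ring.
Qed.

Lemma admissible_cst (k : R) : admissible G (step 0 T (fun=> k)).
Proof.
apply: (H2_step T0 cF) => //; last exact: sqint_cst.
by apply: measurable_wrt_cst; apply: (filtration_sigma cF); rewrite lexx ltW.
Qed.

(** Second moment over the individual noise, given the common path of [w]. *)
Definition msec (X : Om -> R) (w : Om) : R := \int[P0 G]_w0 (X (w0, w.2) ^+ 2).

Lemma msec_ge0 X w : 0 <= msec X w.
Proof. by apply: Rintegral_ge0 => w0 _; exact: sqr_ge0. Qed.

Lemma sqint_msec X : sqint P X -> sqint P (fun w => Num.sqrt (msec X w)).
Proof.
move=> sX; have [ae1 i1 e1] := intg_fubini2 (sqint_intg2 sX).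
apply: intg2_sqint.
  apply: (measurableT_comp (f := @Num.sqrt R)).
    by apply: continuous_measurable_fun; exact: sqrt_continuous.
  apply: (measurableT_comp (f := fun v => \int[P0 G]_w0 (X (w0, v) ^+ 2))).
    exact: intg_meas i1.
  exact: measurable_snd.
rewrite (_ : (fun w => _) = fun w => msec X w).
  exact: (intg_snd (P0 G) i1).
by apply/funext => w; rewrite sqr_sqrtr// msec_ge0.
Qed.

(** Given the common path, [X] and [Y] are coupled through the individual noise. *)
Lemma W2_sections X Y (m m' : Om -> P2 R) : sqint P X -> sqint P Y ->
  {ae P, forall w, has_law (P0 G) (fun w0 => X (w0, w.2)) (m w)} ->
  {ae P, forall w, has_law (P0 G) (fun w0 => Y (w0, w.2)) (m' w)} ->
  {ae P, forall w, W2 (m w) (m' w) <= Num.sqrt (msec (fun w => X w - Y w) w)}.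
Proof.
move=> sX sY lX lY.
have sX2 := ae_snd (P0 G) (sqint_section2 sX).
have sY2 := ae_snd (P0 G) (sqint_section2 sY).
apply: filterS3 sX2 sY2 (filterI lX lY) => w s1 s2 [l1 l2].
exact: (W2_le s1 s2 l1 l2).
Qed.

Section given_flow.
Variables (eps : R) (b : R -> Om -> R) (m : R -> Om -> P2 R).
Hypotheses (eps0 : 0 <= eps) (Hb : admissible G b) (fm : conditional_flow G eps b m).

Lemma flow_section : {ae P, forall w,
  has_law (P0 G) (fun w0 => state G eps b T (w0, w.2)) (m T w)}.
Proof.
apply: (cond_law_section T0 hb); last exact: (fm horizon).
exact: sqint_meas (sqint_state eps Hb).
Qed.

Definition gain a (w : Om) : R := dx gg (state G eps a T w) (m T w).

Lemma intg_terminal a : admissible G a ->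
  intg P (fun w => gg (state G eps a T w) (m T w)).
Proof. by move=> Ha; exact: (cwd eps0 Ha Hb fm). Qed.

(** [cost_well_defined] makes the terminal cost measurable along states. Adding the constant
    [T^-1 / n.+1%:R] to the control shifts the terminal state by [n.+1%:R^-1], so the difference
    quotients in the state variable are measurable too, and they converge to [gain]. *)
Lemma gain_measurable_version a : admissible G a ->
  exists2 D, measurable_fun setT D & {ae P, forall w, D w = gain a w}.
Proof.
move=> Ha.
pose an n : R -> Om -> R := fun t w => a t w + n.+1%:R^-1 * step 0 T (fun=> T^-1) t w.
have Hn n : admissible G (an n) := H2_lin T0 cF n.+1%:R^-1 Ha (admissible_cst T^-1).
pose X := state G eps a T; pose Xn n := state G eps (an n) T.
have mX : measurable_fun setT X by exact: sqint_meas (sqint_state eps Ha).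
have mXn n : measurable_fun setT (Xn n) by exact: sqint_meas (sqint_state eps (Hn n)).
(* The shift is exact only almost surely; the quotients are cut off outside the event where it holds
   for every [n]. *)
pose E n : set Om := [set w | Xn n w = X w + n.+1%:R^-1].
have mE n : measurable (E n).
  rewrite (_ : E n = (fun w => Xn n w - (X w + n.+1%:R^-1)) @^-1` [set 0]).
    rewrite -[X in measurable X]setTI; apply: measurable_funB => //.
    exact: measurable_funD.
  by apply/seteqP; split => w /=; rewrite /E/=; [move->; rewrite subrr|move/eqP; rewrite subr_eq0 => /eqP].
pose EE := \bigcap_n E n.
have mEE : measurable EE by exact: bigcapT_measurable.
have aeE : {ae P, forall w, EE w}.
  have : {ae P, forall w, forall n, E n w}.
    apply: ae_foralln => n; apply: filterS (state_lin eps n.+1%:R^-1 Ha (admissible_cst T^-1)) => w.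
    by rewrite tint_step// ?ltW// subr0 mulfV ?gt_eqF// mulr1.
  by apply: filterS => w h n _; exact: h.
exists (fun w => \1_EE w * gain a w).
  apply: (@measurable_fun_cvg _ _ R setT (fun n w => \1_EE w * (n.+1%:R * (gg (Xn n w) (m T w) - gg (X w) (m T w))))).
    move=> n; apply: measurable_funM; first exact: measurable_indic.
    apply: measurable_funM => //; apply: measurable_funB.
      exact: intg_meas (intg_terminal (Hn n)).
    exact: intg_meas (intg_terminal Ha).
  move=> w _; rewrite indicE; case: (boolP (w \in EE)) => wE; last first.
    by under eq_fun do rewrite mul0r; rewrite mul0r; exact: cvg_cst.
  rewrite mul1r; under eq_fun do rewrite mul1r.
  have e n : Xn n w = n.+1%:R^-1 + X w by rewrite addrC; move: wE; rewrite inE => /(_ n I).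
  under eq_fun do rewrite e.
  have [d1 _] := a1.
  have dm x : derivable (fun y => gg y (m T w)) x 1 by exact: d1.
  have := @derive1_seq R (fun y => gg y (m T w)) dm (X w).
  exact.
by apply: filterS aeE => w wE; rewrite indicE mem_set// mul1r.
Qed.

(** Linear growth: (A1) and (A3) compare the derivative with its value at 0 and at the law of the
    constant 0, whose distance to the conditional law is at most the root of a conditional second
    moment of the state. *)
Lemma sqint_gain a D : admissible G a -> measurable_fun setT D ->
  {ae P, forall w, D w = gain a w} -> sqint P D.
Proof.
move=> Ha mD DE.
pose m0 := law_of (P0 G) (fun=> 0 : R).
have l0 : has_law (P0 G) (fun=> 0 : R) m0 by exact: law_ofP (sqint_cst _ 0).
have sb := sqint_state eps Hb; have sa := sqint_state eps Ha.
have w2 := W2_sections sb (sqint_cst P 0) flow_section (aeW P (fun=> l0)).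
pose B w := `|dx gg 0 m0| + K * `|state G eps a T w| +
   K * Num.sqrt (msec (fun w => state G eps b T w - 0) w).
have [d1 lip] := a1.
have K0 : 0 <= K.
  by have := lip 1 0 m0; rewrite subr0 normr1 mulr1; exact: le_trans.
have sB : sqint P B.
  apply: sqintD.
    by apply: sqintD; [exact: sqint_cst|apply: sqintZ; exact: sqint_norm].
  by apply: sqintZ; apply: sqint_msec; exact/sqintB/sqint_cst.
have DB : {ae P, forall w, `|D w| <= B w}.
  apply: filterS2 DE w2 => w -> le2; rewrite /gain.
  have h1 := lip (state G eps a T w) 0 (m T w).
  have h2 := a3 0 (m T w) m0; rewrite subr0 in h1.
  have h3 := ler_wpM2l K0 le2.
  have -> : dx gg (state G eps a T w) (m T w) = dx gg 0 m0
    + (dx gg (state G eps a T w) (m T w) - dx gg 0 (m T w))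
    + (dx gg 0 (m T w) - dx gg 0 m0) by ring.
  apply: le_trans (ler_normD _ _) _; apply: lerD; last exact: le_trans h2 h3.
  by apply: le_trans (ler_normD _ _) _; apply: lerD.
(* Truncating [D] at the bound changes it on a null set only and makes the domination hold
   everywhere. *)
apply: (@sqint_ae _ _ _ _ _ (fun w => Num.max (- B w) (Num.min (D w) (B w)))) => //.
  have B0 w : 0 <= B w by rewrite !addr_ge0 ?mulr_ge0.
  apply: (sqint_le _ sB).
    apply: measurable_maxr; first by apply: measurableT_comp => //; exact: sqint_meas sB.
    by apply: measurable_minr => //; exact: sqint_meas sB.
  move=> w; rewrite (ger0_norm (B0 w)) ler_norml.
  by rewrite le_max lexx/= ge_max ge_min lexx orbT andbT (le_trans _ (B0 w))// oppr_le0.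
apply: filterS DB => w; rewrite ler_norml => /andP[h1 h2].
by rewrite min_l// max_r.
Qed.

Lemma cost_real a : admissible G a -> cost G eps a m =
  (inner P T0 a a / 2 + \int[P]_w gg (state G eps a T w) (m T w))%:E.
Proof.
move=> Ha; have [pa sa] := (H2P T0 cF a).1 Ha.
have [_ i1 e1] := intg_fubini2 (sqint_intg2 sa).
pose q (w : Om) := \int[lebesgue_measure]_(t in `[0, T]) ((a t w) ^+ 2 / 2).
have qE : {ae P, forall w, q w = (T / 2) * \int[unifT T0]_s (tcut T a (s, w) ^+ 2)}.
  apply: filterS (H2_sqint_section T0 cF Ha) => w sw; have i2 := sqint_intg2 sw.
  rewrite -mulrA -RintZ// -Rintegral_unifT; last exact: intgZ.
  apply: eq_Rintegral => t; rewrite inE/= in_itv/= /tcut/= => ->.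
  by rewrite mulrC.
have mq : measurable_fun setT q.
  pose f (z : measurableTypeR R * Om) := tcut T a z ^+ 2 / 2.
  have mf : measurable_fun setT f.
    by apply: measurable_funM => //; apply: measurable_funX; exact: sqint_meas sa.
  rewrite (_ : q = fun w => \int[lebesgue_measure]_t f (t, w)).
    exact: (measurable_Rintegral2 lebesgue_measure mf).
  apply/funext => w; rewrite /q Rintegral_mkcond; apply: eq_Rintegral => t _.
  rewrite patchE /f /tcut/=; case: ifPn; first by rewrite inE/= in_itv/= => ->.
  by rewrite notin_setE/= in_itv/= => /negP/negbTE ->; rewrite expr0n/= mul0r.
have iq : intg P q.
  have i3 := intgZ (T / 2) i1.
  apply/integrableP; split; first exact/measurable_EFinP.
  rewrite (ae_eq_integral (fun w => `|(T / 2 * \int[unifT T0]_s (tcut T a (s, w) ^+ 2))%:E|%E))//.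
  - by case/integrableP : i3.
  - by apply: measurableT_comp => //; exact/measurable_EFinP.
  - by apply: measurableT_comp => //; exact: measurable_int i3.
  - by apply: filterS qE => w e _; rewrite -e.
have eq : \int[P]_w q w = inner P T0 a a / 2.
  rewrite (@Rint_ae _ _ _ P _ _ mq (intg_meas (intgZ (T / 2) i1)) qE) RintZ//.
  rewrite e1 /inner; under [in RHS]eq_Rintegral do rewrite -expr2.
  by ring.
have ig := intg_terminal Ha.
rewrite /cost unlock -eq -RintD// /Rintegral fineK//.
by apply: (@integrable_fin_num _ _ _ P setT) => //; exact: intgD.
Qed.

Lemma inner_expand a c h : admissible G a -> admissible G c ->
  inner P T0 (fun t w => a t w + h * c t w) (fun t w => a t w + h * c t w) =
  inner P T0 a a + 2 * h * inner P T0 a c + h ^+ 2 * inner P T0 c c.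
Proof.
move=> Ha Hc; have Hac := H2_lin T0 cF h Ha Hc.
rewrite (inner_linr T0 cF h Ha Hc Hac) inner_sym (inner_linr T0 cF h Ha Hc Ha).
rewrite [X in _ + _ + h * X](inner_sym P T0 (fun t w => a t w + h * c t w) c).
rewrite (inner_linr T0 cF h Ha Hc Hc) (inner_sym P T0 c a).
by ring.
Qed.

Lemma cost_lower a c D : admissible G a -> admissible G c -> sqint P D ->
  {ae P, forall w, D w = gain a w} ->
  (cost G eps a m + (inner P T0 a c + inner P T0 c c / 2
      + \int[P]_w (D w * tint T c w))%:E
    <= cost G eps (fun t w => a t w + c t w)%R m)%E.
Proof.
move=> Ha Hc sD DE.
rewrite (_ : (fun t w => a t w + c t w) = fun t w => a t w + 1 * c t w); last first.
  by apply/funext => t; apply/funext => w; rewrite mul1r.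
have Hac := H2_lin T0 cF 1 Ha Hc.
rewrite !cost_real// inner_expand// -EFinD lee_fin.
have sc := sqint_tint T0 cF Hc; have iDc := sqintM sD sc.
have i1 := intg_terminal Ha; have i2 := intg_terminal Hac.
have : \int[P]_w gg (state G eps a T w) (m T w) + \int[P]_w (D w * tint T c w) <=
    \int[P]_w gg (state G eps (fun t w => a t w + 1 * c t w) T w) (m T w).
  rewrite -RintD//; apply: Rint_ae_le => //; first exact: intgD.
  apply: filterS2 DE (state_lin eps 1 Ha Hc) => w -> ->.
  rewrite mul1r addrC -lerBrDr; have [d1 lip] := a1.
  have := convex_lower (fun x => d1 x (m T w)) (fun x y => a2 x y (m T w))
    (state G eps a T w) (state G eps a T w + tint T c w).
  by rewrite addrAC subrr add0r.
rewrite mulr1 expr1n mul1r.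
move: (\int[P]_w gg (state G eps a T w) (m T w)) (\int[P]_w gg _ _) (\int[P]_w _).
move: (inner P T0 a a) (inner P T0 a c) (inner P T0 c c) => x y z u v r.
by lra.
Qed.

Lemma cost_upper a c h D : admissible G a -> admissible G c -> sqint P D ->
  {ae P, forall w, D w = gain a w} ->
  (cost G eps (fun t w => a t w + h * c t w)%R m <= cost G eps a m +
    (h * (inner P T0 a c + \int[P]_w (D w * tint T c w))
     + h ^+ 2 * (inner P T0 c c / 2 + K * \int[P]_w (tint T c w ^+ 2)))%:E)%E.
Proof.
move=> Ha Hc sD DE; have Hac := H2_lin T0 cF h Ha Hc.
rewrite !cost_real// inner_expand// -EFinD lee_fin.
have sc := sqint_tint T0 cF Hc; have iDc := sqintM sD sc.
have ic2 := sqint_intg2 sc.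
have i1 := intg_terminal Ha; have i2 := intg_terminal Hac.
have : \int[P]_w gg (state G eps (fun t w => a t w + h * c t w) T w) (m T w) <=
   \int[P]_w (gg (state G eps a T w) (m T w) + (h * (D w * tint T c w) + (h ^+ 2 * K) * tint T c w ^+ 2)).
  apply: Rint_ae_le => //.
    by apply: intgD => //; apply: intgD; exact: intgZ.
  apply: filterS2 DE (state_lin eps h Ha Hc) => w -> ->.
  rewrite addrC -lerBlDr addrC; have [d1 lip] := a1.
  have := convex_upper (fun x => d1 x (m T w)) (fun x y => lip x y (m T w))
    (fun x y => a2 x y (m T w))
    (state G eps a T w) (state G eps a T w + h * tint T c w).
  rewrite /gain /dx; lra.
rewrite RintD//; last by apply: intgD; exact: intgZ.
rewrite RintD; [|exact: intgZ..]; rewrite !RintZ//.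
move: (\int[P]_w gg (state G eps a T w) (m T w)) (\int[P]_w gg _ _) (\int[P]_w (D w * _)) (\int[P]_w (_ ^+ 2)).
move: (inner P T0 a a) (inner P T0 a c) (inner P T0 c c) => x y z u v r s.
by lra.
Qed.

(** By [cost_upper], optimality makes a quadratic polynomial in [h] without constant term
    nonnegative, so its linear coefficient vanishes. *)
Lemma first_order a D : admissible G a -> sqint P D ->
  {ae P, forall w, D w = gain a w} ->
  (forall c, admissible G c -> (cost G eps a m <= cost G eps c m)%E) ->
  forall c, admissible G c ->
  inner P T0 a c = - \int[P]_w (D w * tint T c w).
Proof.
move=> Ha sD DE opt c Hc.
set I := \int[P]_w _; set beta := inner P T0 a c + I.
set gam := inner P T0 c c / 2 + K * \int[P]_w (tint T c w ^+ 2).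
have key h : 0 <= h * beta + h ^+ 2 * gam.
  have := le_trans (opt _ (H2_lin T0 cF h Ha Hc)) (cost_upper h Ha Hc sD DE).
  by rewrite cost_real// -EFinD lee_fin lerDl.
suff : beta = 0 by move=> /eqP; rewrite addr_eq0 => /eqP.
have g0 : 0 <= gam.
  by have := key 1; have := key (-1); rewrite sqrrN expr1n; lra.
have g1 : 0 < gam + 1 by lra.
(* At this [h] the polynomial is bounded by its completed value, minus the square of
   [beta / (gam + 1)]; the added 1 keeps the denominator positive. *)
have := key (- (beta / (gam + 1))).
rewrite (_ : _ + _ = - ((beta / (gam + 1)) ^+ 2)); last by field; rewrite gt_eqF.
rewrite oppr_ge0 => h.
have /eqP : (beta / (gam + 1)) ^+ 2 == 0 by rewrite eq_le h sqr_ge0.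
move/eqP; rewrite sqrf_eq0 mulf_eq0 invr_eq0 => /orP[/eqP//|/eqP e].
by move: g1; rewrite e ltxx.
Qed.

End given_flow.

End game_costs.

(** * The adjoint process is a martingale *)


Lemma sqint_EFin d (Om : measurableType d) (R : realType) (P : probability Om R)
    (f : Om -> R) : sqint P f ->
  (\int[P]_w ((f w) ^+ 2)%:E)%E = (\int[P]_w (f w ^+ 2))%:E.
Proof.
move=> sf; rewrite /Rintegral fineK//.
by apply: (@integrable_fin_num _ _ _ P setT) => //; exact: sqint_intg2.
Qed.

Section ito_martingale.
Context d (Om : measurableType d) (R : realType) (P : probability Om R).
Variables (T : R) (F : R -> set (set Om)).
Hypotheses (T0 : 0 < T) (cF : complete_filtration P T F).
Variable B : R -> Om -> R.
Hypothesis bB : brownian_motion P T F B.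
Implicit Types (s t : R) (H M : R -> Om -> R) (h : @simple_process R d Om) (z : Om -> R).

Lemma sqint_simple_integral h t : simple_adapted T F h -> 0 <= t <= T ->
  sqint P (simple_integral B h t).
Proof.
move=> ha /andP[t0 tT]; apply: sqint_sum => i.
have [l0 lr rT mz [C zC]] := ha i.
have lT : 0 <= sp_l i <= T by rewrite l0 (le_trans lr).
apply: (sqintMb (M := C)) => //.
  exact: (measurable_wrt_meas (filtration_sub cF lT) mz).
apply: (sqint_increment cF bB); first by rewrite le_min l0.
  by rewrite le_min !ge_min lexx lr !orbT.
by rewrite ge_min rT.
Qed.

(** Each interval contributes its part after [t]. Its coefficient times [z] is known at the maximum
    of [sp_l i] and [t], hence orthogonal to the increment that remains. *)
Lemma simple_integral_orth h t z : simple_adapted T F h -> 0 <= t <= T ->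
  measurable_wrt (F t) z -> sqint P z ->
  \int[P]_w (z w * (simple_integral B h T w - simple_integral B h t w)) = 0.
Proof.
move=> ha t01 mz sz; have [t0 tT] := andP t01.
pose u i w := sp_zeta (s := h) i w * (B (Num.max (sp_r i) t) w - B (Num.max (sp_l i) t) w).
have uE w : simple_integral B h T w - simple_integral B h t w = \sum_(i < sp_size h) u i w.
  rewrite /simple_integral -sumrB; apply: eq_bigr => i _.
  have [l0 lr rT _ _] := ha i; rewrite -mulrBr; congr (_ * _).
  rewrite (min_l rT) (min_l (le_trans lr rT)).
  have [lt|lt] := leP (sp_l i) t; have [rt|rt] := leP (sp_r i) t; rewrite ?max_r ?max_l//; try lra.
under eq_Rintegral do rewrite uE mulr_sumr.
have key i : intg P (fun w => z w * u i w) /\ \int[P]_w (z w * u i w) = 0.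
  have [l0 lr rT mzi [C zC]] := ha i.
  pose s := Num.max (sp_l i) t; pose r := Num.max (sp_r i) t.
  have ls : sp_l i <= s by rewrite le_max lexx.
  have ts : t <= s by rewrite le_max lexx orbT.
  have s0 : 0 <= s by exact: le_trans ls.
  have sr : s <= r by rewrite ge_max !le_max lr lexx orbT.
  have rT' : r <= T by rewrite ge_max rT.
  have sT := le_trans sr rT'.
  have s01 : 0 <= s <= T by rewrite s0.
  have mzi' := measurable_wrt_mono cF l0 ls sT mzi.
  have mz' := measurable_wrt_mono cF t0 ts sT mz.
  have szz : sqint P (fun w => sp_zeta i w * z w).
    by apply: (sqintMb (M := C)) => //; exact: (measurable_wrt_meas (filtration_sub cF s01) mzi').
  have mzz : measurable_wrt (F s) (fun w => sp_zeta i w * z w).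
    have sF := filtration_sigma cF s01.
    apply/(measurable_wrtP sF); apply: measurable_funM; exact/(measurable_wrtP sF).
  have e w : z w * u i w = (sp_zeta i w * z w) * (B r w - B s w) by rewrite /u mulrCA mulrA.
  rewrite (_ : (fun w => z w * u i w) = fun w => (sp_zeta i w * z w) * (B r w - B s w)); last exact/funext.
  split; first by apply: sqintM => //; exact: (sqint_increment cF bB).
  exact: (increment_orth cF bB).
rewrite Rint_sum => [|i]; last by case: (key i).
by rewrite big1// => i _; case: (key i).
Qed.

Lemma Rint_mul_lim (f : nat -> Om -> R) (z g : Om -> R) :
  sqint P z -> sqint P g -> (forall n, sqint P (f n)) ->
  (forall n, \int[P]_w (z w * f n w) = 0) ->
  ((\int[P]_w ((f n w - g w) ^+ 2)%:E)%E @[n --> \oo] --> 0%E) ->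
  \int[P]_w (z w * g w) = 0.
Proof.
move=> sz sg sf f0 fg.
have e n : (\int[P]_w (z w * g w)) ^+ 2 <= \int[P]_w (z w ^+ 2) * \int[P]_w ((f n w - g w) ^+ 2).
  apply: le_trans (Rint_CS sz (sqintB (sf n) sg)).
  under [in leRHS]eq_Rintegral do rewrite mulrBr.
  by rewrite RintB ?f0 ?sub0r ?sqrrN//; exact: sqintM.
have lim0 : (\int[P]_w ((f n w - g w) ^+ 2)) @[n --> \oo] --> (0 : R).
  apply: fine_cvg; exact: fg.
have lim1 : \int[P]_w (z w ^+ 2) * \int[P]_w ((f n w - g w) ^+ 2) @[n --> \oo] --> (\int[P]_w (z w ^+ 2) * 0 : R).
  by apply: cvgM => //; exact: cvg_cst.
rewrite mulr0 in lim1.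
have le0 : (\int[P]_w (z w * g w)) ^+ 2 <= 0.
  by apply: (cvgr_to_ge lim1); exact: nearW.
by apply/eqP; rewrite -sqrf_eq0 eq_le le0 sqr_ge0.
Qed.

(** A single simple integral at finite mean square distance is enough. *)
Lemma ito_sqint H M t : ito_integral P T F B H M -> 0 <= t <= T -> sqint P (M t).
Proof.
move=> [mM [h [ha _ hM]]] t01.
have mMt : measurable_fun setT (M t) := measurable_wrt_meas (filtration_sub cF t01) (mM t t01).
have /fine_cvgP[[N _ fin] _] := hM t t01.
have sI : sqint P (simple_integral B (h N) t) by exact: sqint_simple_integral.
apply: (sqint_lim mMt sI).
by have := fin N (leqnn N); rewrite ge0_fin_numE// integral_ge0// => w _; rewrite lee_fin sqr_ge0.
Qed.

Lemma ito_orth H M t z : ito_integral P T F B H M -> 0 <= t <= T ->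
  measurable_wrt (F t) z -> sqint P z ->
  \int[P]_w (z w * (M T w - M t w)) = 0.
Proof.
move=> iM t01 mz sz; have T01 : 0 <= T <= T by rewrite lexx ltW.
have key s : 0 <= s <= T -> sqint P (M s) by move=> ?; exact: (ito_sqint iM).
have [mM [h [ha _ hM]]] := iM.
have sI s n : 0 <= s <= T -> sqint P (simple_integral B (h n) s) by exact: sqint_simple_integral.
apply: (Rint_mul_lim (f := fun n w => simple_integral B (h n) T w - simple_integral B (h n) t w)) => //.
- by apply: sqintB; exact: key.
- by move=> n; apply: sqintB; exact: sI.
- by move=> n; exact: simple_integral_orth.
(* The squared error of a difference is at most twice the sum of the two squared errors. *)
have l0 : ((2%:E * (\int[P]_w ((simple_integral B (h n) T w - M T w) ^+ 2)%:E) +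
  2%:E * (\int[P]_w ((simple_integral B (h n) t w - M t w) ^+ 2)%:E))%E @[n --> \oo] --> (2%:E * 0 + 2%:E * 0)%E).
  by apply: cvgeD => //; apply: cvgeZl => //; exact: hM.
rewrite !mule0 adde0 in l0.
apply: (squeeze_cvge _ (cvg_cst 0%E) l0).
apply: nearW => n; rewrite integral_ge0//=; last by move=> w _; rewrite lee_fin sqr_ge0.
have s1 : sqint P (fun w => simple_integral B (h n) T w - M T w).
  by apply: sqintB; [exact: sI|exact: key].
have s2 : sqint P (fun w => simple_integral B (h n) t w - M t w).
  by apply: sqintB; [exact: sI|exact: key].
have s3 : sqint P (fun w => (simple_integral B (h n) T w - simple_integral B (h n) t w) - (M T w - M t w)).
  by apply: sqintB; apply: sqintB; [exact: sI|exact: sI|exact: key|exact: key].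
rewrite !sqint_EFin// -!EFinM -EFinD lee_fin -!RintZ; [|exact: sqint_intg2..].
rewrite -RintD; [|by apply: intgZ; exact: sqint_intg2..].
apply: Rint_le => [||w]; first exact: sqint_intg2.
  by apply: intgD; apply: intgZ; exact: sqint_intg2.
rewrite -subr_ge0 (_ : _ - _ = ((simple_integral B (h n) T w - M T w) +
  (simple_integral B (h n) t w - M t w)) ^+ 2) ?sqr_ge0//.
by ring.
Qed.

End ito_martingale.

Section nonempty_ae.
Context d (Om : measurableType d) (R : realType) (P : probability Om R).

Lemma ae_ex (A : Om -> Prop) : {ae P, forall w, A w} -> exists w, A w.
Proof.
move=> hA; apply/not_existsP => nA.
have [B [mB PB sB]] := hA.
have BT : B = setT by apply/seteqP; split=> // w _; exact: (sB w (nA w)).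
have := PB; rewrite BT probability_setT => /eqP.
by rewrite eqe oner_eq0.
Qed.

Lemma ae_and (A B : Om -> Prop) : {ae P, forall w, A w} -> {ae P, forall w, B w} ->
  {ae P, forall w, A w /\ B w}.
Proof. exact: filterI. Qed.

Lemma ae_sub (A B : Om -> Prop) : (forall w, A w -> B w) ->
  {ae P, forall w, A w} -> {ae P, forall w, B w}.
Proof. exact: filterS. Qed.

End nonempty_ae.

Lemma ae_unifT (R : realType) (T : R) (T0 : 0 < T) : {ae unifT T0, forall t, 0 <= t <= T}.
Proof.
pose A : set (measurableTypeR R) := ~` `[0, T]%classic.
have mA : measurable A by apply: measurableC; exact: measurable_itv.
exists A; split => //.
have m1 : measurable_fun setT (\1_A : measurableTypeR R -> R) by exact: measurable_indic.
have mI : measurable_fun setT (EFin \o (\1_A : measurableTypeR R -> R)).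
  exact: (@measurableT_comp _ _ _ _ _ _ EFin).
have h0 x : (0 <= (\1_A x)%:E :> \bar R)%E by rewrite lee_fin.
have e := ge0_integral_unifT T0 mI h0.
have e2 : (\int[unifT T0]_x (\1_A x)%:E = unifT T0 A)%E by rewrite integral_indic// setIT.
move: e; rewrite e2 integral0_eq => [/esym/eqP|x xT]; last first.
  by rewrite /= indicE memNset// => /(_ xT).
by rewrite mule_eq0 eqe gt_eqF//= => /eqP.
Qed.

Section martingale_control.
Context d (Om : measurableType d) (R : realType) (P : probability Om R).
Variables (T : R) (F : R -> set (set Om)).
Hypotheses (T0 : 0 < T) (cF : complete_filtration P T F).
Variables B1 B2 Q1 Q2 M N V : R -> Om -> R.
Hypotheses (b1 : brownian_motion P T F B1) (b2 : brownian_motion P T F B2).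
Hypotheses (iM : ito_integral P T F B1 Q1 M) (iN : ito_integral P T F B2 Q2 N).
Hypothesis VE : forall t, 0 <= t <= T -> {ae P, forall w, V t w = V 0 w + M t w + N t w}.
Hypothesis HV : H2 P T F V.
Implicit Types (s t : R).

(** Membership in [H2] makes [V] square integrable at almost every time only. One such time and the
    stochastic integrals recover [V 0], and from it all other times. *)
Lemma sqint_martingale t : 0 <= t <= T -> sqint P (V t).
Proof.
have [pV sV] := (H2P T0 cF V).1 HV.
have mV s : 0 <= s <= T -> measurable_fun setT (V s).
  by move=> s01; apply: (measurable_wrt_meas (filtration_sub cF s01)); exact: (progressive_section cF pV s01).
have [s [s01 sVs]] := ae_ex (ae_and (ae_unifT T0) (sqint_section1 sV)).
have VsE w : tcut T V (s, w) = V s w by rewrite /tcut/= s01.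
have {}sVs : sqint P (V s) by move: sVs; under eq_fun do rewrite VsE.
have sM r : 0 <= r <= T -> sqint P (M r) by exact: (ito_sqint cF b1 iM).
have sN r : 0 <= r <= T -> sqint P (N r) by exact: (ito_sqint cF b2 iN).
have sV0 : sqint P (V 0).
  apply: (sqint_ae _ (sqintB (sqintB sVs (sM s s01)) (sN s s01))).
    by apply: mV; rewrite lexx ltW.
  by apply: filterS (VE s01) => w ->; ring.
move=> t01; apply: (sqint_ae (mV _ t01) _ (VE t01)).
by apply: sqintD; [exact/sqintD/sM|exact: sN].
Qed.

Lemma martingale_orth t z : 0 <= t <= T -> measurable_wrt (F t) z -> sqint P z ->
  \int[P]_w (z w * V T w) = \int[P]_w (z w * V t w).
Proof.
move=> t01 mz sz; have T01 : 0 <= T <= T by rewrite lexx ltW.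
have sVT := sqint_martingale T01; have sVt := sqint_martingale t01.
have sM r : 0 <= r <= T -> sqint P (M r) by exact: (ito_sqint cF b1 iM).
have sN r : 0 <= r <= T -> sqint P (N r) by exact: (ito_sqint cF b2 iN).
apply/eqP; rewrite -subr_eq0 -RintB; [|exact: sqintM..].
rewrite (@Rint_ae _ _ _ P _ (fun w => z w * (M T w - M t w) + z w * (N T w - N t w))).
- rewrite RintD; [|by apply: sqintM => //; apply: sqintB; auto..].
  by rewrite (ito_orth T0 cF b1 iM)// (ito_orth T0 cF b2 iN)// addr0.
- by apply: (@intg_meas _ _ _ P); apply: intgB; apply: sqintM.
- by apply: (@intg_meas _ _ _ P); apply: intgD; apply: sqintM => //; apply: sqintB; auto.
- by apply: filterS2 (VE T01) (VE t01) => w -> ->; ring.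
Qed.

(** At almost every time the value of the control is known, so the martingale [V] may be replaced by
    its terminal value; Fubini then collects the control into its integral. *)
Lemma inner_martingale a : H2 P T F a ->
  inner P T0 V a = \int[P]_w (V T w * tint T a w).
Proof.
move=> Ha; have [pa sa] := (H2P T0 cF a).1 Ha.
have [pV sV] := (H2P T0 cF V).1 HV.
have T01 : 0 <= T <= T by rewrite lexx ltW.
have sVT := sqint_martingale T01.
rewrite (tint_inner T0 cF Ha sVT) /inner; congr (_ * _).
have [_ i1 <-] := intg_fubini1 (sqintM sV sa).
have [_ i2 <-] := intg_fubini1 (sqintM (sqint_snd (unifT T0) sVT) sa).
apply: Rint_ae; [exact: intg_meas i1|exact: intg_meas i2|].
apply: ae_sub (ae_and (ae_unifT T0) (sqint_section1 sa)) => t [t01 sat].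
have aE w : tcut T a (t, w) = a t w by rewrite /tcut/= t01.
have VtE w : tcut T V (t, w) = V t w by rewrite /tcut/= t01.
under eq_Rintegral do rewrite aE VtE mulrC.
under [RHS]eq_Rintegral do rewrite aE /= mulrC.
rewrite (martingale_orth t01)//; first exact: (progressive_section cF pa t01).
by move: sat; under eq_fun do rewrite aE.
Qed.

End martingale_control.

(** * The derivative in the measure along an arbitrary direction *)


Lemma same_law_integral d1 d2 (T1 : measurableType d1) (T2 : measurableType d2)
    (R : realType) (m1 : {measure set T1 -> \bar R}) (m2 : {measure set T2 -> \bar R})
    (X1 : T1 -> R) (X2 : T2 -> R) (h : R -> R) :
  measurable_fun setT X1 -> measurable_fun setT X2 ->
  (forall C : set R, measurable C -> m1 (X1 @^-1` C) = m2 (X2 @^-1` C)) ->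
  measurable_fun setT h ->
  (\int[m1]_x (h (X1 x))%:E = \int[m2]_x (h (X2 x))%:E)%E.
Proof.
move=> mX1 mX2 e mh.
pose Xm := isMeasurableFun.Build _ _ T2 (measurableTypeR R) X2 mX2.
pose Xf : {mfun T2 >-> measurableTypeR R} := HB.pack X2 Xm.
have key (f : R -> \bar R) : measurable_fun setT f -> (forall x, 0 <= f x)%E ->
    (\int[m1]_x f (X1 x) = \int[m2]_x f (X2 x))%E.
  move=> mf f0.
  rewrite -(@ge0_integral_law _ _ _ m1 X1 (pushforward m2 Xf) mX1)//; last first.
    by move=> C mC; rewrite e.
  by rewrite (@ge0_integral_law _ _ _ m2 X2 (pushforward m2 Xf) mX2).
have mEh : measurable_fun setT (EFin \o h) by exact/measurable_EFinP.
rewrite [LHS]integralE [RHS]integralE; congr (_ - _)%E.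
  transitivity (\int[m1]_x ((EFin \o h)^\+ (X1 x)))%E.
    by apply: eq_integral => x _; rewrite !funeposE.
  rewrite (key _ (measurable_funepos mEh) (funepos_ge0 _)).
  by apply: eq_integral => x _; rewrite !funeposE.
transitivity (\int[m1]_x ((EFin \o h)^\- (X1 x)))%E.
  by apply: eq_integral => x _; rewrite !funenegE.
rewrite (key _ (measurable_funeneg mEh) (funeneg_ge0 _)).
by apply: eq_integral => x _; rewrite !funenegE.
Qed.

Lemma nondecreasing_union_le d (T : measurableType d) (R : realType)
    (nu : probability T R) (B : nat -> set T) (c : \bar R) :
  (forall n, measurable (B n)) -> (forall n m, (n <= m)%N -> B n `<=` B m) ->
  (forall n, nu (B n) <= c)%E -> (nu (\bigcup_n B n) <= c)%E.
Proof.
move=> mB Bn Bc; have := @nondecreasing_cvg_mu _ _ _ nu B mB (bigcupT_measurable _ mB).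
move=> /(_ _)/cvge_to_le; apply; last exact: nearW.
by move=> n m nm; apply/subsetPset; exact: Bn.
Qed.

(** * The quantile transform on [Phat] *)

Section quantile.
Context (R : realType).
Local Notation mR := (measurableTypeR R).
Variable nu : probability mR R.
Implicit Types (u r x : R) (C : set R).

Lemma Phat_itv c : 0 <= c <= 1 -> (@Phat R) `]0, c[%classic = c%:E.
Proof.
move=> /andP[c0 c1]; pose A : set mR := `]0, c[%classic.
have mA : measurable A by exact: measurable_itv.
have mI : measurable_fun setT (EFin \o (\1_A : mR -> R)).
  exact: (@measurableT_comp _ _ _ _ _ _ EFin).
have h0 x : (0 <= (EFin \o (\1_A : mR -> R)) x)%E by rewrite lee_fin.
have := ge0_integral_unifT ltr01 mI h0.
have i1 : (\int[lebesgue_measure]_(x in `[0%R, 1%R]) (EFin \o (\1_A : mR -> R)) x = lebesgue_measure (A `&` `[0%R, 1%R]))%E.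
  by rewrite integral_indic//; exact: measurable_itv.
have i2 : (\int[unifT ltr01]_x (EFin \o (\1_A : mR -> R)) x = (@Phat R) A)%E.
  by rewrite integral_indic// setIT.
rewrite i1 i2 mul1e => <-.
rewrite setIidl; last first.
  by move=> x /=; rewrite /A/= !in_itv/= => /andP[x0 xc]; rewrite !ltW// (lt_le_trans xc).
rewrite lebesgue_measure_itv/= lte_fin; case: ltP => [_|c0']; first by rewrite sube0.
by congr (_%:E); apply/le_anti; rewrite c0.
Qed.

Let ray x : set mR := `]-oo, x[%classic.

Let mray x : measurable (ray x). Proof. exact: measurable_itv. Qed.

Let ray_le x y : x <= y -> (nu (ray x) <= nu (ray y))%E.
Proof.
move=> xy; apply: le_measure; rewrite ?inE; [exact: mray..|].
by move=> z; rewrite /ray/= !in_itv/= => /lt_le_trans; apply.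
Qed.

Definition quantile u : R :=
  if 0 < u < 1 then sup [set x | (nu `]-oo, x[%classic <= u%:E)%E] else 0.

(** With open rays the supremum gives an exact equivalence: continuity of [nu] from below rules out
    [r <= quantile u] as soon as the ray up to [r] has mass above [u]. The same continuity, for the
    rays and for their complements, makes the supremum finite. *)
Lemma quantile_lt u r : 0 < u < 1 -> (quantile u < r) = (u%:E < nu `]-oo, r[%classic)%E.
Proof.
move=> /[dup] u01 /andP[u0 u1]; rewrite /quantile u01.
set S := [set x | _].
have uS : has_ubound S.
  have [|nh] := pselect (exists n : nat, (u%:E < nu (ray n%:R))%E).
    move=> [n hn]; exists n%:R => x Sx; rewrite leNgt; apply/negP => nx.
    by have := lt_le_trans hn (le_trans (ray_le (ltW nx)) Sx); rewrite ltxx.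
  exfalso; have : (nu (\bigcup_n ray n%:R) <= u%:E)%E.
    apply: nondecreasing_union_le => [n|n m nm x|n]; first exact: mray.
      by rewrite /ray/= !in_itv/= => /lt_le_trans; apply; rewrite ler_nat.
    by rewrite leNgt; apply/negP => h; apply: nh; exists n.
  rewrite (_ : \bigcup_n _ = setT); last first.
    apply/seteqP; split => // x _; exists (Num.truncn x).+1 => //=.
    by rewrite /ray/= in_itv/= truncnS_gt.
  by rewrite probability_setT lee_fin leNgt u1.
have S0 : S !=set0.
  have [|nh] := pselect (exists n : nat, (nu (ray (- n%:R)) <= u%:E)%E).
    by move=> [n hn]; exists (- n%:R).
  exfalso; have : (nu (\bigcup_n ~` ray (- n%:R)) <= (1 - u)%:E)%E.
    apply: nondecreasing_union_le => [n|n m nm x|n].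
    - by apply: measurableC; exact: mray.
    - rewrite /ray/= !in_itv/= => /negP; rewrite -leNgt => h; apply/negP; rewrite -leNgt.
      by apply: le_trans h; rewrite lerN2 ler_nat.
    - rewrite probability_setC; last exact: mray.
      rewrite EFinB; apply: leeB => //; rewrite leNgt; apply/negP => h.
      by apply: nh; exists n; exact: ltW.
  rewrite (_ : \bigcup_n _ = setT); last first.
    apply/seteqP; split => // x _; exists (Num.bound x) => //=.
    rewrite /ray/= in_itv/=; apply/negP; rewrite -leNgt lerNl.
    by rewrite ltW// ltrNbound.
  by rewrite probability_setT lee_fin leNgt gtrBl u0.
apply/idP/idP => [qr|ur].
  rewrite ltNge; apply/negP => Sr.
  by have := lt_le_trans qr (ub_le_sup uS Sr); rewrite ltxx.
rewrite ltNge; apply/negP => rq.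
suff : (nu (ray r) <= u%:E)%E by rewrite leNgt ur.
rewrite (_ : ray r = \bigcup_n ray (r - n.+1%:R^-1)); last first.
  apply/seteqP; split => [x|x [n _]]; rewrite /ray/= !in_itv/= => h; last first.
    by rewrite (lt_le_trans h)// gerBl.
  have d0 : 0 < r - x by rewrite subr_gt0.
  exists (Num.truncn (r - x)^-1) => //=; rewrite /ray/= in_itv/= ltrBrDl -ltrBrDr.
  by rewrite invf_plt ?posrE// truncnS_gt.
apply: nondecreasing_union_le => [n|n m nm x|n]; first exact: mray.
  rewrite /ray/= !in_itv/= => /lt_le_trans; apply.
  by rewrite lerB// lef_pV2 ?posrE// ler_nat.
have [] := @sup_adherent _ S n.+1%:R^-1 _ (conj S0 uS); first by rewrite invr_gt0.
move=> x Sx lt; apply: le_trans Sx; apply: ray_le; apply: ltW.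
by apply: le_lt_trans lt; rewrite lerB.
Qed.

Lemma measurable_quantile : measurable_fun setT (quantile : mR -> R).
Proof.
pose I : set mR := `]0, 1[%classic.
have mI : measurable I by exact: measurable_itv.
apply: (measurability (@RGenInftyO.G R)) => [|/= _ [_] [r] -> <-].
  exact: RGenInftyO.measurableE.
rewrite setTI (_ : _ @^-1` _ = (I `&` `]-oo, fine (nu (ray r))[%classic)
    `|` (~` I `&` [set u | 0 < r])); last first.
  apply/seteqP; split => u /=; rewrite /I/= !in_itv/=.
    have [u01|u01] := boolP (0 < u < 1).
      by rewrite quantile_lt// -[X in (_ < X)%E]fine_prob// lte_fin; left.
    by rewrite /quantile (negbTE u01); right.
  case=> [[u01]|[/negP/negbTE u01]].
    by rewrite quantile_lt// -[X in (_ < X)%E]fine_prob// lte_fin.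
  by rewrite /quantile u01.
apply: measurableU; first by apply: measurableI => //; exact: measurable_itv.
apply: measurableI; first exact: measurableC.
have [r0|r0] := boolP (0 < r).
  by rewrite (_ : [set _ | _] = setT)//; apply/seteqP; split.
by rewrite (_ : [set _ | _] = set0)//; apply/seteqP; split.
Qed.

(** Up to a [Phat]-null set, the event [quantile < r] is the interval from 0 to the mass of the ray
    up to [r]. *)
Lemma quantile_law C : measurable C -> nu C = (@Phat R) (quantile @^-1` C).
Proof.
apply: law_by_rays => [|q]; first exact: measurable_quantile.
pose I : set mR := `]0, 1[%classic.
have mI : measurable I by exact: measurable_itv.
have PI : (@Phat R) (~` I) = 0%E.
  by rewrite probability_setC// Phat_itv ?lexx ?ler01// subee.
set A := _ @^-1` _.
have mA : measurable A.
  by rewrite -[A]setTI; apply: measurable_quantile => //; exact: measurable_itv.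
set c := nu _; have c01 : 0 <= fine c <= 1.
  apply/andP; split; first by apply: fine_ge0; exact: measure_ge0.
  by rewrite -lee_fin /c fine_prob ?probability_le1//; exact: measurable_itv.
have e : A `&` I = `]0, fine c[%classic.
  apply/seteqP; split => u; rewrite /A /I/= !in_itv/=.
    case=> + u01; rewrite quantile_lt// -[X in (_ < X)%E]fine_prob// lte_fin => ->.
    by rewrite andbT; case/andP: u01.
  move=> /andP[u0 uc]; have u01 : 0 < u < 1.
    by rewrite u0 (lt_le_trans uc)//; case/andP: c01.
  by split => //; rewrite quantile_lt// -[X in (_ < X)%E]fine_prob// lte_fin.
have eI : (@Phat R) (A `&` I) = c by rewrite e Phat_itv// fine_prob.
apply/eqP; rewrite eq_le; apply/andP; split.
  rewrite -eI; apply: le_measure; rewrite ?inE//; first exact: measurableI.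
apply: (@le_trans _ _ ((@Phat R) ((A `&` I) `|` ~` I))).
  apply: le_measure; rewrite ?inE//.
    by apply: measurableU; [exact: measurableI|exact: measurableC].
  by move=> u Au; have [Iu|Iu] := pselect (I u); [left|right].
rewrite -[leRHS]adde0 -PI -eI; apply: measureU2; first exact: measurableI.
exact: measurableC.
Qed.

End quantile.

Section decode.
Context (R : realType).
Local Notation mR := (measurableTypeR R).
Implicit Types x z : R.

(** A bijection of the line onto []0, 1[], so that a real number fits into a fractional part. The
    reciprocal is written as a power, from which measurability is derived below. *)
Definition squeeze x : R := (1 + x * (1 + `|x|) `^ (-1)) / 2.

Definition unsqueeze z : R := (2 * z - 1) * (1 - `|2 * z - 1|) `^ (-1).

Lemma squeeze_itv x : 0 < squeeze x < 1.
Proof.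
rewrite /squeeze powR_inv1 ?addr_ge0//.
have h : 0 < 1 + `|x| by rewrite ltr_pwDl.
have : -1 < x / (1 + `|x|) < 1.
  rewrite ltr_pdivlMr// ltr_pdivrMr// mul1r mulN1r ltrNl.
  rewrite (le_lt_trans (ler_norm x)) ?ltrDr// andbT.
  by rewrite (le_lt_trans (ler_norm (- x)))// normrN ltrDr.
by lra.
Qed.

Lemma squeezeK x : unsqueeze (squeeze x) = x.
Proof.
have h : 0 < 1 + `|x| by rewrite ltr_pwDl.
rewrite /unsqueeze /squeeze.
rewrite (_ : 2 * (_ / 2) - 1 = x / (1 + `|x|)); last first.
  by rewrite powR_inv1 ?ltW//; field.
rewrite normrM normfV (gtr0_norm h).
have e : 1 - `|x| / (1 + `|x|) = (1 + `|x|)^-1 by field; rewrite gt_eqF.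
rewrite e powR_inv1 ?invr_ge0 ?ltW// invrK mulfVK// gt_eqF.
Qed.

Lemma measurable_squeeze : measurable_fun setT (squeeze : mR -> R).
Proof.
apply: measurable_funM => //; apply: measurable_funD => //; apply: measurable_funM => //.
apply: (measurableT_comp (measurable_powR (-1))).
by apply: measurable_funD => //; exact: measurableT_comp.
Qed.

Lemma measurable_unsqueeze : measurable_fun setT (unsqueeze : mR -> R).
Proof.
have m1 : measurable_fun setT (fun z : mR => 2 * z - 1).
  by apply: measurable_funB => //; exact: measurable_funM.
apply: measurable_funM => //.
apply: (measurableT_comp (measurable_powR (-1))).
by apply: measurable_funB => //; exact: measurableT_comp.
Qed.

Definition rfloor z : R := (Num.floor z)%:~R.

Lemma measurable_rfloor : measurable_fun setT (rfloor : mR -> R).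
Proof.
apply: nondecreasing_measurable => // x y xy.
by rewrite /rfloor ler_int; exact: le_floor.
Qed.

Lemma rfloor_squeeze x z : rfloor (rfloor z + squeeze x) = rfloor z.
Proof.
congr (_%:~R); apply: floor_def; have := squeeze_itv x; rewrite /rfloor intrD => h.
by apply/andP; split; lra.
Qed.

Lemma rfloor_itv z : 0 <= z - rfloor z <= 1.
Proof.
have := floor_itv z; rewrite /rfloor intrD; lra.
Qed.

End decode.

Section measure_derivative.
Context d (Om : measurableType d) (R : realType) (P : probability Om R).
Local Notation mR := (measurableTypeR R).

(* A pair with an integer-valued second component is coded by one real number,
   whose quantile function transports the pair to [Phat]. *)
Lemma common_copy (X Y : Om -> R) (n : nat) : measurable_fun setT X -> measurable_fun setT Y ->
  exists (Z : Om -> R) (z q dX dY : R -> R),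
  [/\ measurable_fun setT Z /\ measurable_fun setT q,
      measurable_fun setT dX /\ measurable_fun setT dY,
      (forall C : set R, measurable C -> (@Phat R) (q @^-1` C) = P (Z @^-1` C)),
      (forall w, dX (Z w) = X w) &
      (forall w, `|Y w - dY (Z w)| <= n.+1%:R^-1)].
Proof.
move=> mX mY.
pose N w := rfloor (n.+1%:R * Y w).
pose Z w := N w + squeeze (X w).
have mZ : measurable_fun setT Z.
  apply: measurable_funD; last exact: (measurableT_comp (@measurable_squeeze R)).
  by apply: (measurableT_comp (@measurable_rfloor R)); exact: measurable_funM.
pose Zm := isMeasurableFun.Build _ _ Om mR Z mZ.
pose Zf : {mfun Om >-> mR} := HB.pack Z Zm.
pose nu : probability mR R := distribution P Zf.
have mr := @measurable_rfloor R.
exists Z, id, (quantile nu), (fun z => unsqueeze (z - rfloor z)), (fun z => n.+1%:R^-1 * rfloor z).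
split.
- by split => //; exact: measurable_quantile.
- split; last exact: measurable_funM.
  apply: (measurableT_comp (@measurable_unsqueeze R)); exact: measurable_funB.
- by move=> C mC; rewrite -quantile_law.
- by move=> w; rewrite /Z /N rfloor_squeeze addrAC subrr add0r squeezeK.
- move=> w; rewrite /Z /N rfloor_squeeze.
  have n0 : 0 < n.+1%:R :> R by [].
  rewrite (_ : _ - _ = n.+1%:R^-1 * (n.+1%:R * Y w - rfloor (n.+1%:R * Y w))); last first.
    by rewrite mulrBr mulrA mulVf ?mul1r// gt_eqF.
  have /andP[h0 h1] := rfloor_itv (n.+1%:R * Y w).
  by rewrite ger0_norm ?mulr_ge0// ler_piMr.
Qed.

Lemma abs_Rint_le (f g : Om -> R) (a b : R) : sqint P f -> sqint P g ->
  0 <= a -> 0 <= b -> \int[P]_w (f w ^+ 2) <= a ^+ 2 -> \int[P]_w (g w ^+ 2) <= b ^+ 2 ->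
  `|\int[P]_w (f w * g w)| <= a * b.
Proof.
move=> sf sg a0 b0 ha hb; rewrite -(@ler_pXn2r _ 2)// ?nnegrE ?mulr_ge0//.
rewrite real_normK ?num_real// exprMn.
apply: le_trans (Rint_CS sf sg) _; apply: ler_pM => //; apply: Rint_ge0 => w; exact: sqr_ge0.
Qed.

Variables (K : R) (F : P2 R -> R) (m0 : P2 R) (D : R -> R) (X Y : Om -> R).
Hypotheses (K0 : 0 <= K) (lipF : forall m m', `|F m - F m'| <= K * W2 m m').
Hypothesis dF : is_measure_derivative F m0 D.
Hypotheses (sX : sqint P X) (sY : sqint P Y) (lX : has_law P X m0).

Lemma sqint_derivative : sqint P (fun w => D (X w)).
Proof.
have [mD D2 _] := dF; split.
  by apply: (measurableT_comp mD); exact: sqint_meas sX.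
move: D2; rewrite (@ge0_integral_law _ _ _ P X m0 (sqint_meas sX))//.
  by apply/measurable_EFinP; exact: measurable_funX.
by move=> x; rewrite lee_fin sqr_ge0.
Qed.

(** The definition expands only along directions on [Phat]. The direction is rounded so that the
    pair can be transported there; the Lipschitz bound on [F] and Cauchy-Schwarz bound the effect of
    the rounding by [(K + c) * r] times [s]. *)
Lemma measure_derivative_along e : 0 < e -> exists2 del : R, 0 < del &
  forall s m1, 0 < s <= del -> has_law P (fun w => X w + s * Y w) m1 ->
  `|F m1 - F m0 - s * \int[P]_w (D (X w) * Y w)| <= e * s.
Proof.
move=> e0; have [mD D2 hD] := dF; have sD := sqint_derivative.
set c := Num.sqrt (\int[P]_w (D (X w) ^+ 2)).
have c0 : 0 <= c by exact: sqrtr_ge0.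
have cE : \int[P]_w (D (X w) ^+ 2) <= c ^+ 2.
  by rewrite sqr_sqrtr// Rint_ge0// => w; exact: sqr_ge0.
(* Fine enough for the rounding to cost at most half of [e]. *)
pose n := Num.truncn (2 * (K + c) / e); pose r : R := n.+1%:R^-1.
have r0 : 0 < r by rewrite invr_gt0.
have rE : (K + c) * r <= e / 2.
  have := truncnS_gt (2 * (K + c) / e); rewrite -/n ltr_pdivrMr// => h.
  rewrite /r ler_pdivrMr//; lra.
have [Z [_ [q [dX [dY [[mZ mq] [mdX mdY] law dXZ dYZ]]]]]] :=
  common_copy n (sqint_meas sX) (sqint_meas sY).
have int (h : R -> R) : measurable_fun setT h ->
    (\int[@Phat R]_u (h (q u))%:E = \int[P]_w (h (Z w))%:E)%E.
  by move=> mh; exact: same_law_integral.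
pose Yn w := dY (Z w).
have sYn : sqint P Yn.
  have sE : sqint P (fun w => Yn w - Y w).
    apply: (@sqint_bounded _ _ _ _ _ r) => [|w]; last by rewrite distrC.
    apply: measurable_funB; last exact: sqint_meas sY.
    exact: (measurableT_comp mdY).
  rewrite (_ : Yn = fun w => (Yn w - Y w) + Y w); first exact: sqintD.
  by apply/funext => w; rewrite subrK.
have mY' : measurable_fun setT (fun u => dY (q u)) by exact: (measurableT_comp mdY).
have mX' : measurable_fun setT (fun u => dX (q u)) by exact: (measurableT_comp mdX).
have int2 : (\int[@Phat R]_u (dY (q u) ^+ 2)%:E = \int[P]_w (Yn w ^+ 2)%:E)%E.
  by apply: (int (fun z => dY z ^+ 2)); exact: measurable_funX.
have sY' : sqint (@Phat R) (fun u => dY (q u)).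
  by split => //; rewrite int2; case: sYn.
pose v := Num.sqrt (\int[P]_w (Yn w ^+ 2)).
have v0 : 0 <= v by exact: sqrtr_ge0.
have nE s : 0 < s -> norm2 (@Phat R) (fun u => s * dY (q u)) = (s * v)%:E.
  move=> s0; rewrite norm2E; last exact: sqintZ.
  congr (_%:E); under eq_Rintegral do rewrite exprMn.
  rewrite RintZ; last exact: sqint_intg2.
  by rewrite sqrtrM ?sqr_ge0// sqrtr_sqr gtr0_norm// /Rintegral int2.
have lX' : has_law (@Phat R) (fun u => dX (q u)) m0.
  move=> C mC; rewrite lX//.
  have mdC : measurable (dX @^-1` C) by rewrite -[X in measurable X]setTI; exact: mdX.
  rewrite -[RHS]/((@Phat R) (q @^-1` (dX @^-1` C))) law//; congr (P _).
  by apply/seteqP; split => w /=; rewrite dXZ.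
(* The direction has norm [s * v], so this tolerance leaves at most [e / 2 * s]; adding 1 covers
   [v = 0]. *)
have [del del0 hdel] := hD _ mX' lX' (e / 2 / (v + 1)) ltac:(by rewrite !divr_gt0// ltr_wpDl).
exists (del / (v + 1)); first by rewrite divr_gt0// ltr_wpDl.
move=> s m1 /andP[s0 sdel] l1.
have sv : s * v <= del.
  move: sdel; rewrite ler_pdivlMr ?ltr_wpDl//; apply: le_trans.
  by rewrite ler_pM2l// lerDl.
have sXYn : sqint P (fun w => X w + s * Yn w) by apply: sqintD => //; exact: sqintZ.
have lm := law_ofP sXYn; set m2 := law_of _ _ in lm.
have lm' : has_law (@Phat R) (fun u => dX (q u) + s * dY (q u)) m2.
  move=> C mC; rewrite lm//.
  have mds : measurable_fun setT (fun z => dX z + s * dY z).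
    by apply: measurable_funD => //; exact: measurable_funM.
  have mdC : measurable ((fun z => dX z + s * dY z) @^-1` C).
    by rewrite -[X in measurable X]setTI; exact: mds.
  rewrite -[RHS]/((@Phat R) (q @^-1` ((fun z => dX z + s * dY z) @^-1` C))) law//; congr (P _).
  by apply/seteqP; split => w /=; rewrite /Yn dXZ.
have msY : measurable_fun setT (fun u => s * dY (q u)) by exact: measurable_funM.
have := hdel _ m2 msY; rewrite nE// lee_fin => /(_ sv lm').
rewrite (_ : \int[@Phat R]_u (D (dX (q u)) * (s * dY (q u))) = s * \int[P]_w (D (X w) * Yn w)); last first.
  rewrite -RintZ; last exact: sqintM.
  rewrite /Rintegral; congr fine.
  transitivity (\int[@Phat R]_u (s * (D (dX (q u)) * dY (q u)))%:E)%E.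
    by apply: eq_integral => u _; rewrite mulrCA.
  rewrite (int (fun z => s * (D (dX z) * dY z))).
    by apply: eq_integral => w _; rewrite dXZ.
  apply: measurable_funM => //; apply: measurable_funM => //.
  exact: (measurableT_comp mD).
move=> h2; have h1 : `|F m1 - F m2| <= K * (s * r).
  apply: le_trans (lipF _ _) _; apply: ler_wpM2l => //.
  have sXY : sqint P (fun w => X w + s * Y w) by apply: sqintD => //; exact: sqintZ.
  apply: le_trans (W2_le sXY sXYn l1 lm) _.
  have sr0 : 0 <= s * r by rewrite mulr_ge0 ?ltW.
  rewrite -[leRHS](ger0_norm sr0) -sqrtr_sqr; apply: ler_wsqrtr.
  rewrite -[leRHS](Rint_cst P); apply: Rint_le => [||w].
  - by apply: sqint_intg2; exact: sqintB.
  - exact: intg_cst.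
  - rewrite opprD addrACA subrr add0r -mulrBr !exprMn ler_wpM2l ?sqr_ge0//.
    by rewrite -real_normK ?num_real// ler_pXn2r// ?nnegrE// ltW.
have h3 : `|\int[P]_w (D (X w) * Yn w) - \int[P]_w (D (X w) * Y w)| <= c * r.
  rewrite -RintB; [|exact: sqintM..].
  under eq_Rintegral do rewrite -mulrBr.
  apply: abs_Rint_le => //; first exact: sqintB; first exact: ltW.
  rewrite -[leRHS](Rint_cst P); apply: Rint_le => [||w].
  - by apply: sqint_intg2; exact: sqintB.
  - exact: intg_cst.
  - by rewrite -real_normK ?num_real// distrC ler_pXn2r ?nnegrE ?(ltW r0)//; exact: dYZ.
have h4 : e / 2 / (v + 1) * (s * v) <= e / 2 * s.
  by rewrite mulrAC ler_pdivrMr ?ltr_wpDl// -[leRHS]mulrA ler_pM2l ?divr_gt0// ler_pM2l// lerDl.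
set I := \int[P]_w (D (X w) * Y w) in h3 *; set I' := \int[P]_w _ in h2 h3.
have -> : F m1 - F m0 - s * I = (F m1 - F m2) + (F m2 - F m0 - s * I') + s * (I' - I) by ring.
apply: le_trans (ler_normD _ _) _.
apply: le_trans (lerD (ler_normD _ _) (lexx _)) _.
have h5 : `|s * (I' - I)| <= s * (c * r) by rewrite normrM gtr0_norm// ler_pM2l.
have h6 := ler_wpM2r (ltW s0) rE.
have h7 := le_trans h2 h4.
move: h1 h7 h5 h6; clear; lra.
Qed.

End measure_derivative.

(** * Coupling two copies inside the blocks of a countable partition *)


Lemma intg_EFin d (Om : measurableType d) (R : realType) (P : probability Om R)
    (f : Om -> R) : intg P f -> (\int[P]_w (f w)%:E)%E = (\int[P]_w f w)%:E.
Proof.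
move=> fi; rewrite /Rintegral fineK//.
exact: (@integrable_fin_num _ _ _ P setT).
Qed.

Section countable_partition.
Context d (T : measurableType d) (R : realType) (h : T -> nat).

Lemma measurable_wrt_label (F : set (set T)) (phi : nat -> R) :
  sigma_algebra setT F -> (forall k, F [set x | h x = k]) ->
  measurable_wrt F (phi \o h).
Proof.
move=> sF Fh C mC.
rewrite (_ : _ @^-1` _ = \bigcup_k (if phi k \in C then [set x | h x = k] else set0)).
  case: sF => F0 _ FU; apply: FU => k; case: ifP => _ //.
apply/seteqP; split => [x Cx|x [k _]] /=.
  by exists (h x) => //; rewrite mem_set.
by case: ifPn => // /set_mem Ck /= ->.
Qed.

Hypothesis mh : forall k, measurable [set x | h x = k].

Lemma measurable_label (phi : nat -> R) : measurable_fun setT (phi \o h).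
Proof.
apply: (measurable_wrt_meas (F := measurable)) => //.
by apply: measurable_wrt_label => //; exact: sigma_algebra_measurable.
Qed.

Variable P : probability T R.

Definition ind k x : R := (h x == k)%:R.

Definition mass k : R := \int[P]_x ind k x.

Lemma measurable_ind k : measurable_fun setT (ind k).
Proof. exact: (measurable_label (fun j => (j == k)%:R)). Qed.

Lemma ind_bound k x : `|ind k x| <= 1.
Proof. by rewrite /ind; case: eqP => _; rewrite ?normr1 ?normr0. Qed.

Lemma sqint_ind k : sqint P (ind k).
Proof. exact: (sqint_bounded _ (measurable_ind k) (ind_bound k)). Qed.

Lemma mass_ge0 k : 0 <= mass k.
Proof. by apply: Rint_ge0 => x; rewrite /ind ler0n. Qed.

Lemma massE k : (mass k)%:E = P [set x | h x = k].
Proof.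
rewrite /mass -intg_EFin; last exact/sqint_intg/sqint_ind.
transitivity (P ([set x | h x = k] `&` setT)); last by rewrite setIT.
rewrite -integral_indic//; apply: eq_integral => x _.
rewrite indicE /ind; case: eqP => hx; first by rewrite mem_set.
by rewrite memNset.
Qed.

Lemma ae_mass_gt0 : {ae P, forall x, 0 < mass (h x)}.
Proof.
have nB k : P.-negligible (if 0 < mass k then set0 else [set x | h x = k]).
  case: ltP => [_|m0]; first exact: negligible_set0.
  exists [set x | h x = k]; split => //; rewrite -massE; congr (_%:E).
  by apply/le_anti; rewrite m0 mass_ge0.
apply: negligibleS (negligible_bigcup nB) => x /= nx.
by exists (h x) => //; case: ifP => // /nx.
Qed.

(* Density, with respect to [pprod P P], of the coupling of two copies of [P]
   that are independent given that they lie in the same block. *)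
Definition kern x y : R := ind (h x) y / mass (h x).

(** Conditional mean on the block [k]; on blocks of mass zero the division gives 0. *)
Definition block_mean (f : T -> R) k : R := (\int[P]_x (f x * ind k x)) / mass k.

Lemma kern_ge0 x y : 0 <= kern x y.
Proof. by rewrite divr_ge0 ?mass_ge0// ler0n. Qed.

Lemma kern_sym x y : kern x y = kern y x.
Proof. by rewrite /kern /ind eq_sym; case: eqP => [->//|_]; rewrite !mul0r. Qed.

Lemma measurable_kern : measurable_fun setT (fun z : T * T => kern z.1 z.2).
Proof.
apply: measurable_funM; last first.
  by apply: (measurableT_comp (measurable_label (fun k => (mass k)^-1))); exact: measurable_fst.
pose E := \bigcup_k ([set x | h x = k] `*` [set x | h x = k]).
have mE : measurable E by apply: bigcupT_measurable => k; exact: measurableX.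
rewrite (_ : (fun z => _) = \1_E); first exact: measurable_indic.
apply/funext => z; rewrite indicE /ind; case: eqP => e.
  by rewrite mem_set//; exists (h z.1).
by rewrite memNset// => -[k _ [/= e1 e2]]; apply: e; rewrite e1 e2.
Qed.

Lemma intg_kern (f : T -> R) x : sqint P f -> intg P (fun y => f y * kern x y) /\
  \int[P]_y (f y * kern x y) = block_mean f (h x).
Proof.
move=> sf; have i1 := sqintM sf (sqint_ind (h x)).
rewrite /kern /block_mean.
have -> : (fun y => f y * (ind (h x) y / mass (h x))) =
    fun y => (mass (h x))^-1 * (f y * ind (h x) y).
  by apply/funext => y; rewrite mulrA mulrC.
split; first exact: intgZ.
by rewrite RintZ// mulrC.
Qed.

Lemma kern_total x : 0 < mass (h x) -> \int[P]_y kern x y = 1.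
Proof.
move=> m0; have [_] := intg_kern x (sqint_cst P 1).
under eq_Rintegral do rewrite mul1r; move=> ->.
rewrite /block_mean; under eq_Rintegral do rewrite mul1r.
by rewrite -/(mass _) mulfV// gt_eqF.
Qed.

(** For [x] in a block of positive mass the kernel is a probability density in [y], and almost every
    [x] is in such a block. *)
Lemma kern_fst (f : T -> \bar R) : measurable_fun setT f -> (forall x, 0 <= f x)%E ->
  (\int[pprod P P]_z (f z.1 * (kern z.1 z.2)%:E) = \int[P]_x f x)%E.
Proof.
move=> mf f0.
have mk : measurable_fun setT (fun z : T * T => (kern z.1 z.2)%:E).
  by apply/measurable_EFinP; exact: measurable_kern.
have mF : measurable_fun setT (fun z : T * T => (f z.1 * (kern z.1 z.2)%:E)%E).
  by apply: emeasurable_funM => //; apply: (measurableT_comp mf); exact: measurable_fst.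
have F0 z : (0 <= f z.1 * (kern z.1 z.2)%:E)%E.
  by rewrite mule_ge0// lee_fin kern_ge0.
apply: etrans (fubini_tonelli1 (m1 := P) (m2 := P) _ mF F0) _.
apply: ae_eq_integral => //; first exact: measurable_fun_fubini_tonelli_F.
apply: filterS ae_mass_gt0 => x m0 _; rewrite /fubini_F/=.
rewrite ge0_integralZl//=.
- have [i1 _] := intg_kern x (sqint_cst P 1).
  have {}i1 : intg P (kern x) by move: i1; under eq_fun do rewrite mul1r.
  by rewrite intg_EFin// kern_total// mule1.
- by apply/measurable_EFinP; exact: (meas_pair1 x measurable_kern).
- by move=> y _; rewrite lee_fin kern_ge0.
Qed.

Lemma kern_snd (f : T -> \bar R) : measurable_fun setT f -> (forall x, 0 <= f x)%E ->
  (\int[pprod P P]_z (f z.2 * (kern z.1 z.2)%:E) = \int[P]_x f x)%E.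
Proof.
move=> mf f0; rewrite -(kern_fst mf f0).
have mk : measurable_fun setT (fun z : T * T => (kern z.1 z.2)%:E).
  by apply/measurable_EFinP; exact: measurable_kern.
have mF : measurable_fun setT (fun z : T * T => (f z.1 * (kern z.1 z.2)%:E)%E).
  by apply: emeasurable_funM => //; apply: (measurableT_comp mf); exact: measurable_fst.
have mG : measurable_fun setT (fun z : T * T => (f z.2 * (kern z.1 z.2)%:E)%E).
  by apply: emeasurable_funM => //; apply: (measurableT_comp mf); exact: measurable_snd.
have F0 z : (0 <= f z.1 * (kern z.1 z.2)%:E)%E.
  by rewrite mule_ge0// lee_fin kern_ge0.
have G0 z : (0 <= f z.2 * (kern z.1 z.2)%:E)%E.
  by rewrite mule_ge0// lee_fin kern_ge0.
apply: etrans (fubini_tonelli2 (m1 := P) (m2 := P) _ mG G0) _.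
apply: etrans _ (esym (fubini_tonelli1 (m1 := P) (m2 := P) _ mF F0)).
apply: eq_integral => x _; apply: eq_integral => y _ /=.
by rewrite kern_sym.
Qed.

(** Only the integral formula is exported; the properties of the coupling below are deduced from
    it. *)
Lemma exists_glue : exists Q : probability (T * T)%type R,
  forall f : T * T -> \bar R, measurable_fun setT f -> (forall z, 0 <= f z)%E ->
  (\int[Q]_z f z = \int[pprod P P]_z (f z * (kern z.1 z.2)%:E))%E.
Proof.
have k0 z : 0 <= kern z.1 z.2 := kern_ge0 z.1 z.2.
pose mu : {measure set (T * T) -> \bar R} := dens (pprod P P) measurable_kern k0.
have mu1 : mu setT = 1%E.
  have := kern_fst (measurable_cst (1 : \bar R)%E) (fun=> lee01).
  rewrite integral_cst// mul1e [RHS](@probability_setT _ _ _ P) => <-.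
  by apply: eq_integral => z _; rewrite mul1e.
pose Qm := @Measure_isProbability.Build _ _ R mu mu1.
pose Q : probability (T * T)%type R := HB.pack (dens (pprod P P) measurable_kern k0) Qm.
exists Q => f mf f0; exact: (integral_dens (pprod P P) measurable_kern k0).
Qed.

Section glued.
Variable Q : probability (T * T)%type R.
Hypothesis QE : forall f : T * T -> \bar R, measurable_fun setT f -> (forall z, 0 <= f z)%E ->
  (\int[Q]_z f z = \int[pprod P P]_z (f z * (kern z.1 z.2)%:E))%E.

Lemma glue_fst (f : T -> \bar R) : measurable_fun setT f -> (forall x, 0 <= f x)%E ->
  (\int[Q]_z f z.1 = \int[P]_x f x)%E.
Proof.
move=> mf f0; rewrite -(kern_fst mf f0) QE//.
by apply: (measurableT_comp mf); exact: measurable_fst.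
Qed.

Lemma glue_snd (f : T -> \bar R) : measurable_fun setT f -> (forall x, 0 <= f x)%E ->
  (\int[Q]_z f z.2 = \int[P]_x f x)%E.
Proof.
move=> mf f0; rewrite -(kern_snd mf f0) QE//.
by apply: (measurableT_comp mf); exact: measurable_snd.
Qed.

Lemma glue_label : {ae Q, forall z, h z.1 = h z.2}.
Proof.
pose E := \bigcup_k ([set x | h x = k] `*` [set x | h x = k]).
have mE : measurable E by apply: bigcupT_measurable => k; exact: measurableX.
exists (~` E); split; first exact: measurableC.
  have mI : measurable_fun setT (fun z => (\1_(~` E) z)%:E : \bar R).
    by apply/measurable_EFinP; apply: measurable_indic; exact: measurableC.
  transitivity (Q (~` E `&` setT)); first by rewrite setIT.
  rewrite -integral_indic//; last exact: measurableC.
  rewrite QE//.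
  apply: integral0_eq => z _; rewrite indicE /kern /ind.
  case: eqP => [e|_]; last by rewrite mul0r mule0.
  by rewrite memNset ?mul0e//; apply; exists (h z.1).
by move=> z /= nz [k _ [/= e1 e2]]; apply: nz; rewrite e1 e2.
Qed.

Lemma glue_real (f : T * T -> R) : measurable_fun setT f ->
  (\int[Q]_z (f z)%:E = \int[pprod P P]_z (f z * kern z.1 z.2)%:E)%E.
Proof.
move=> mf; have mEf : measurable_fun setT (EFin \o f) by exact/measurable_EFinP.
rewrite [LHS]integralE [RHS]integralE; congr (_ - _)%E.
  rewrite QE//; last exact: measurable_funepos.
  apply: eq_integral => z _; rewrite !funeposE (EFinM (f z) (kern z.1 z.2)) -[in RHS](mul0e (kern z.1 z.2)%:E).
  by rewrite -maxe_pMl// lee_fin kern_ge0.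
rewrite QE//; last exact: measurable_funeneg.
apply: eq_integral => z _; rewrite !funenegE (EFinM (f z) (kern z.1 z.2)) -[in RHS](mul0e (kern z.1 z.2)%:E).
by rewrite -mulNe -maxe_pMl// lee_fin kern_ge0.
Qed.

Lemma glue_sqint1 (f : T -> R) : sqint P f -> sqint Q (fun z => f z.1).
Proof.
move=> [mf f2]; split; first by apply: (measurableT_comp mf); exact: measurable_fst.
rewrite (glue_fst (f := fun x => (f x ^+ 2)%:E))//.
  by apply/measurable_EFinP; exact: measurable_funX.
by move=> x; rewrite lee_fin sqr_ge0.
Qed.

Lemma glue_sqint2 (f : T -> R) : sqint P f -> sqint Q (fun z => f z.2).
Proof.
move=> [mf f2]; split; first by apply: (measurableT_comp mf); exact: measurable_snd.
rewrite (glue_snd (f := fun x => (f x ^+ 2)%:E))//.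
  by apply/measurable_EFinP; exact: measurable_funX.
by move=> x; rewrite lee_fin sqr_ge0.
Qed.

(** Given the block the two copies are independent, so the second factor may be averaged over the
    block. *)
Lemma glue_cond (f g : T -> R) : sqint P f -> sqint P g ->
  \int[Q]_z (f z.1 * g z.2) = \int[P]_x (f x * block_mean g (h x)).
Proof.
move=> sf sg; have i1 := sqintM (glue_sqint1 sf) (glue_sqint2 sg).
have mfg := intg_meas i1.
have i2 : intg (pprod P P) (fun z => f z.1 * g z.2 * kern z.1 z.2).
  have mF : measurable_fun setT (fun z => f z.1 * g z.2 * kern z.1 z.2).
    by apply: measurable_funM => //; exact: measurable_kern.
  apply/integrableP; split; first exact/measurable_EFinP.
  have mn : measurable_fun setT (fun z => `|f z.1 * g z.2|) by exact: measurableT_comp.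
  rewrite (eq_integral (fun z => (`|f z.1 * g z.2| * kern z.1 z.2)%:E)); last first.
    by move=> z _; rewrite /= normrM (ger0_norm (kern_ge0 _ _)).
  by rewrite -(glue_real mn); case/integrableP : i1.
have [_ _ e3] := intg_fubini1 i2.
have e x : \int[P]_y (f (x, y).1 * g (x, y).2 * kern (x, y).1 (x, y).2) = f x * block_mean g (h x).
  have [i4 <-] := intg_kern x sg; rewrite -RintZ//=.
  by apply: eq_Rintegral => y _; rewrite mulrA.
under [RHS]eq_Rintegral do rewrite -e.
by rewrite e3 /Rintegral glue_real//; exact: intg_meas i1.
Qed.

(** Conditional Jensen inequality; on a block of mass zero both sides are 0. *)
Lemma sqint_block_mean (f : T -> R) : sqint P f -> sqint P (fun x => block_mean f (h x)).
Proof.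
move=> sf; split; first exact: (measurable_label (block_mean f)).
have if2 x : intg P (fun y => f y ^+ 2 * ind (h x) y).
  apply: (intg_le _ (sqint_intg2 sf)) => [|y].
    by apply: measurable_funM; [exact/measurable_funX/sqint_meas/sf|exact: measurable_ind].
  by rewrite normrM ler_piMr// ind_bound.
have ifk x : intg P (fun y => f y ^+ 2 * kern x y).
  rewrite (_ : (fun y => _) = fun y => (mass (h x))^-1 * (f y ^+ 2 * ind (h x) y)).
    exact: intgZ.
  by apply/funext => y; rewrite /kern mulrA mulrC.
have le1 x : block_mean f (h x) ^+ 2 <= \int[P]_y (f y ^+ 2 * kern x y).
  have sfi : sqint P (fun y => f y * ind (h x) y).
    rewrite (_ : (fun y => _) = fun y => ind (h x) y * f y).
      exact: (sqintMb (measurable_ind _) (ind_bound _)).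
    by apply/funext => y; rewrite mulrC.
  have h1 : (\int[P]_y (f y * ind (h x) y)) ^+ 2 <=
      \int[P]_y (f y ^+ 2 * ind (h x) y) * mass (h x).
    have e y : ind (h x) y * ind (h x) y = ind (h x) y.
      by rewrite /ind; case: eqP; rewrite ?mulr1 ?mulr0.
    have := Rint_CS sfi (sqint_ind (h x)).
    under eq_Rintegral do rewrite -mulrA e.
    under [X in _ <= X * _]eq_Rintegral do rewrite exprMn [ind _ _ ^+ 2]expr2 e.
    by under [X in _ <= _ * X]eq_Rintegral do rewrite expr2 e.
  have -> : \int[P]_y (f y ^+ 2 * kern x y) = (\int[P]_y (f y ^+ 2 * ind (h x) y)) / mass (h x).
    rewrite mulrC -RintZ//; apply: eq_Rintegral => y _.
    by rewrite /kern mulrA mulrC.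
  rewrite /block_mean; have := mass_ge0 (h x); rewrite le_eqVlt => /predU1P[<-|m0].
    by rewrite invr0 !mulr0 expr0n.
  rewrite exprMn exprVn ler_pdivrMr ?exprn_gt0//.
  by rewrite mulrAC ler_pdivlMr// expr2 mulrA ler_pM2r.
have mk : measurable_fun setT (fun z : T * T => (f z.2 ^+ 2 * kern z.1 z.2)%:E).
  apply/measurable_EFinP; apply: measurable_funM; last exact: measurable_kern.
  by apply: measurable_funX; apply: (measurableT_comp (sqint_meas sf)); exact: measurable_snd.
have k0 z : (0 <= (f z.2 ^+ 2 * kern z.1 z.2)%:E)%E.
  by rewrite lee_fin mulr_ge0 ?sqr_ge0 ?kern_ge0.
apply: (@le_lt_trans _ _ (\int[P]_x \int[P]_y (f y ^+ 2 * kern x y)%:E)%E).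
  apply: ge0_le_integral => //.
  - by move=> x _; rewrite lee_fin sqr_ge0.
  - by apply/measurable_EFinP; apply: measurable_funX; exact: (measurable_label (block_mean f)).
  - exact: (@measurable_fun_fubini_tonelli_F _ _ _ _ _ P _ mk k0).
  - by move=> x _; rewrite intg_EFin// lee_fin.
apply: (@le_lt_trans _ _ (\int[pprod P P]_z (f z.2 ^+ 2 * kern z.1 z.2)%:E)%E).
  by rewrite (fubini_tonelli1 (m1 := P) (m2 := P) _ mk k0).
have mf2 : measurable_fun setT (fun x => (f x ^+ 2)%:E).
  by apply/measurable_EFinP; exact/measurable_funX/sqint_meas/sf.
have f20 x : (0 <= (f x ^+ 2)%:E)%E by rewrite lee_fin sqr_ge0.
have := kern_snd mf2 f20; rewrite (eq_integral (fun z => (f z.2 ^+ 2 * kern z.1 z.2)%:E)).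
  by move=> ->; case: sf.
by [].
Qed.

End glued.

End countable_partition.

(** * Energy estimates from the first order condition *)


Section first_order_energy.
Context d (Om : measurableType d) (R : realType) (P : probability Om R).
Variables (T : R) (F : R -> set (set Om)).
Hypotheses (T0 : 0 < T) (cF : complete_filtration P T F).
Variables (a : R -> Om -> R) (D : Om -> R).
Hypotheses (Ha : H2 P T F a) (sD : sqint P D).

(** Cauchy-Schwarz between the restricted control and its own integral spread over the window. Where
    [tint_sqr_le] gives the horizon, this gives the length of the window, as the summation over
    small steps requires. *)
Lemma tint_restr_sqr_le l r : 0 <= l -> l <= r -> r <= T ->
  \int[P]_w (tint T (restr l r a) w ^+ 2) <=
  (r - l) * inner P T0 (restr l r a) (restr l r a).
Proof.
move=> l0 lr rT; have Hr := H2_restr T0 cF l r Ha.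
have [_ sv] := (H2P T0 cF _).1 Hr.
set B := tint T (restr l r a); set v := tcut T (restr l r a) in sv.
have sB : sqint P B by exact: (sqint_tint T0 cF Hr).
pose win (s : measurableTypeR R) : R := (l < s <= r)%R%:R.
have win2 s : win s * win s = win s by rewrite /win; case: (_ < _ <= _); rewrite ?mulr1 ?mulr0.
pose u (x : measurableTypeR R * Om) := win x.1 * B x.2.
have su : sqint (pprod (unifT T0) P) u.
  apply: (@sqintMb _ _ _ _ _ _ 1); last exact: sqint_snd.
    exact: measurable_window.
  by move=> x; rewrite /win; case: (_ < _ <= _); rewrite ?normr1 ?normr0.
have iwin : intg (unifT T0) win.
  have mwin : measurable_fun setT win.
    exact: (meas_pair2 (0 : measurableTypeR R) (@measurable_window R _ (measurableTypeR R) l r)).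
  apply: sqint_intg; apply: (sqint_bounded _ mwin (M := 1)).
  by move=> x; rewrite /win; case: (_ < _ <= _); rewrite ?normr1 ?normr0.
have winE : T * \int[unifT T0]_s win s = r - l.
  rewrite -Rintegral_unifT//.
  have := tint_step (fun=> 1 : R) (0 : measurableTypeR R) l0 lr rT; rewrite mulr1 => <-.
  by apply: eq_Rintegral => s _; rewrite /step /restr mulr1.
have e1 : \int[P]_w (B w ^+ 2) = T * \int[pprod (unifT T0) P]_x (u x * v x).
  under eq_Rintegral do rewrite expr2; rewrite (tint_inner T0 cF Hr sB); congr (_ * _).
  apply: eq_Rintegral => x _; rewrite /u /v cut_restr -/(win x.1).
  by rewrite -[in LHS]win2; ring.
have e2 : T * \int[pprod (unifT T0) P]_x (u x ^+ 2) = (r - l) * \int[P]_w (B w ^+ 2).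
  have [_ i <-] := intg_fubini2 (sqint_intg2 su).
  have e w : \int[unifT T0]_s (u (s, w) ^+ 2) = (\int[unifT T0]_s win s) * B w ^+ 2.
    rewrite mulrC -RintZ//; apply: eq_Rintegral => s _.
    by rewrite /u/= exprMn [win s ^+ 2]expr2 win2 mulrC.
  under eq_Rintegral do rewrite e.
  rewrite RintZ; last exact: sqint_intg2.
  by rewrite mulrA winE.
have e3 : T * \int[pprod (unifT T0) P]_x (v x ^+ 2) = inner P T0 (restr l r a) (restr l r a).
  by rewrite /inner; under [in RHS]eq_Rintegral do rewrite -expr2.
have CS := Rint_CS su sv.
have := Rint_ge0 P (fun w => sqr_ge0 (B w)); rewrite le_eqVlt => /predU1P[<-|E0].
  by rewrite mulr_ge0 ?subr_ge0// inner_ge0.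
rewrite -(ler_pM2l E0) [leRHS]mulrA [_ * (r - l)]mulrC -e2 -e3 -expr2 {1}e1.
rewrite mulrACA exprMn expr2 ler_pM2l ?mulr_gt0//.
Qed.

Hypothesis foc : forall c, H2 P T F c -> inner P T0 a c = - \int[P]_w (D w * tint T c w).
Variable n : nat.

Definition grid (k : nat) : R := T * k%:R / n.+1%:R.

Definition gap : R := T / n.+1%:R.

Lemma grid0 : grid 0 = 0. Proof. by rewrite /grid mulr0 mul0r. Qed.

Lemma gridn : grid n.+1 = T.
Proof. by rewrite /grid mulfK// pnatr_eq0. Qed.

Lemma gap_gt0 : 0 < gap. Proof. by rewrite divr_gt0. Qed.

Lemma gridS k : grid k.+1 = grid k + gap.
Proof. by rewrite /grid /gap -addn1 natrD; ring. Qed.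

Lemma grid_ge0 k : 0 <= grid k.
Proof. by rewrite /grid !mulr_ge0// ?ltW// invr_gt0. Qed.

Lemma grid_lt k : grid k < grid k.+1.
Proof. by rewrite gridS ltrDl gap_gt0. Qed.

Lemma grid_leT k : (k <= n.+1)%N -> grid k <= T.
Proof.
move=> kn; rewrite /grid ler_pdivrMr// ler_pM2l//; by rewrite ler_nat.
Qed.

Lemma grid_mono i k : (i <= k)%N -> grid i <= grid k.
Proof. by move=> ik; rewrite /grid ler_pM2r ?invr_gt0// ler_pM2l// ler_nat. Qed.

Definition block k : Om -> R := tint T (restr (grid k) (grid k.+1) a).

Lemma sqint_block k : sqint P (block k).
Proof. by apply: (sqint_tint T0 cF); exact: (H2_restr T0 cF). Qed.

Lemma block_adapted k : (k <= n)%N -> measurable_wrt (F (grid k.+1)) (block k).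
Proof.
move=> kn; have [pa _] := (H2P T0 cF a).1 Ha.
apply: (measurable_tint_restr cF) => //; [exact: grid_ge0|exact/ltW/grid_lt|].
by apply: grid_leT; rewrite ltnS.
Qed.

(** The first order condition tested with the control equal to [z] during the step [k], which has to
    be known at the start of this step. *)
Lemma block_foc k (z : Om -> R) : (k <= n)%N -> measurable_wrt (F (grid k)) z -> sqint P z ->
  \int[P]_w (z w * block k w) = - gap * \int[P]_w (D w * z w).
Proof.
move=> kn mz sz.
have lr := ltW (grid_lt k); have g0 := grid_ge0 k.
have rT : grid k.+1 <= T by apply: grid_leT; rewrite ltnS.
rewrite /block -(inner_step T0 cF (grid k.+1) g0 mz sz Ha) inner_sym foc; last first.
  exact: (H2_step T0 cF).
rewrite mulNr -RintZ; last exact: sqintM.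
congr (- _); apply: eq_Rintegral => w _.
by rewrite tint_step// gridS addrAC subrr add0r; ring.
Qed.

(** The first order condition tested with the control itself on this step; its energy bounds the
    squared displacement. *)
Lemma block_energy k : (k <= n)%N ->
  \int[P]_w (block k w ^+ 2) <= - gap * \int[P]_w (D w * block k w).
Proof.
move=> kn; have lr := ltW (grid_lt k); have g0 := grid_ge0 k.
have rT : grid k.+1 <= T by apply: grid_leT; rewrite ltnS.
apply: le_trans (tint_restr_sqr_le g0 lr rT) _.
rewrite [X in (X - _) * _]gridS addrAC subrr add0r mulNr -mulrN ler_pM2l ?gap_gt0//.
by rewrite -inner_restr (foc (H2_restr T0 cF (grid k) (grid k.+1) Ha)).
Qed.

Let ED := \int[P]_w (D w ^+ 2).

Let square_step (e x y q : R) : e <= - x * y -> 0 <= q + 2 * x * y + e -> e <= q.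
Proof. by lra. Qed.

(** [block_energy] bounds [E[b^2]] by [- gap E[D b]]; twice this bound, inserted into the expansion
    of [E[(gap D + b)^2] >= 0], eliminates the mixed term. *)
Lemma block_bound k : (k <= n)%N -> \int[P]_w (block k w ^+ 2) <= gap ^+ 2 * ED.
Proof.
move=> kn; have h1 := block_energy kn.
have := Rint_ge0 P (fun w => sqr_ge0 (gap * D w + block k w)).
under eq_Rintegral do rewrite sqrrD.
have sB := sqint_block k.
have sgD : sqint P (fun w => gap * D w) by exact: sqintZ.
have i1 := sqint_intg2 sgD; have i2 := sqintM sgD sB; have i3 := sqint_intg2 sB.
have -> : \int[P]_w ((gap * D w) ^+ 2 + gap * D w * block k w *+ 2 + block k w ^+ 2) =
   gap ^+ 2 * ED + 2 * gap * \int[P]_w (D w * block k w) + \int[P]_w (block k w ^+ 2).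
  have j1 := sqint_intg2 sD; have j2 := sqintM sD sB.
  rewrite -RintZ// -RintZ// -RintD; [|exact: intgZ..].
  rewrite -RintD//; last by apply: intgD; exact: intgZ.
  by apply: eq_Rintegral => w _; ring.
exact: square_step h1.
Qed.

Let monotone_step (e x y z f : R) : e <= - x * y -> z = - x * y ->
  f - 2 * z + e <= f - e.
Proof. by lra. Qed.

(** Testing the step [k + 1] with the displacement of the step [k], and the step [k] with the
    control itself, gives [E[b_k b_(k+1)] >= E[b_k^2]]. *)
Lemma block_monotone k : (k < n)%N ->
  \int[P]_w ((block k.+1 w - block k w) ^+ 2) <=
  \int[P]_w (block k.+1 w ^+ 2) - \int[P]_w (block k w ^+ 2).
Proof.
move=> kn; have h1 := block_energy (ltnW kn).
have := block_foc kn (block_adapted (ltnW kn)) (sqint_block k).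
have s0 := sqint_block k; have s1 := sqint_block k.+1.
have -> : \int[P]_w ((block k.+1 w - block k w) ^+ 2) =
    \int[P]_w (block k.+1 w ^+ 2) - 2 * \int[P]_w (block k w * block k.+1 w) + \int[P]_w (block k w ^+ 2).
  have i1 := sqint_intg2 s1; have i2 := sqintM s0 s1; have i3 := sqint_intg2 s0.
  rewrite -RintZ// -RintB// ?intgZ// -RintD//.
    by apply: eq_Rintegral => w _; ring.
  by apply: intgB => //; exact: intgZ.
exact: monotone_step h1.
Qed.

(** The bounds telescope to the last squared displacement, so that the sum of all [n] terms is of
    the order of a single one, [gap ^+ 2]. *)
Lemma sum_block_increments :
  \sum_(0 <= k < n) \int[P]_w ((block k.+1 w - block k w) ^+ 2) <= gap ^+ 2 * ED.
Proof.
apply: (@le_trans _ _ (\sum_(0 <= k < n)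
    (\int[P]_w (block k.+1 w ^+ 2) - \int[P]_w (block k w ^+ 2)))).
  by rewrite !big_nat; apply: ler_sum => k /andP[_ kn]; exact: block_monotone.
rewrite telescope_sumr//; apply: le_trans (block_bound (leqnn n)).
by rewrite lerBlDr lerDl; apply: Rint_ge0 => w; exact: sqr_ge0.
Qed.

Lemma Rintegral_restr r w : 0 <= r -> r <= T ->
  \int[lebesgue_measure]_(s in `[0, r]) a s w = tint T (restr 0 r a) w.
Proof.
move=> r0 rT; have [pa sa] := (H2P T0 cF a).1 Ha.
rewrite tint_restr// /Rintegral integral_itv_obnd_cbnd//.
have mc : measurable_fun setT (fun s => (tcut T a (s, w))%:E).
  by apply/measurable_EFinP; exact: (meas_pair2 w (sqint_meas sa)).
apply: (eq_measurable_fun (fun s => (tcut T a (s, w))%:E)).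
  by move=> s; rewrite inE/= in_itv/= => /andP[s0 sr]; rewrite /tcut/= (ltW s0) (le_trans sr).
exact: measurable_funTS.
Qed.

Lemma tint_blocks : {ae P, forall w, tint T a w = \sum_(0 <= k < n.+1) block k w}.
Proof.
have key m : (m <= n.+1)%N ->
    {ae P, forall w, tint T (restr 0 (grid m) a) w = \sum_(0 <= k < m) block k w}.
  elim: m => [_|m IH mn].
    apply: aeW => w; rewrite big_geq// grid0 /tint /Rintegral integral0_eq// => s _.
    by rewrite /restr; case: ltP => s0; rewrite ?mul0r// leNgt s0 mul0r.
  have Hl : H2 P T F (restr 0 (grid m) a) by exact: (H2_restr T0 cF).
  have Hr : H2 P T F (restr (grid m) (grid m.+1) a) by exact: (H2_restr T0 cF).
  apply: filterS2 (IH (ltnW mn)) (tint_lin T0 cF 1 Hl Hr) => w e1 e2.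
  rewrite big_nat_recr//= -e1 -[block m w]mul1r -e2; congr (tint T _ w).
  apply/funext => s; apply/funext => v; rewrite /restr mul1r -mulrDl; congr (_ * _).
  have g0 := grid_ge0 m; have g1 := ltW (grid_lt m).
  rewrite -natrD; congr (_%:R).
  have [sm|sm] := leP s (grid m); first by rewrite (le_trans sm g1) !andbT addn0.
  by rewrite (le_lt_trans g0 sm)//.
apply: filterS (key n.+1 (leqnn _)) => w <-.
by rewrite gridn -Rintegral_restr// ltW.
Qed.

End first_order_energy.

(** * Discretised individual noise *)


Section measure_preserving.
Context d1 d2 (T1 : measurableType d1) (T2 : measurableType d2) (R : realType).
Variables (Q : probability T1 R) (P : probability T2 R) (X : T1 -> T2).
Hypothesis mX : measurable_fun setT X.
Hypothesis lX : forall S, measurable S -> Q (X @^-1` S) = P S.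

Lemma pull_integral (h : T2 -> \bar R) : measurable_fun setT h -> (forall x, 0 <= h x)%E ->
  (\int[Q]_z h (X z) = \int[P]_x h x)%E.
Proof.
move=> mh h0.
pose Xm := isMeasurableFun.Build _ _ T1 T2 X mX.
pose Xf : {mfun T1 >-> T2} := HB.pack X Xm.
transitivity (\int[pushforward Q Xf]_x h x)%E.
  have := @ge0_integral_pushforward _ _ T1 T2 R X mX Q setT h measurableT mh.
  by rewrite preimage_setT => ->.
by apply: (@eq_measure_integral _ T2 R setT P (pushforward Q Xf) h) => A mA _; exact: lX.
Qed.

Lemma pull_integral_real (h : T2 -> R) : measurable_fun setT h ->
  (\int[Q]_z (h (X z))%:E = \int[P]_x (h x)%:E)%E.
Proof.
move=> mh; have mEh : measurable_fun setT (EFin \o h) by exact/measurable_EFinP.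
rewrite [LHS]integralE [RHS]integralE; congr (_ - _)%E.
  rewrite -(pull_integral (measurable_funepos mEh) (funepos_ge0 _)).
  by apply: eq_integral => z _; rewrite !funeposE.
rewrite -(pull_integral (measurable_funeneg mEh) (funeneg_ge0 _)).
by apply: eq_integral => z _; rewrite !funenegE.
Qed.

Lemma pull_Rint (h : T2 -> R) : measurable_fun setT h ->
  \int[Q]_z h (X z) = \int[P]_x h x.
Proof. by move=> mh; rewrite /Rintegral pull_integral_real. Qed.

Lemma pull_sqint (h : T2 -> R) : sqint P h -> sqint Q (fun z => h (X z)).
Proof.
move=> [mh h2]; split; first exact: (measurableT_comp mh).
rewrite (pull_integral (h := fun x => (h x ^+ 2)%:E))//.
  by apply/measurable_EFinP; exact: measurable_funX.
by move=> x; rewrite lee_fin sqr_ge0.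
Qed.

Lemma pull_ae (A : T2 -> Prop) : {ae P, forall x, A x} -> {ae Q, forall z, A (X z)}.
Proof.
move=> [B [mB PB sB]]; exists (X @^-1` B); split.
- by rewrite -[X in measurable X]setTI; exact: mX.
- by rewrite lX.
- by move=> z nz; exact: sB.
Qed.

End measure_preserving.

Section coupled_monotonicity.
Context d (U : measurableType d) (R : realType) (Q : probability U R).
Variables (g : R -> P2 R -> R).
Hypotheses (a2 : A2 g) (a4 : A4 g).
Local Notation mR := (measurableTypeR R).

Lemma measurable_dx m : measurable_fun setT ((fun x => dx g x m) : mR -> R).
Proof.
by apply: nondecreasing_measurable => // x y xy; exact: (derive1_mono (fun x y => a2 x y m)).
Qed.

(** Weak monotonicity for the joint law of [X] and [Y], moved back to the space that carries
    them. *)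
Lemma coupled_monotone (X Y : U -> R) (m m' : P2 R) : sqint Q X -> sqint Q Y ->
  has_law Q X m -> has_law Q Y m' ->
  0 <= \int[Q]_z ((dx g (X z) m - dx g (Y z) m') * (X z - Y z)).
Proof.
move=> sX sY lX lY.
have mX := sqint_meas sX; have mY := sqint_meas sY.
have mXY : measurable_fun setT (fun w => (X w, Y w) : (mR * mR)%type).
  by apply: measurable_fun_pair.
pose Zm := isMeasurableFun.Build _ _ U (mR * mR)%type (fun w => (X w, Y w)) mXY.
pose Zf : {mfun U >-> (mR * mR)%type} := HB.pack (fun w => (X w, Y w) : (mR * mR)%type) Zm.
pose gam : probability (mR * mR)%type R := distribution Q Zf.
have cgam : coupling m m' gam.
  move=> C mC; split.
    rewrite lX// -[LHS]/(Q (Zf @^-1` (C `*` setT))); congr (Q _).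
    by apply/seteqP; split => [w []|w].
  rewrite lY// -[LHS]/(Q (Zf @^-1` (setT `*` C))); congr (Q _).
  by apply/seteqP; split => [w []|w].
have mphi : measurable_fun setT
    (fun z : (mR * mR)%type => (dx g z.1 m - dx g z.2 m') * (z.1 - z.2)).
  apply: measurable_funM; apply: measurable_funB.
  - by apply: (measurableT_comp (measurable_dx m)); exact: measurable_fst.
  - by apply: (measurableT_comp (measurable_dx m')); exact: measurable_snd.
  - exact: measurable_fst.
  - exact: measurable_snd.
have := a4 cgam.
rewrite -(@pull_integral_real _ _ _ _ _ Q gam (fun w => (X w, Y w)) mXY _ _ mphi)//.
by move=> h; apply: fine_ge0.
Qed.

End coupled_monotonicity.

Section history.
Context {R : realType} {T : R} {d0} {Omega0 : measurableType d0}.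
Variable G : game T Omega0.
Local Notation Om := (Omega0 * path_space T)%type.
Local Notation PS := (path_space T).
Local Notation P := (prob G).
Local Notation F := (Filt G).
Hypotheses (T0 : 0 < T) (hb : stochastic_basis G).
Variables n res : nat.
Local Notation grid := (grid T n).

Let cF : complete_filtration P T F.
Proof. by case: hb. Qed.

Let gT k : (k <= n.+1)%N -> 0 <= grid k <= T.
Proof. by move=> kn; rewrite grid_ge0// grid_leT. Qed.

Definition cell (x : R) : int := Num.floor (res.+1%:R * x).

Lemma measurable_cell (a : int) : measurable ([set x | cell x = a] : set (measurableTypeR R)).
Proof.
have m1 : measurable_fun setT (fun x : measurableTypeR R => rfloor (res.+1%:R * x)).
  by apply: (measurableT_comp (@measurable_rfloor R)); exact: measurable_funM.
rewrite (_ : [set x | _] = (fun x => rfloor (res.+1%:R * x)) @^-1` [set a%:~R]).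
  by rewrite -[X in measurable X]setTI; exact: m1.
apply/seteqP; split => x; rewrite /cell/= /rfloor; first by move=> ->.
by move=> /intr_inj.
Qed.

Lemma cell_close x y : cell x = cell y -> `|x - y| <= res.+1%:R^-1.
Proof.
have n0 : 0 < res.+1%:R :> R by [].
move=> e; have := rfloor_itv (res.+1%:R * x); have := rfloor_itv (res.+1%:R * y).
rewrite /rfloor -[Num.floor (_ * x)]/(cell x) e -[Num.floor (_ * y)]/(cell y) => h1 h2.
rewrite -(ler_pM2l n0) mulfV ?gt_eqF// -{1}(ger0_norm (ltW n0)) -normrM mulrBr ler_norml.
by apply/andP; split; lra.
Qed.

(* The individual noise is only seen through countably many cells: conditioning
   on a cell is then an adapted operation, which averaging over the common noise
   need not be, because [Filt G t] is not assumed to be a product. *)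
Fixpoint hist k (x : Omega0) : seq int :=
  if k is k'.+1 then cell (W G (grid k) x - W G (grid k') x) :: hist k' x
  else [:: cell (xi0 G x)].

Definition label k x : nat := pickle (hist k x).

Lemma hist_adapted k s : (k <= n.+1)%N -> F (grid k) [set w : Om | hist k w.1 = s].
Proof.
case: hb => _ [_ _ aW _] _ mxi _.
elim: k s => [|k IH] s kn.
  have sF := filtration_sigma cF (gT kn).
  case: s => [|a [|b s]]; rewrite /= ?grid0.
  - rewrite (_ : [set _ | _] = set0); last by apply/seteqP; split.
    by move: sF; rewrite grid0 => sF; exact: sigma_set0.
  - rewrite (_ : [set _ | _] = (fun w : Om => xi0 G w.1) @^-1` [set x | cell x = a]).
      by apply: mxi; exact: measurable_cell.
    by apply/seteqP; split => w /= => [[->]|->].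
  - rewrite (_ : [set _ | _] = set0); last by apply/seteqP; split.
    by move: sF; rewrite grid0 => sF; exact: sigma_set0.
have sF := filtration_sigma cF (gT kn).
case: s => [|a s] /=.
  rewrite (_ : [set _ | _] = set0); last by apply/seteqP; split.
  exact: sigma_set0.
rewrite (_ : [set _ | _] = (fun w : Om => individual_noise G (grid k.+1) w - individual_noise G (grid k) w) @^-1` [set x | cell x = a]
   `&` [set w : Om | hist k w.1 = s]); last first.
  by apply/seteqP; split => w /= => [[-> ->]|[-> ->]].
have g0 := grid_ge0 T0 n k; have g1 := ltW (grid_lt T0 n k).
have g2 : grid k.+1 <= T by apply: grid_leT.
apply: sigma_setI => //; last first.
  by apply: (filtration_mono cF g0 g1 g2); apply: IH; exact: ltnW.
apply: (measurable_wrtB sF); last exact: measurable_cell.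
  by apply: aW; exact: gT.
by apply: (measurable_wrt_mono cF g0 g1 g2); apply: aW; apply: gT; exact: ltnW.
Qed.

Lemma label_adapted k j : (k <= n.+1)%N -> F (grid k) [set w : Om | label k w.1 = j].
Proof.
move=> kn; have [[s e]|no] := pselect (exists s : seq int, pickle s = j).
  rewrite (_ : [set _ | _] = [set w : Om | hist k w.1 = s]); first exact: hist_adapted.
  apply/seteqP; split => w /=; rewrite /label -e; last by move=> ->.
  exact: (pcan_inj (@pickleK _)).
rewrite (_ : [set _ | _] = set0).
  by apply: sigma_set0; exact: (filtration_sigma cF (gT kn)).
by apply/seteqP; split => // w /= e; apply: no; exists (hist k w.1).
Qed.

(** The label is read off the first factor, so its event is the section of a measurable event at any
    path, here the zero path. *)
Lemma measurable_label_fst k j : (k <= n.+1)%N -> measurable [set x | label k x = j].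
Proof.
move=> kn; have := filtration_sub cF (gT kn) (label_adapted j kn) => mA.
rewrite (_ : [set x | _] = (fun x => (x, zero_path T) : Om) @^-1` [set w : Om | label k w.1 = j]).
  rewrite -[X in measurable X]setTI.
  have mp : measurable_fun setT (fun x => (x, zero_path T) : Om).
    by apply: measurable_fun_pair => //; exact: measurable_cst.
  exact: mp.
by apply/seteqP; split.
Qed.

(** The increments of the individual noise after [grid i] are independent of [F (grid i)]; [q] is
    the product of the probabilities that they fall in the cells of [x]. *)
Lemma hist_indep i k x : (i <= k)%N -> (k <= n.+1)%N -> exists q : R,
  forall A, F (grid i) A -> P (A `&` [set w : Om | hist k w.1 = hist k x]) =
    (P (A `&` [set w : Om | hist i w.1 = hist i x]) * q%:E)%E.
Proof.
move=> ik; elim: k ik => [|k IH].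
  by rewrite leqn0 => /eqP -> _; exists 1 => A FA; rewrite mule1.
rewrite leq_eqVlt ltnS => /predU1P[-> _|ik kn].
  by exists 1 => A FA; rewrite mule1.
have [q hq] := IH ik (ltnW kn).
have bW : brownian_motion P T F (individual_noise G) by case: hb.
case: hb => _ [_ _ aW iW] _ _ _.
have g0 := grid_ge0 T0 n k; have g1 := grid_lt T0 n k.
have g2 : grid k.+1 <= T by apply: grid_leT.
set a := cell (W G (grid k.+1) x - W G (grid k) x).
have /= [_ ind] := iW _ _ g0 g1 g2 _ (measurable_cell a).
set I := [set w | _] in ind.
have mI : measurable I.
  have -> : I = (fun w : Om => individual_noise G (grid k.+1) w - individual_noise G (grid k) w) @^-1` [set x | cell x = a] by [].
  rewrite -[X in measurable X]setTI.
  by apply: (increment_meas cF bW g0 (ltW g1) g2) => //; exact: measurable_cell.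
exists (q * fine (P I)) => A FA.
have FAh : F (grid k) (A `&` [set w : Om | hist k w.1 = hist k x]).
  apply: sigma_setI; first by apply: (filtration_sigma cF (gT (ltnW kn))).
    by apply: (filtration_mono cF) FA; [exact: grid_ge0|exact: grid_mono|exact: grid_leT (ltnW kn)].
  by apply: hist_adapted; exact: ltnW.
rewrite EFinM fine_prob// muleA -hq// -ind//; congr (P _).
by apply/seteqP; split => w /= => [[Aw [e1 e2]]|[[Aw e1] e2]]; do ?split => //; rewrite ?e1// e2.
Qed.

Definition path_mean (f : Om -> R) (x : Omega0) : R := \int[Pt G]_v f (x, v).

Lemma sqint_path_mean f : sqint P f -> sqint (P0 G) (path_mean f).
Proof. by move=> /(@sqint_average1 _ _ _ _ _ (P0 G) (Pt G)) []. Qed.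

Lemma path_mean_ind f k j : (k <= n.+1)%N -> sqint P f ->
  \int[P0 G]_x (path_mean f x * ind R (label k) j x) =
  \int[P]_w (f w * ind R (label k) j w.1).
Proof.
move=> kn sf.
have sI := sqint_ind (fun i => measurable_label_fst i kn) (P0 G) j.
under eq_Rintegral do rewrite mulrC.
rewrite (average1M (m1 := P0 G) (m2 := Pt G) sf sI).
by apply: eq_Rintegral => w _; rewrite mulrC.
Qed.

Lemma mass_ind k j : (k <= n.+1)%N ->
  mass (label k) (P0 G) j = \int[P]_w (1 * ind R (label k) j w.1).
Proof.
move=> kn; rewrite -path_mean_ind//; last exact: sqint_cst.
by apply: eq_Rintegral => x _; rewrite /path_mean Rint_cst mul1r.
Qed.

(** Orthogonality passes from the events of [F (grid i)] to the functions measurable for it, with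
    the same factor [q]. *)
Lemma ind_indep i k x : (i <= k)%N -> (k <= n.+1)%N -> exists q : R,
  forall f : Om -> R, sqint P f -> measurable_wrt (F (grid i)) f ->
  \int[P]_w (f w * ind R (label k) (label k x) w.1) =
  q * \int[P]_w (f w * ind R (label i) (label i x) w.1).
Proof.
move=> ik kn; have [q hq] := hist_indep x ik kn; exists q => f sf mf.
have in1 := leq_trans ik kn.
pose e j := ind R (label j) (label j x).
have sI j : (j <= n.+1)%N -> sqint P (fun w : Om => e j w.1).
  move=> jn; apply: sqint_fst; exact: (sqint_ind (fun i => measurable_label_fst i jn)).
have sk := sI _ kn; have si := sI _ in1.
have hE j : [set w : Om | label j w.1 = label j x] = [set w : Om | hist j w.1 = hist j x].
  apply/seteqP; split => w /=; rewrite /label; last by move=> ->.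
  exact: (pcan_inj (@pickleK _)).
have eE j A (w : Om) : \1_A w * e j w.1 = \1_(A `&` [set w : Om | hist j w.1 = hist j x]) w :> R.
  rewrite -hE !indicE /e /ind in_setI -natrM mulnb; congr ((_ && _)%:R).
  by apply/eqP/idP => [h|/set_mem//]; rewrite mem_set.
have mE j : (j <= n.+1)%N -> measurable [set w : Om | hist j w.1 = hist j x].
  by move=> jn; exact: (filtration_sub cF (gT jn) (hist_adapted _ jn)).
have eI j A : (j <= n.+1)%N -> measurable A ->
    \int[P]_(w in A) e j w.1 = fine (P (A `&` [set w : Om | hist j w.1 = hist j x])).
  move=> jn mA; rewrite Rintegral_mkcond /Rintegral -[in RHS](setIT (A `&` _)).
  rewrite -integral_indic//; last by apply: measurableI => //; exact: mE.
  congr fine; apply: eq_integral => w _; rewrite -eE patchE indicE.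
  by case: ifP => _; rewrite ?mul1r ?mul0r.
have : \int[P]_w (f w * (e k w.1 - q * e i w.1)) = 0.
  apply: (Rint_sub_orth (filtration_sigma cF (gT in1)) (filtration_sub cF (gT in1))) => //.
  - by apply: sqint_intg; apply: sqintB => //; exact: sqintZ.
  - move=> A FA; have mA := filtration_sub cF (gT in1) FA.
    have iA (u : Om -> R) : intg P u -> P.-integrable A (EFin \o u).
      by move=> iu; apply: (integrableS measurableT).
    rewrite RintegralB//; [|exact/iA/sqint_intg|by apply: iA; apply: intgZ; exact: sqint_intg].
    rewrite RintegralZl//; last exact/iA/sqint_intg.
    rewrite !eI// hq//.
    have fA : (P (A `&` [set w : Om | hist i w.1 = hist i x])) \is a fin_num.
      by apply: fin_num_measure; apply: measurableI => //; exact: mE.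
    by rewrite fineM//= mulrC subrr.
  - by apply: sqintM => //; apply: sqintB => //; exact: sqintZ.
under eq_Rintegral do rewrite mulrBr mulrCA.
rewrite RintB; [|exact: sqintM|by apply: intgZ; exact: sqintM].
rewrite RintZ; last exact: sqintM.
by move/eqP; rewrite subr_eq0 => /eqP.
Qed.

(** The factor [q] is common to the numerator and to the mass: later noise brings no information on
    a variable known at [grid i]. Hence the mean given the whole history is already a function of
    the history up to [grid i]. *)
Lemma block_mean_indep f i k x : (i <= k)%N -> (k <= n.+1)%N ->
  sqint P f -> measurable_wrt (F (grid i)) f ->
  0 < mass (label k) (P0 G) (label k x) ->
  block_mean (label k) (P0 G) (path_mean f) (label k x) =
  block_mean (label i) (P0 G) (path_mean f) (label i x).
Proof.
move=> ik kn sf mf; have in1 := leq_trans ik kn.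
have [q hq] := ind_indep x ik kn.
have h1 : \int[P]_w (1 * ind R (label k) (label k x) w.1) =
    q * \int[P]_w (1 * ind R (label i) (label i x) w.1).
  apply: (hq (fun=> 1)); first exact: sqint_cst.
  by apply: measurable_wrt_cst; exact: (filtration_sigma cF (gT in1)).
rewrite /block_mean !path_mean_ind// !mass_ind// h1 hq// => m0.
rewrite -mulf_div divff ?mul1r//.
by apply: contraTneq m0 => ->; rewrite mul0r ltxx.
Qed.

Lemma path_mean_adapted f k : (k <= n.+1)%N ->
  measurable_wrt (F (grid k)) (fun w : Om =>
    block_mean (label k) (P0 G) (path_mean f) (label k w.1)).
Proof.
move=> kn; apply: (measurable_wrt_label (h := fun w : Om => label k w.1) (block_mean (label k) (P0 G) (path_mean f))).
  exact: (filtration_sigma cF (gT kn)).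
by move=> j; exact: label_adapted.
Qed.

End history.

(** * The equilibrium without common noise ignores the common noise *)


Section products_of_measure_preserving_maps.
Context (R : realType).

Definition preserving d1 d2 (T1 : measurableType d1) (T2 : measurableType d2)
    (Q : probability T1 R) (P : probability T2 R) (X : T1 -> T2) : Prop :=
  measurable_fun setT X /\ (forall S, measurable S -> Q (X @^-1` S) = P S).

Lemma preserving_integral d1 d2 (T1 : measurableType d1) (T2 : measurableType d2)
    (Q : probability T1 R) (P : probability T2 R) (X : T1 -> T2) :
  measurable_fun setT X ->
  (forall f : T2 -> \bar R, measurable_fun setT f -> (forall x, 0 <= f x)%E ->
    (\int[Q]_z f (X z) = \int[P]_x f x)%E) -> preserving Q P X.
Proof.
move=> mX h; split=> // S mS.
have mI : measurable_fun setT (fun x => (\1_S x)%:E : \bar R) by apply/measurable_EFinP.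
have I0 x : (0 <= (\1_S x)%:E :> \bar R)%E by rewrite lee_fin.
have mXS : measurable (X @^-1` S) by rewrite -[X in measurable X]setTI; exact: mX.
have e : (\int[P]_x (\1_S x)%:E = P S)%E by rewrite integral_indic// setIT.
rewrite -e -(h _ mI I0).
transitivity (Q (X @^-1` S `&` setT)); first by rewrite setIT.
by rewrite -integral_indic.
Qed.

Lemma preserving_pair d1 d2 d3 d4 (T1 : measurableType d1) (T2 : measurableType d2)
    (U1 : measurableType d3) (U2 : measurableType d4)
    (Q1 : probability T1 R) (Q2 : probability T2 R)
    (P1 : probability U1 R) (P2 : probability U2 R) (X1 : T1 -> U1) (X2 : T2 -> U2) :
  preserving Q1 P1 X1 -> preserving Q2 P2 X2 ->
  preserving (pprod Q1 Q2) (pprod P1 P2) (fun z => (X1 z.1, X2 z.2)).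
Proof.
move=> [m1 l1] [m2 l2].
have mX : measurable_fun setT (fun z : T1 * T2 => (X1 z.1, X2 z.2)).
  apply: measurable_fun_pair.
    by apply: (measurableT_comp m1); exact: measurable_fst.
  by apply: (measurableT_comp m2); exact: measurable_snd.
apply: preserving_integral => // f mf f0.
have mF : measurable_fun setT (fun z : T1 * T2 => f (X1 z.1, X2 z.2)) by exact: (measurableT_comp mf).
apply: etrans (fubini_tonelli1 (m1 := Q1) (m2 := Q2) _ mF (fun z => f0 _)) _.
apply: etrans _ (esym (fubini_tonelli1 (m1 := P1) (m2 := P2) _ mf f0)).
rewrite -(pull_integral m1 l1 (h := fubini_F P2 f)).
- apply: eq_integral => x _; rewrite /fubini_F/=.
  apply: (pull_integral m2 l2 (h := fun y => f (X1 x, y))) => //.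
  exact: (measurableT_comp mf (pair1_measurable (X1 x))).
- exact: measurable_fun_fubini_tonelli_F.
- by move=> x; apply: integral_ge0.
Qed.

Lemma preserving_fst d1 d2 (T1 : measurableType d1) (T2 : measurableType d2)
    (P1 : probability T1 R) (P2 : probability T2 R) :
  preserving (pprod P1 P2) P1 fst.
Proof.
split; first exact: measurable_fst.
move=> S mS; rewrite (_ : fst @^-1` S = S `*` setT); last first.
  by apply/seteqP; split => [z|z []].
rewrite [LHS](product_measure1E P1 P2 mS measurableT).
by rewrite [X in (_ * X)%E](@probability_setT _ _ _ P2) mule1.
Qed.

Lemma preserving_snd d1 d2 (T1 : measurableType d1) (T2 : measurableType d2)
    (P1 : probability T1 R) (P2 : probability T2 R) :
  preserving (pprod P1 P2) P2 snd.
Proof.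
split; first exact: measurable_snd.
move=> S mS; rewrite (_ : snd @^-1` S = setT `*` S); last first.
  by apply/seteqP; split => [z|z []].
rewrite [LHS](product_measure1E P1 P2 measurableT mS).
by rewrite [X in (X * _)%E](@probability_setT _ _ _ P1) mul1e.
Qed.

Lemma preserving_swap d (T1 : measurableType d) (P : probability T1 R) :
  preserving (pprod P P) (pprod P P) (@swap T1 T1).
Proof.
have ms : measurable_fun setT (@swap T1 T1) by exact: measurable_swap.
apply: preserving_integral => // f mf f0.
have mF : measurable_fun setT (fun z : T1 * T1 => f (swap z)) by exact: (measurableT_comp mf).
apply: etrans (fubini_tonelli1 (m1 := P) (m2 := P) _ mF (fun z => f0 _)) _.
exact: esym (fubini_tonelli2 (m1 := P) (m2 := P) _ mf f0).
Qed.

End products_of_measure_preserving_maps.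

Section history_close.
Context {R : realType} {T : R} {d0} {Omega0 : measurableType d0}.
Variable G : game T Omega0.
Variables n res : nat.

(** Each time step adds one rounding error, at most the width of a cell. *)
Lemma hist_noise_close k x y : hist G n res k x = hist G n res k y ->
  `|xi0 G x - xi0 G y| <= res.+1%:R^-1 /\
  `|(W G (grid T n k) x - W G (grid T n 0) x) - (W G (grid T n k) y - W G (grid T n 0) y)|
    <= k%:R * res.+1%:R^-1.
Proof.
elim: k => [[]/cell_close h|k IH [/cell_close h1 /IH [h2 h3]]].
  by split => //; rewrite !subrr normr0 mul0r.
split => //; rewrite -natr1 mulrDl mul1r.
set a := W G (grid T n k.+1) x; set a' := W G _ y in h1 *.
set b := W G (grid T n k) x in h1 h3 *; set b' := W G (grid T n k) y in h1 h3 *.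
set c := W G _ x in h3 *; set c' := W G _ y in h3 *.
have -> : a - c - (a' - c') = (b - c - (b' - c')) + (a - b - (a' - b')) by ring.
by apply: le_trans (ler_normD _ _) _; apply: lerD.
Qed.

End history_close.

Section gluing.
Context d (Om0 : measurableType d) (R : realType) (P : probability Om0 R) (h : Om0 -> nat).
Hypothesis mh : forall k, measurable [set x | h x = k].
Variable Q : probability (Om0 * Om0)%type R.
Hypothesis QE : forall f : Om0 * Om0 -> \bar R, measurable_fun setT f -> (forall z, 0 <= f z)%E ->
  (\int[Q]_z f z = \int[pprod P P]_z (f z * (kern h P z.1 z.2)%:E))%E.

Lemma preserving_glue1 : preserving Q P fst.
Proof. by apply: preserving_integral => [|f]; [exact: measurable_fst|exact: (glue_fst mh QE)]. Qed.

Lemma preserving_glue2 : preserving Q P snd.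
Proof. by apply: preserving_integral => [|f]; [exact: measurable_snd|exact: (glue_snd mh QE)]. Qed.

Lemma preserving_glue_swap : preserving Q Q (@swap Om0 Om0).
Proof.
have ms : measurable_fun setT (@swap Om0 Om0) by exact: measurable_swap.
apply: preserving_integral => // f mf f0.
have mF : measurable_fun setT (fun z : Om0 * Om0 => f (swap z)) by exact: (measurableT_comp mf).
rewrite QE// QE//.
have [_ lsw] := preserving_swap P.
have mG : measurable_fun setT (fun z => (f z * (kern h P z.1 z.2)%:E)%E).
  by apply: emeasurable_funM => //; apply/measurable_EFinP; exact: measurable_kern.
have G0 z : (0 <= f z * (kern h P z.1 z.2)%:E)%E by rewrite mule_ge0// lee_fin kern_ge0.
rewrite -(pull_integral ms lsw mG G0); apply: eq_integral => z _ /=.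
by rewrite kern_sym.
Qed.

End gluing.

(** Arithmetic of [sum_squares]: [p] stands for the sum of products, [u] for that of squared
    increments, [v] for the sum of the squares but the last, and [l] for the last one. *)
Lemma energy_step (R : realType) (p u v l q c : R) : p <= c + 4 * q -> u <= 4 * q ->
  v <= 2 * p + u -> l <= 4 * q -> v + l <= 2 * c + 16 * q.
Proof. lra. Qed.

Lemma sqr_sum_le (R : realType) (n : nat) (x : nat -> R) :
  (\sum_(0 <= k < n.+1) x k) ^+ 2 <= n.+1%:R * \sum_(0 <= k < n.+1) x k ^+ 2.
Proof.
elim: n => [|n IH]; first by rewrite !big_nat1 mul1r.
rewrite !(big_nat_recr n.+1)//=; move: IH.
set S := \sum_(0 <= k < n.+1) x k; set S2 := \sum_(0 <= k < n.+1) _; set y := x n.+1.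
set N : R := n.+1%:R => h.
have N0 : 0 < N by [].
have -> : n.+2%:R = N + 1 :> R by rewrite natr1.
have h2 : 2 * (S * y) <= N^-1 * S ^+ 2 + N * y ^+ 2.
  rewrite -subr_ge0 (_ : _ - _ = N * (N^-1 * S - y) ^+ 2); first by rewrite mulr_ge0 ?sqr_ge0 ?ltW.
  by field; rewrite gt_eqF.
have h3 : N^-1 * S ^+ 2 <= S2 by rewrite mulrC ler_pdivrMr// mulrC.
rewrite sqrrD; have -> : S * y *+ 2 = 2 * (S * y) by ring.
have -> : (N + 1) * (S2 + y ^+ 2) = N * S2 + S2 + N * y ^+ 2 + y ^+ 2 by ring.
move: h h2 h3; move: (N * S2) (S * y) (N^-1 * _) (N * _) => u1 u2 u3 u4.
by clear; lra.
Qed.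

Lemma ae_preimage d (U : measurableType d) (R : realType) (mu : probability U R)
    (f1 f2 : U -> R) (C : set R) :
  measurable_fun setT f1 -> measurable_fun setT f2 -> measurable C ->
  {ae mu, forall x, f1 x = f2 x} -> mu (f1 @^-1` C) = mu (f2 @^-1` C).
Proof.
move=> m1 m2 mC e12.
have mp (f : U -> R) : measurable_fun setT f -> measurable (f @^-1` C).
  by move=> mf; rewrite -[X in measurable X]setTI; exact: mf.
have key (f : U -> R) : measurable_fun setT f -> mu (f @^-1` C) = (\int[mu]_x (\1_(f @^-1` C) x)%:E)%E.
  by move=> mf; rewrite integral_indic ?setIT//; exact: mp.
rewrite !key//; apply: ae_eq_integral => //.
- by apply/measurable_EFinP; apply: measurable_indic; exact: mp.
- by apply/measurable_EFinP; apply: measurable_indic; exact: mp.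
apply: filterS e12 => x e _; rewrite !indicE; congr ((_ %:R)%:E); congr nat_of_bool.
by apply/idP/idP => /set_mem h; apply/mem_set; move: h; rewrite /preimage/= e.
Qed.

(** * Two coupled copies of the equilibrium *)

Section uniqueness.
Context {R : realType} {T : R} {d0} {Omega0 : measurableType d0}.
Variable G : game T Omega0.
Local Notation Om := (Omega0 * path_space T)%type.
Local Notation PS := (path_space T).
Local Notation P := (prob G).
Local Notation F := (Filt G).
Local Notation gg := (g G).
Hypotheses (T0 : 0 < T) (hb : stochastic_basis G).
Hypotheses (a2 : A2 gg) (a4 : A4 gg).
Variables (alpha : R -> Om -> R) (D : Om -> R).
Hypotheses (Ha : admissible G alpha) (sD : sqint P D).
Local Notation X := (state G 0 alpha T).
Hypothesis DE : {ae P, forall w, D w = dx gg (X w) (law_of (P0 G) (fun x => X (x, w.2)))}.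
Hypothesis foc : forall c, admissible G c ->
  inner P T0 alpha c = - \int[P]_w (D w * tint T c w).

Let cF : complete_filtration P T F.
Proof. by case: hb. Qed.

Let sX : sqint P X. Proof. exact: sqint_state. Qed.

Local Notation A := (tint T alpha).

Let sA : sqint P A. Proof. exact: (sqint_tint T0 cF Ha). Qed.

Section fixed_scale.
Variables n res : nat.
Local Notation h := (label G n res n.+1).
Local Notation B := (block T alpha n).
Let mh j : measurable [set x | h x = j] := measurable_label_fst T0 hb res j (leqnn n.+1).
Variable Q0 : probability (Omega0 * Omega0)%type R.
Hypothesis QE : forall f : Omega0 * Omega0 -> \bar R, measurable_fun setT f -> (forall z, 0 <= f z)%E ->
  (\int[Q0]_z f z = \int[pprod (P0 G) (P0 G)]_z (f z * (kern h (P0 G) z.1 z.2)%:E))%E.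

(** Two copies of the game whose individual noises visit the same cells up to the horizon and whose
    common noises are independent. *)
Local Notation Z := ((Omega0 * Omega0) * (PS * PS))%type.
Local Notation Q := (pprod Q0 (pprod (Pt G) (Pt G))).
Let p1 (z : Z) : Om := (z.1.1, z.2.1).
Let p2 (z : Z) : Om := (z.1.2, z.2.2).
Let sw (z : Z) : Z := (swap z.1, swap z.2).

Let pr1 : preserving Q P p1.
Proof. exact: (preserving_pair (preserving_glue1 mh QE) (preserving_fst _ _)). Qed.

Let pr2 : preserving Q P p2.
Proof. exact: (preserving_pair (preserving_glue2 mh QE) (preserving_snd _ _)). Qed.

Let prs : preserving Q Q sw.
Proof. exact: (preserving_pair (preserving_glue_swap mh QE) (preserving_swap _)). Qed.

Let s1 f : sqint P f -> sqint Q (fun z => f (p1 z)).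
Proof. by case: pr1 => m l; exact: pull_sqint. Qed.

Let s2 f : sqint P f -> sqint Q (fun z => f (p2 z)).
Proof. by case: pr2 => m l; exact: pull_sqint. Qed.

Let e1 f : measurable_fun setT f -> \int[Q]_z f (p1 z) = \int[P]_w f w.
Proof. by case: pr1 => m l; exact: pull_Rint. Qed.

Let e2 f : measurable_fun setT f -> \int[Q]_z f (p2 z) = \int[P]_w f w.
Proof. by case: pr2 => m l; exact: pull_Rint. Qed.

Let path_product (u v : PS -> R) : sqint (Pt G) u -> sqint (Pt G) v ->
  \int[pprod (Pt G) (Pt G)]_z (u z.1 * v z.2) = (\int[Pt G]_x u x) * (\int[Pt G]_x v x).
Proof.
move=> su sv; have := average1M (sqint_snd (Pt G) sv) su => /= <-.
by rewrite mulrC -RintZ; [under eq_Rintegral do rewrite mulrC|exact: sqint_intg].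
Qed.

(** The common paths are independent, so each factor may be averaged over its own path; the
    individual noises are independent within a block. *)
Let cross f g : sqint P f -> sqint P g ->
  \int[Q]_z (f (p1 z) * g (p2 z)) =
  \int[P0 G]_x (path_mean G f x * block_mean h (P0 G) (path_mean G g) (h x)).
Proof.
move=> sf sg; have sf' := sqint_path_mean sf; have sg' := sqint_path_mean sg.
rewrite -(glue_cond mh QE sf' sg').
have [_ i1 <-] := intg_fubini1 (sqintM (s1 sf) (s2 sg)).
have [m1 l1] := preserving_glue1 mh QE; have [m2 l2] := preserving_glue2 mh QE.
apply: Rint_ae.
- exact: intg_meas i1.
- have sf1 := glue_sqint1 mh QE sf'; have sg2 := glue_sqint2 mh QE sg'.
  exact: intg_meas (sqintM sf1 sg2).
- have ae1 := pull_ae m1 l1 (sqint_section1 (m1 := P0 G) (m2 := Pt G) sf).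
  have ae2 := pull_ae m2 l2 (sqint_section1 (m1 := P0 G) (m2 := Pt G) sg).
  by apply: filterS2 ae1 ae2 => z z1 z2; rewrite (path_product z1 z2).
Qed.

Let cross_sym f g : sqint P f -> sqint P g ->
  \int[Q]_z (f (p2 z) * g (p1 z)) = \int[Q]_z (f (p1 z) * g (p2 z)).
Proof.
move=> sf sg; have [m l] := prs.
have mfg : measurable_fun setT (fun z : Z => f (p1 z) * g (p2 z)).
  by apply: intg_meas; exact: sqintM (s1 sf) (s2 sg).
exact: (pull_Rint m l mfg).
Qed.

(** The mean given the history up to the horizon equals the one given the history up to [grid k],
    which is an admissible test variable at that time. *)
Let cross_adapted f g k : (k <= n.+1)%N -> sqint P f -> sqint P g ->
  measurable_wrt (F (grid T n k)) g ->
  \int[Q]_z (f (p1 z) * g (p2 z)) =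
  \int[P]_w (f w * block_mean (label G n res k) (P0 G) (path_mean G g) (label G n res k w.1)).
Proof.
move=> kn sf sg ag; rewrite cross//.
have mk j := measurable_label_fst T0 hb res j kn.
have sg' := sqint_path_mean sg; have sf' := sqint_path_mean sf.
have sz := sqint_block_mean mk sg'.
have sz' := sqint_block_mean mh sg'.
transitivity (\int[P0 G]_x (path_mean G f x * block_mean (label G n res k) (P0 G) (path_mean G g) (label G n res k x))).
  apply: Rint_ae.
  - by apply: intg_meas; exact: sqintM sf' sz'.
  - by apply: intg_meas; exact: sqintM sf' sz.
  - apply: filterS (ae_mass_gt0 mh (P0 G)) => x m0; congr (_ * _).
    exact: (block_mean_indep T0 hb kn (leqnn _) sg ag m0).
under eq_Rintegral do rewrite mulrC.
rewrite (average1M (m1 := P0 G) (m2 := Pt G) sf sz).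
by apply: eq_Rintegral => w _; rewrite mulrC.
Qed.

Let dif f (z : Z) : R := f (p1 z) - f (p2 z).

Let sqint_dif f : sqint P f -> sqint Q (dif f).
Proof. by move=> sf; apply: sqintB; [exact: s1|exact: s2]. Qed.

Let dif_sqr f : sqint P f -> \int[Q]_z (dif f z ^+ 2) <= 4 * \int[P]_w (f w ^+ 2).
Proof.
move=> sf; have i1 := sqint_intg2 (s1 sf); have i2 := sqint_intg2 (s2 sf).
have m2 : measurable_fun setT (fun w => f w ^+ 2) by exact: measurable_funX (sqint_meas sf).
apply: (@le_trans _ _ (\int[Q]_z (2 * f (p1 z) ^+ 2 + 2 * f (p2 z) ^+ 2))).
  apply: Rint_le => [||z]; first exact/sqint_intg2/sqint_dif.
    by apply: intgD; exact: intgZ.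
  rewrite -subr_ge0 (_ : _ - _ = (f (p1 z) + f (p2 z)) ^+ 2) ?sqr_ge0//.
  by rewrite /dif; ring.
rewrite RintD; [|exact: intgZ..].
by rewrite !RintZ// (e1 m2) (e2 m2) le_eqVlt; apply/orP; left; apply/eqP; ring.
Qed.

Let dif_mul f g : sqint P f -> sqint P g -> \int[Q]_z (dif f z * dif g z) =
  2 * \int[P]_w (f w * g w) - 2 * \int[Q]_z (f (p1 z) * g (p2 z)).
Proof.
move=> sf sg.
have i11 := sqintM (s1 sf) (s1 sg); have i12 := sqintM (s1 sf) (s2 sg).
have i21 := sqintM (s2 sf) (s1 sg); have i22 := sqintM (s2 sf) (s2 sg).
have mfg : measurable_fun setT (fun w => f w * g w) by apply: intg_meas; exact: sqintM sf sg.
have E1 := e1 mfg; have E2 := e2 mfg; have E3 := cross_sym sf sg.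
transitivity (\int[Q]_z ((f (p1 z) * g (p1 z) + f (p2 z) * g (p2 z)) -
    (f (p1 z) * g (p2 z) + f (p2 z) * g (p1 z)))).
  by apply: eq_Rintegral => z _; rewrite /dif; ring.
rewrite RintB; [|exact: intgD..]; rewrite !RintD// E1 E2 E3.
by ring.
Qed.

(** After expansion of the differences, the diagonal terms come from the first order condition on
    the step [k + 1] tested with [B k], the cross terms from the same condition tested with the
    conditional mean of [B k] given the cells. *)
Let consecutive k : (k < n)%N ->
  \int[Q]_z (dif (B k.+1) z * dif (B k) z) = - gap T n * \int[Q]_z (dif D z * dif (B k) z).
Proof.
move=> kn; have kn1 : (k.+1 <= n.+1)%N by rewrite ltnS ltnW.
have sB := sqint_block T0 cF Ha n k; have sB1 := sqint_block T0 cF Ha n k.+1.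
have aB := block_adapted T0 cF Ha (ltnW kn).
rewrite (dif_mul sB1 sB) (dif_mul sD sB) (cross_adapted kn1 sB1 sB aB) (cross_adapted kn1 sD sB aB).
have mk j := measurable_label_fst T0 hb res j kn1.
have sz := sqint_fst (Pt G) (sqint_block_mean mk (sqint_path_mean sB)).
have az := path_mean_adapted T0 hb res (B k) kn1.
have f1 := block_foc cF Ha sD foc kn aB sB.
have f2 := block_foc cF Ha sD foc kn az sz.
under eq_Rintegral do rewrite mulrC; rewrite f1.
under [X in _ - _ * X]eq_Rintegral do rewrite mulrC; rewrite f2.
by ring.
Qed.

(** For two fixed common paths the glued individual noise couples the two conditional laws, to which
    weak monotonicity applies; the paths are then averaged. *)
Let monotone : 0 <= \int[Q]_z (dif D z * dif X z).
Proof.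
have [_ i1 <-] := intg_fubini2 (sqintM (sqint_dif sD) (sqint_dif sX)).
rewrite -[leLHS](Rint_cst (pprod (Pt G) (Pt G))); apply: Rint_ae_le => //; first exact: intg_cst.
pose good (v : PS) := [/\ sqint (P0 G) (fun x => D (x, v)), sqint (P0 G) (fun x => X (x, v)) &
  {ae P0 G, forall x, D (x, v) = dx gg (X (x, v)) (law_of (P0 G) (fun x => X (x, v)))}].
have ae0 : {ae Pt G, forall v, good v}.
  have h1 := sqint_section2 (m1 := P0 G) (m2 := Pt G) sD.
  have h2 := sqint_section2 (m1 := P0 G) (m2 := Pt G) sX.
  have h3 := ae_section2 (m1 := P0 G) (m2 := Pt G) DE.
  by apply: filterS3 h1 h2 h3 => v; split.
apply: filterS2 (ae_fst (Pt G) ae0) (ae_snd (Pt G) ae0) => v [sD1 sX1 D1] [sD2 sX2 D2].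
have [m1 l1] := preserving_glue1 mh QE; have [m2 l2] := preserving_glue2 mh QE.
have tD1 := pull_sqint m1 l1 sD1; have tD2 := pull_sqint m2 l2 sD2.
have tX1 := pull_sqint m1 l1 sX1; have tX2 := pull_sqint m2 l2 sX2.
have aeD1 := pull_ae m1 l1 D1; have aeD2 := pull_ae m2 l2 D2.
set mu1 := law_of _ _ in D1 aeD1; set mu2 := law_of _ _ in D2 aeD2.
have lX1 : has_law Q0 (fun z => X (z.1, v.1)) mu1.
  move=> C mC; rewrite (law_ofP sX1)// -l1// -[X in measurable X]setTI.
  exact: (sqint_meas sX1).
have lX2 : has_law Q0 (fun z => X (z.2, v.2)) mu2.
  move=> C mC; rewrite (law_ofP sX2)// -l2// -[X in measurable X]setTI.
  exact: (sqint_meas sX2).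
apply: le_trans (coupled_monotone a2 a4 tX1 tX2 lX1 lX2) _.
rewrite le_eqVlt; apply/orP; left; apply/eqP; apply: Rint_ae.
- apply: measurable_funM; apply: measurable_funB.
  + by apply: (measurableT_comp (measurable_dx a2 mu1)); exact: sqint_meas tX1.
  + by apply: (measurableT_comp (measurable_dx a2 mu2)); exact: sqint_meas tX2.
  + exact: sqint_meas tX1.
  + exact: sqint_meas tX2.
- by apply: intg_meas; exact: sqintM (sqintB tD1 tD2) (sqintB tX1 tX2).
- by apply: filterS2 aeD1 aeD2 => z h1 h2; rewrite /dif /p1 /p2/= h1 h2.
Qed.

(** Two copies with the same cells have initial states within one cell width of each other, and
    individual noises at [T] within [n.+1] cell widths. *)
Let delta : R := (1 + `|sigma G| * n.+1%:R) / res.+1%:R.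

Let close : {ae Q, forall z, `|dif X z - dif A z| <= delta}.
Proof.
have ae1 := ae_fst (pprod (Pt G) (Pt G)) (glue_label mh QE).
have W0 : {ae P, forall w, individual_noise G 0 w = 0} by case: hb => _ [].
have [m1 l1] := pr1; have [m2 l2] := pr2.
apply: filterS3 ae1 (pull_ae m1 l1 W0) (pull_ae m2 l2 W0) => z.
move=> /(pcan_inj (@pickleK _)) /hist_noise_close[h1 h2] w1 w2.
rewrite /dif !stateE /noise !mul0r !addr0.
rewrite /individual_noise /= in w1 w2 *.
move: h2; rewrite gridn grid0 w1 w2 !subr0 => h2.
move: (A (p1 z)) (A (p2 z)) => u1 u2.
rewrite [X in `|X|](_ : _ = (xi0 G z.1.1 - xi0 G z.1.2) + sigma G * (W G T z.1.1 - W G T z.1.2)); last by ring.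
apply: le_trans (ler_normD _ _) _; rewrite /delta mulrDl mul1r; apply: lerD => //.
by rewrite normrM -mulrA; apply: ler_wpM2l.
Qed.

Let s := Num.sqrt (\int[P]_w (D w ^+ 2)).

Let s0 : 0 <= s. Proof. exact: sqrtr_ge0. Qed.

Let sE : \int[P]_w (D w ^+ 2) = s ^+ 2.
Proof. by rewrite sqr_sqrtr// Rint_ge0// => w; exact: sqr_ge0. Qed.

Let delta_ge0 : 0 <= delta.
Proof. by rewrite divr_ge0// addr_ge0// mulr_ge0. Qed.

Let dif_D : \int[Q]_z (dif D z ^+ 2) <= (2 * s) ^+ 2.
Proof. by apply: le_trans (dif_sqr sD) _; rewrite sE le_eqVlt; apply/orP; left; apply/eqP; ring. Qed.

(** Weak monotonicity speaks of the states; replacing them by the integrated controls costs the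
    mismatch [delta] of the noises. *)
Let dif_A : - (2 * s * delta) <= \int[Q]_z (dif D z * dif A z).
Proof.
have tD := sqint_dif sD; have tX := sqint_dif sX; have tA := sqint_dif sA.
have tE := sqintB tX tA.
have dE : \int[Q]_z ((dif X z - dif A z) ^+ 2) <= delta ^+ 2.
  rewrite -[leRHS](Rint_cst Q); apply: Rint_ae_le; [exact: sqint_intg2|exact: intg_cst|].
  apply: filterS close => z hz.
  by rewrite -real_normK ?num_real// ler_pXn2r ?nnegrE.
have := abs_Rint_le tD tE (mulr_ge0 (ler0n _ 2) s0) delta_ge0 dif_D dE.
rewrite ler_norml => /andP[_]; have -> : \int[Q]_z (dif D z * (dif X z - dif A z)) =
  \int[Q]_z (dif D z * dif X z) - \int[Q]_z (dif D z * dif A z).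
  by rewrite -RintB; [under eq_Rintegral do rewrite mulrBr|exact: sqintM..].
by have := monotone; move: (\int[Q]_z (dif D z * dif X z)) (\int[Q]_z (dif D z * dif A z)) => x y; lra.
Qed.

Let b k := \int[Q]_z (dif (B k) z ^+ 2).

Let difA_sum : {ae Q, forall z, dif A z = \sum_(0 <= k < n.+1) dif (B k) z}.
Proof.
have ae0 := tint_blocks T0 cF Ha n.
have [m1 l1] := pr1; have [m2 l2] := pr2.
apply: filterS2 (pull_ae m1 l1 ae0) (pull_ae m2 l2 ae0) => z h1 h2.
by rewrite /dif h1 h2 -sumrB.
Qed.

Let b_last : b n <= (2 * (gap T n * s)) ^+ 2.
Proof.
have sB := sqint_block T0 cF Ha n n.
apply: le_trans (dif_sqr sB) _.
have := block_bound cF Ha sD foc (leqnn n); rewrite sE => h.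
rewrite (_ : (2 * (gap T n * s)) ^+ 2 = 4 * (gap T n ^+ 2 * s ^+ 2)); last by ring.
by rewrite ler_pM2l.
Qed.

(** Summing [consecutive] produces the displacement over all steps but the last. The full
    displacement is controlled by [dif_A], the missing block by [b_last]. *)
Let sum_products : \sum_(0 <= k < n) \int[Q]_z (dif (B k.+1) z * dif (B k) z) <=
  gap T n * (2 * s * delta) + 4 * (gap T n * s) ^+ 2.
Proof.
have g0 := gap_gt0 T0 n; have tD := sqint_dif sD.
have tB k : sqint Q (dif (B k)) by apply: sqint_dif; exact: (sqint_block T0 cF Ha n k).
have -> : \sum_(0 <= k < n) \int[Q]_z (dif (B k.+1) z * dif (B k) z) =
    - gap T n * (\int[Q]_z (dif D z * dif A z) - \int[Q]_z (dif D z * dif (B n) z)).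
  under eq_big_nat => k /andP[_ kn] do rewrite consecutive//.
  rewrite -mulr_sumr; congr (_ * _); apply/eqP; rewrite eq_sym subr_eq; apply/eqP.
  rewrite -[RHS](big_nat_recr n 0 (fun k => \int[Q]_z (dif D z * dif (B k) z)))//=.
  rewrite -Rint_sum; last by move=> k; exact: sqintM.
  apply: Rint_ae.
  - by apply: intg_meas; exact: sqintM tD (sqint_dif sA).
  - by apply: intg_meas; apply: intg_sum => k; exact: sqintM tD (tB k).
  - by apply: filterS difA_sum => z ->; rewrite mulr_sumr.
have := abs_Rint_le tD (tB n) (mulr_ge0 (ler0n _ 2) s0) (mulr_ge0 (ler0n _ 2) (mulr_ge0 (ltW g0) s0)) dif_D b_last.
rewrite ler_norml => /andP[_ h1]; have h2 := dif_A.
rewrite mulNr -mulrN opprB.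
have -> : gap T n * (2 * s * delta) + 4 * (gap T n * s) ^+ 2 =
  gap T n * (2 * s * (2 * (gap T n * s)) + 2 * s * delta) by ring.
by rewrite ler_pM2l//; apply: lerD => //; rewrite lerNl.
Qed.

(** Each square is at most [b k.+1 + b k], which is twice a product of consecutive differences plus
    the square of their increment; the sums of both are under control. *)
Let sum_squares : \sum_(0 <= k < n.+1) b k <=
  gap T n * (4 * s * delta) + 16 * (gap T n * s) ^+ 2.
Proof.
have tB k : sqint Q (dif (B k)) by apply: sqint_dif; exact: (sqint_block T0 cF Ha n k).
have b0 k : 0 <= b k by apply: Rint_ge0 => z; exact: sqr_ge0.
have h1 := sum_products; have h2 := b_last.
have h3 : \sum_(0 <= k < n) \int[Q]_z ((dif (B k.+1) z - dif (B k) z) ^+ 2) <= 4 * (gap T n * s) ^+ 2.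
  have := sum_block_increments cF Ha sD foc n; rewrite sE -exprMn.
  move=> h; apply: le_trans (ler_wpM2l (ler0n R 4) h).
  rewrite mulr_sumr !big_nat; apply: ler_sum => k _.
  have sB := sqint_block T0 cF Ha n k; have sB1 := sqint_block T0 cF Ha n k.+1.
  apply: le_trans (dif_sqr (sqintB sB1 sB)).
  rewrite le_eqVlt; apply/orP; left; apply/eqP; apply: eq_Rintegral => z _.
  by rewrite /dif; congr (_ ^+ 2); ring.
have h4 : \sum_(0 <= k < n) (b k.+1 + b k) =
    2 * \sum_(0 <= k < n) \int[Q]_z (dif (B k.+1) z * dif (B k) z) +
    \sum_(0 <= k < n) \int[Q]_z ((dif (B k.+1) z - dif (B k) z) ^+ 2).
  rewrite mulr_sumr -big_split/=; apply: eq_bigr => k _.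
  have i1 := sqint_intg2 (tB k); have i2 := sqint_intg2 (tB k.+1).
  have i3 := sqintM (tB k.+1) (tB k); have i4 := sqint_intg2 (sqintB (tB k.+1) (tB k)).
  rewrite /b -RintD// -RintZ// -RintD//; last exact: intgZ.
  by apply: eq_Rintegral => z _; ring.
have h5 : \sum_(0 <= k < n) b k <= \sum_(0 <= k < n) (b k.+1 + b k).
  by apply: ler_sum => k _; have := b0 k.+1; move: (b k.+1) (b k) => u v u0; rewrite lerDr.
rewrite h4 in h5; rewrite (_ : (2 * _) ^+ 2 = 4 * (gap T n * s) ^+ 2) in h2; last by ring.
rewrite big_nat_recr//= (_ : gap T n * (4 * s * delta) = 2 * (gap T n * (2 * s * delta))); last by ring.
exact: energy_step h1 h3 h5 h2.
Qed.

(** Cauchy-Schwarz over the steps costs a factor [n.+1], which one [gap] turns into [T]; the second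
    [gap] remains as [T / n.+1]. *)
Lemma scale_bound : \int[Q]_z (dif A z ^+ 2) <=
  (16 * (T * s) ^+ 2) / n.+1%:R + 4 * T * s * delta.
Proof.
have tB k : sqint Q (dif (B k)) by apply: sqint_dif; exact: (sqint_block T0 cF Ha n k).
have le1 : \int[Q]_z (dif A z ^+ 2) <= n.+1%:R * \sum_(0 <= k < n.+1) b k.
  rewrite /b -Rint_sum; last by move=> k; exact: sqint_intg2.
  rewrite -RintZ; last by apply: intg_sum => k; exact: sqint_intg2.
  apply: Rint_ae_le.
  - exact/sqint_intg2/sqint_dif.
  - by apply: intgZ; apply: intg_sum => k; exact: sqint_intg2.
  by apply: filterS difA_sum => z ->; exact: sqr_sum_le.
apply: le_trans le1 _; apply: le_trans (ler_wpM2l (ler0n _ _) sum_squares) _.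
rewrite le_eqVlt; apply/orP; left; apply/eqP; rewrite /gap; field.
by rewrite addrC natr1 pnatr_eq0.
Qed.

(** The deviation [E] from the mean over the common noise is centred given the individual noise,
    hence orthogonal to that mean and to the second copy; replacing the mean by the second copy can
    only increase the distance. *)
Lemma mean_deviation_le : \int[P]_w ((A w - path_mean G A w.1) ^+ 2) <=
  \int[Q]_z (dif A z ^+ 2).
Proof.
have sm := sqint_path_mean sA.
have sm' : sqint P (fun w => path_mean G A w.1) by exact: sqint_fst.
pose E (w : Om) := A w - path_mean G A w.1.
have sdev : sqint P E by exact: sqintB.
have mE0 : {ae P0 G, forall x, path_mean G E x = 0}.
  apply: filterS (sqint_section1 (m1 := P0 G) (m2 := Pt G) sA) => x sAx.
  rewrite [LHS](@RintB _ _ _ _ (fun v => A (x, v)) (fun=> path_mean G A x)).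
    - by rewrite Rint_cst subrr.
    - exact: sqint_intg sAx.
    - exact: intg_cst.
have null (u : Omega0 -> R) : sqint (P0 G) u -> \int[P0 G]_x (path_mean G E x * u x) = 0.
  move=> su; rewrite -[RHS](Rint_cst (P0 G)); apply: Rint_ae => //.
    by apply: intg_meas; exact: sqintM (sqint_path_mean sdev) su.
  by apply: filterS mE0 => x ->; rewrite mul0r.
have c1 : \int[Q]_z (E (p1 z) * A (p2 z)) = 0.
  by rewrite cross//; apply: null; exact: sqint_block_mean (sqint_path_mean sA).
have c2 : \int[Q]_z (E (p1 z) * path_mean G A (p1 z).1) = 0.
  have mEA : measurable_fun setT (fun w : Om => E w * path_mean G A w.1).
    by apply: intg_meas; exact: sqintM sdev sm'.
  rewrite (e1 mEA); under eq_Rintegral do rewrite mulrC.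
  rewrite -(average1M (m1 := P0 G) (m2 := Pt G) sdev sm).
  by under eq_Rintegral do rewrite mulrC; exact: null.
have mE2 : measurable_fun setT (fun w => E w ^+ 2) by exact: measurable_funX (sqint_meas sdev).
have i1 := sqint_intg2 (s1 sdev); have i2 := sqintM (s1 sdev) (s1 sm').
have i3 := sqintM (s1 sdev) (s2 sA).
have -> : \int[P]_w (E w ^+ 2) = \int[Q]_z (E (p1 z) ^+ 2 + 2 * (E (p1 z) * path_mean G A (p1 z).1 - E (p1 z) * A (p2 z))).
  rewrite RintD//; last by apply: intgZ; exact: intgB.
  rewrite RintZ; last exact: intgB.
  by rewrite RintB// c1 c2 subrr mulr0 addr0 (e1 mE2).
apply: Rint_le => [||z].
- by apply: intgD => //; apply: intgZ; exact: intgB.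
- exact/sqint_intg2/sqint_dif.
- rewrite -subr_ge0 (_ : _ - _ = (path_mean G A (p1 z).1 - A (p2 z)) ^+ 2) ?sqr_ge0//.
  by rewrite /dif /E; ring.
Qed.

End fixed_scale.

Let small (c e : R) : 0 < e -> c / (Num.truncn (2 * c / e)).+1%:R <= e / 2.
Proof.
move=> e0; have := truncnS_gt (2 * c / e); rewrite ltr_pdivrMr// => h.
by rewrite ler_pdivrMr//; set N : R := _.+1%:R in h *; lra.
Qed.

(* [mean_deviation_le] bounds the fluctuation given the first factor by the
   right-hand side of [scale_bound], which vanishes if the time step, and then
   the space step, tend to 0. *)
Lemma tint_common_free : {ae P, forall w, A w = path_mean G A w.1}.
Proof.
have sm' : sqint P (fun w => path_mean G A w.1) by exact: sqint_fst (sqint_path_mean sA).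
set s := Num.sqrt (\int[P]_w (D w ^+ 2)).
suff h : \int[P]_w ((A w - path_mean G A w.1) ^+ 2) <= 0.
  apply: filterS (sqr_Rint_eq0 (sqintB sA sm') h) => w /eqP.
  by rewrite subr_eq0 => /eqP.
apply/ler_addgt0Pl => e e0; rewrite addr0.
pose n := Num.truncn (2 * (16 * (T * s) ^+ 2) / e).
pose res := Num.truncn (2 * (4 * T * s * (1 + `|sigma G| * n.+1%:R)) / e).
have mh j := measurable_label_fst T0 hb res j (leqnn n.+1).
have [Q0 QE] := exists_glue mh (P0 G).
apply: le_trans (mean_deviation_le QE) _; apply: le_trans (scale_bound QE) _.
rewrite -/s [X in _ + X]mulrA.
have h1 := small (16 * (T * s) ^+ 2) e0.
have h2 := small (4 * T * s * (1 + `|sigma G| * n.+1%:R)) e0.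
apply: le_trans (lerD h1 h2) _; by rewrite -splitr.
Qed.

(** By [tint_common_free] the terminal state is almost surely a function of the individual noise
    alone. *)
Lemma terminal_law (m : P2 R) : has_law P X m ->
  {ae P, forall w, has_law (P0 G) (fun x => X (x, w.2)) m}.
Proof.
move=> lX.
(* The common path enters [noise G 0] with the factor 0, so any path may be inserted. *)
pose Y x := noise G 0 (x, zero_path T) + path_mean G A x.
have mN : measurable_fun setT (fun x => noise G 0 (x, zero_path T)).
  exact: (meas_pair2 (zero_path T) (sqint_meas (sqint_noise T0 hb 0))).
have mY : measurable_fun setT Y.
  by apply: measurable_funD => //; exact: sqint_meas (sqint_path_mean sA).
have XY : {ae P, forall w, X w = Y w.1}.
  apply: filterS tint_common_free => w e.
  by rewrite stateE e /Y /noise !mul0r.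
have mX := sqint_meas sX.
have := ae_snd (P0 G) (ae_section2 (m1 := P0 G) (m2 := Pt G) XY).
apply: filterS => w e C mC; rewrite lX//.
rewrite [RHS](ae_preimage (meas_pair2 w.2 mX) mY mC e).
have mYw : measurable_fun setT (fun w : Om => Y w.1).
  by apply: (measurableT_comp mY); exact: measurable_fst.
rewrite (ae_preimage mX mYw mC XY); have [_ l1] := preserving_fst (P0 G) (Pt G).
by rewrite -l1// -[X in measurable X]setTI; exact: mY.
Qed.

End uniqueness.


(** * First order condition of the equilibrium without common noise *)

Section linearised_equilibrium.
Context {R : realType} {T : R} {d0} {Omega0 : measurableType d0}.
Variable G : game T Omega0.
Local Notation Om := (Omega0 * path_space T)%type.
Local Notation PS := (path_space T).
Local Notation P := (prob G).
Local Notation F := (Filt G).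
Local Notation gg := (g G).
Hypotheses (T0 : 0 < T) (hb : stochastic_basis G).
Variable K : R.
Hypotheses (a1 : A1 K gg) (a2 : A2 gg) (a3 : A3 K gg) (a4 : A4 gg).
Hypothesis cwd : cost_well_defined G.

Let cF : complete_filtration P T F.
Proof. by case: hb. Qed.

(** By (A3) two measures at distance zero give the same derivative, so a version of the flow may be
    exchanged for the law of the section of the state. *)
Lemma gain_law eps a b m : 0 <= eps -> admissible G a -> admissible G b ->
  conditional_flow G eps b m ->
  {ae P, forall w, gain G eps m a w =
    dx gg (state G eps a T w) (law_of (P0 G) (fun x => state G eps b T (x, w.2)))}.
Proof.
move=> e0 Ha Hb fm.
have sb := sqint_state T0 hb eps Hb.
have ae2 := ae_snd (P0 G) (sqint_section2 (m1 := P0 G) (m2 := Pt G) sb).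
apply: filterS2 (flow_section T0 hb Hb fm) ae2 => w l1 s1.
have l2 := law_ofP s1; rewrite /gain.
set mu := law_of _ _ in l2 *.
have := a3 (state G eps a T w) (m T w) mu; rewrite (W2_same_law s1 l1 l2) mulr0.
by rewrite normr_le0 subr_eq0 => /eqP.
Qed.

Lemma dx_congr x m m' : W2 m m' = 0 -> dx gg x m = dx gg x m'.
Proof.
move=> e; have := a3 x m m'; rewrite e mulr0 normr_le0 subr_eq0 => /eqP //.
Qed.

Variable alpha : R -> Om -> R.
Hypothesis sol : mfg_solution G 0 alpha.
Local Notation X := (state G 0 alpha T).

Let Ha : admissible G alpha. Proof. by case: sol. Qed.

Let sX : sqint P X. Proof. exact: sqint_state. Qed.

Lemma sqint_state_at t : 0 <= t <= T -> sqint P (state G 0 alpha t).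
Proof.
move=> /[dup] t01 /andP[t0 tT]; case: hb => _ bW bB _ lx.
apply: sqintD; last by apply: sqintZ; exact: (sqint_brownian cF bB t01).
apply: sqintD; last by apply: sqintZ; exact: (sqint_brownian cF bW t01).
apply: sqintD; first exact: L2_sqint.
rewrite (_ : (fun w => _) = tint T (restr 0 t alpha)).
  by apply: (sqint_tint T0 cF); exact: (H2_restr T0 cF).
by apply/funext => w; exact: (Rintegral_restr T0 cF Ha w t0 tT).
Qed.

(* The value outside [[0, T]] is irrelevant. *)
Definition canonical_flow (t : R) : Om -> P2 R :=
  if pselect (0 <= t <= T) is left t01 then flow_law G T0 t01 (state G 0 alpha t)
  else fun=> law_of P (fun=> 0).

(** Optimality in [mfg_solution] is conditional on a version of the flow; this one makes it
    effective. *)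
Lemma canonical_flowP : conditional_flow G 0 alpha canonical_flow.
Proof.
move=> t t01; rewrite /canonical_flow; case: pselect => // t01'.
apply: (cond_law_flow T0 hb t01'); exact: sqint_state_at.
Qed.

Variable m0T : P2 R.
Hypothesis lX : has_law P X m0T.

(** The derivative is obtained at the conditional law of the terminal state, which [terminal_law]
    identifies with [m0T]. *)
Lemma equilibrium_gain : exists D : Om -> R, [/\ sqint P D,
  {ae P, forall w, D w = dx gg (X w) m0T},
  {ae P, forall w, has_law (P0 G) (fun x => X (x, w.2)) m0T} &
  forall c, admissible G c -> inner P T0 alpha c = - \int[P]_w (D w * tint T c w)].
Proof.
have fm := canonical_flowP.
have [D mD DE] := gain_measurable_version T0 hb a1 cwd (lexx 0) Ha fm Ha.
have sD := sqint_gain T0 hb a1 a3 Ha fm Ha mD DE.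
have opt := first_order T0 hb a1 a2 cwd (lexx 0) Ha fm Ha sD DE.
have foc : forall c, admissible G c -> inner P T0 alpha c = - \int[P]_w (D w * tint T c w).
  by apply: opt => c Hc; case: sol => _; apply.
have DE' : {ae P, forall w, D w = dx gg (X w) (law_of (P0 G) (fun x => X (x, w.2)))}.
  by apply: filterS2 DE (gain_law (lexx 0) Ha Ha fm) => w -> ->.
have tl := terminal_law hb a2 a4 Ha sD DE' foc lX.
exists D; split => //.
have ae2 := ae_snd (P0 G) (sqint_section2 (m1 := P0 G) (m2 := Pt G) sX).
apply: filterS3 DE' tl ae2 => w -> l1 s1; apply: dx_congr.
exact: W2_same_law s1 (law_ofP s1) l1.
Qed.

End linearised_equilibrium.

(** * The residual of the linearised equilibrium *)


Section main.
Context {R : realType} {T : R} {d0} {Omega0 : measurableType d0}.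
Variable G : game T Omega0.
Local Notation Om := (Omega0 * path_space T)%type.
Local Notation PS := (path_space T).
Local Notation P := (prob G).
Local Notation F := (Filt G).
Local Notation gg := (g G).
Hypotheses (T0 : 0 < T) (hb : stochastic_basis G).
Variable K : R.
Hypotheses (a1 : A1 K gg) (a2 : A2 gg) (a3 : A3 K gg) (a4 : A4 gg).
Variable dxm : R -> P2 R -> R -> R.
Hypothesis a5 : A5 K gg P dxm.
Hypothesis cwd : cost_well_defined G.
Variables (alpha U V Q Qt : R -> Om -> R) (m0T : P2 R).
Hypothesis sol : mfg_solution G 0 alpha.
Local Notation X := (state G 0 alpha T).
Hypothesis lX : has_law P X m0T.
Hypothesis vf : variational_fbsde G dxm X m0T U V Q Qt.

Let cF : complete_filtration P T F.
Proof. by case: hb. Qed.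

Let T01 : 0 <= T <= T. Proof. by rewrite lexx ltW. Qed.

Let K0 : 0 <= K.
Proof.
by have [_ lip] := a1; apply: (lipschitz_const_ge0 (f := fun x => gg x m0T)) => x y; exact: lip.
Qed.

Let Ha : admissible G alpha. Proof. by case: sol. Qed.
Let HU : admissible G U. Proof. by case: vf => -[]. Qed.
Let HV : admissible G V. Proof. by case: vf => -[]. Qed.

Let sX : sqint P X. Proof. exact: sqint_state. Qed.

Let sV : sqint P (V T).
Proof.
case: hb => _ bW bB _ _; case: vf => _ _ _ [M [N [iM iN VE]]] _.
exact: (sqint_martingale T0 cF bW bB iM iN VE HV T01).
Qed.

Let inner_V c : admissible G c -> inner P T0 V c = \int[P]_w (V T w * tint T c w).
Proof.
case: hb => _ bW bB _ _; case: vf => _ _ _ [M [N [iM iN VE]]] _ Hc.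
exact: (inner_martingale T0 cF bW bB iM iN VE HV Hc).
Qed.

Let UE : {ae P, forall w, U T w = common_noise T w - tint T V w}.
Proof. by case: vf => _ _ /(_ T T01). Qed.

Let sU : sqint P (U T).
Proof.
have [pU _] := (H2P T0 cF U).1 HU.
apply: (sqint_ae _ _ UE); last by apply: sqintB; [exact: sqint_common|exact: (sqint_tint T0 cF)].
exact: (measurable_wrt_meas (filtration_sub cF T01) (progressive_section cF pU T01)).
Qed.

Local Notation beta eps := (fun t w => alpha t w - eps * V t w).

Let betaE eps : beta eps = (fun t w => alpha t w + (- eps) * V t w).
Proof. by apply/funext => t; apply/funext => w; rewrite mulNr. Qed.

Let Hbeta eps : admissible G (beta eps).
Proof. by rewrite betaE; exact: (H2_lin T0 cF (- eps) Ha HV). Qed.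

Let state_beta eps : {ae P, forall w, state G eps (beta eps) T w = X w + eps * U T w}.
Proof.
rewrite betaE; apply: filterS2 (tint_lin T0 cF (- eps) Ha HV) UE => w e1 ->.
by rewrite !stateE e1 /noise; ring.
Qed.

(** Built from [X], [U] and [V] alone, without a version of the flow or of the derivative, so that
    the estimates below hold outside a null set that does not depend on [eps]. *)
Definition residual eps (w : Om) : R :=
  dx gg (X w + eps * U T w) (law_of (P0 G) (fun x => X (x, w.2) + eps * U T (x, w.2)))
  - dx gg (X w) m0T - eps * V T w.

(** Integrals are taken of [De - D - eps * V T], whose measurability is known; [residual] gives its
    values almost surely. *)
Lemma equilibrium_residual D eps m : 0 <= eps -> conditional_flow G eps (beta eps) m ->
  sqint P D -> {ae P, forall w, D w = dx gg (X w) m0T} ->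
  exists De, [/\ sqint P De, {ae P, forall w, De w = gain G eps m (beta eps) w} &
    {ae P, forall w, De w - D w - eps * V T w = residual eps w}].
Proof.
move=> e0 fm sD DE; have Hb := Hbeta eps.
have [De mDe DeE] := gain_measurable_version T0 hb a1 cwd e0 Hb fm Hb.
have sDe := sqint_gain T0 hb a1 a3 Hb fm Hb mDe DeE.
exists De; split => //.
have gE := gain_law T0 hb a3 e0 Hb Hb fm.
have sb := sqint_state T0 hb eps Hb.
have sXU : sqint P (fun w => X w + eps * U T w) by apply: sqintD => //; exact: sqintZ.
have h1 := ae_snd (P0 G) (sqint_section2 (m1 := P0 G) (m2 := Pt G) sb).
have h2 := ae_snd (P0 G) (sqint_section2 (m1 := P0 G) (m2 := Pt G) sXU).
have h3 := ae_snd (P0 G) (ae_section2 (m1 := P0 G) (m2 := Pt G) (state_beta eps)).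
apply: filterS3 (filterI DeE (filterI gE DE)) (filterI h1 h2) (filterI h3 (state_beta eps)).
move=> w [E1 [E2 E3]] [s1 s2] [e1 E4].
have W0 : W2 (law_of (P0 G) (fun x => state G eps (beta eps) T (x, w.2)))
    (law_of (P0 G) (fun x => X (x, w.2) + eps * U T (x, w.2))) = 0.
  apply/eqP; rewrite eq_le W2_ge0 andbT.
  apply: le_trans (W2_le s1 s2 (law_ofP s1) (law_ofP s2)) _.
  rewrite (@Rint_ae _ _ _ (P0 G) _ (fun=> 0)) ?Rint_cst ?sqrtr0//.
    by apply: (@intg_meas _ _ _ (P0 G)); apply: sqint_intg2; exact: sqintB.
  by apply: filterS e1 => x ->; rewrite subrr expr0n.
by rewrite E1 E2 E3 E4 /residual (dx_congr a3 _ W0).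
Qed.

Lemma cost_gap D De eps m b : 0 <= eps -> conditional_flow G eps (beta eps) m ->
  sqint P D -> (forall c, admissible G c -> inner P T0 alpha c = - \int[P]_w (D w * tint T c w)) ->
  sqint P De -> {ae P, forall w, De w = gain G eps m (beta eps) w} ->
  admissible G b ->
  (cost G eps (beta eps) m <=
   cost G eps b m + (T / 2 * \int[P]_w ((De w - D w - eps * V T w) ^+ 2))%:E)%E.
Proof.
move=> e0 fm sD foc sDe DeE Hadm; have Hb := Hbeta eps.
pose c t w := b t w + (-1) * (alpha t w - eps * V t w).
have Hc : admissible G c := H2_lin T0 cF (-1) Hadm Hb.
have := cost_lower T0 hb a1 a2 cwd e0 Hb fm Hb Hc sDe DeE.
have -> : (fun t w => alpha t w - eps * V t w + c t w) = b.
  by apply/funext => t; apply/funext => w; rewrite /c; ring.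
pose rho w := De w - D w - eps * V T w.
have sA := sqint_tint T0 cF Hc.
have srho : sqint P rho.
  by apply: sqintB; [exact: sqintB|exact: sqintZ].
have iE : inner P T0 (beta eps) c = - (\int[P]_w (D w * tint T c w)) - eps * \int[P]_w (V T w * tint T c w).
  rewrite betaE inner_sym (inner_linr T0 cF (- eps) Ha HV Hc).
  rewrite (inner_sym P T0 c alpha) (inner_sym P T0 c V) (foc _ Hc) (inner_V Hc). by rewrite mulNr.
have rE : \int[P]_w (rho w * tint T c w) = \int[P]_w (De w * tint T c w)
    - \int[P]_w (D w * tint T c w) - eps * \int[P]_w (V T w * tint T c w).
  have i1 := sqintM sDe sA; have i2 := sqintM sD sA; have i3 := sqintM sV sA.
  rewrite -RintZ// -RintB// -RintB//; last exact: intgZ.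
    by apply: eq_Rintegral => w _; rewrite /rho; ring.
  exact: intgB.
(* The weight [T] lets the running cost absorb the square of the integrated deviation, through
   [tint_sqr_le]; the factor -1 yields the lower bound. *)
have h1 := Rint_AMGM (sqintZ (-1) srho) sA T0.
have h2 := tint_sqr_le T0 cF Hc.
have key : 0 <= inner P T0 (beta eps) c + inner P T0 c c / 2 + \int[P]_w (De w * tint T c w)
   + T / 2 * \int[P]_w (rho w ^+ 2).
  have e1 : inner P T0 (beta eps) c + \int[P]_w (De w * tint T c w) = \int[P]_w (rho w * tint T c w).
    by rewrite iE rE; ring.
  have e2 : \int[P]_w (-1 * rho w * tint T c w) = - \int[P]_w (rho w * tint T c w).
    under eq_Rintegral do rewrite -mulrA.
    by rewrite RintZ ?mulN1r//; exact: sqintM.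
  have e3 : \int[P]_w ((-1 * rho w) ^+ 2) = \int[P]_w (rho w ^+ 2).
    by apply: eq_Rintegral => w _; rewrite mulN1r sqrrN.
  have h3 : T^-1 * \int[P]_w (tint T c w ^+ 2) <= inner P T0 c c.
    by rewrite mulrC ler_pdivrMr// mulrC.
  rewrite [X in X + _]addrAC e1; rewrite e2 e3 in h1; move: h1 h3.
  move: (\int[P]_w (rho w * _)) (\int[P]_w (rho w ^+ 2)) (inner P T0 c c) => x y z.
  move: (T^-1 * _) => u; lra.
move=> h; rewrite -[X in (_ <= X + _)%E]adde0.
apply: (@le_trans _ _ (cost G eps (beta eps) m + (inner P T0 (beta eps) c + inner P T0 c c / 2 +
    \int[P]_w (De w * tint T c w))%:E + (T / 2 * \int[P]_w (rho w ^+ 2))%:E)%E).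
  by rewrite -addeA -EFinD leeDl// lee_fin.
by rewrite adde0; apply: leeD.
Qed.

(** Bound for the residual divided by [eps]: (A1) for the shift of the state, (A3) for that of its
    law, and the term in [V]. *)
Definition envelope (w : Om) : R :=
  K * `|U T w| + K * Num.sqrt (msec G (U T) w) + `|V T w|.

Lemma sqint_envelope : sqint P envelope.
Proof.
apply: sqintD; last exact: sqint_norm.
by apply: sqintD; apply: sqintZ; [exact: sqint_norm|exact: sqint_msec].
Qed.

Let sections : {ae P, forall w, sqint (P0 G) (fun x => X (x, w.2)) /\ sqint (P0 G) (fun x => U T (x, w.2))}.
Proof.
have h1 := ae_snd (P0 G) (sqint_section2 (m1 := P0 G) (m2 := Pt G) sX).
have h2 := ae_snd (P0 G) (sqint_section2 (m1 := P0 G) (m2 := Pt G) sU).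
by apply: filterS2 h1 h2.
Qed.

Hypothesis tl : {ae P, forall w, has_law (P0 G) (fun x => X (x, w.2)) m0T}.

Let W2_shift eps w : 0 <= eps ->
  sqint (P0 G) (fun x => X (x, w.2)) -> sqint (P0 G) (fun x => U T (x, w.2)) ->
  has_law (P0 G) (fun x => X (x, w.2)) m0T ->
  W2 (law_of (P0 G) (fun x => X (x, w.2) + eps * U T (x, w.2))) m0T
    <= eps * Num.sqrt (msec G (U T) w).
Proof.
move=> e0 s1 s2 l1.
have s3 : sqint (P0 G) (fun x => X (x, w.2) + eps * U T (x, w.2)).
  by apply: sqintD => //; exact: sqintZ.
apply: le_trans (W2_le s3 s1 (law_ofP s3) l1) _.
under eq_Rintegral do rewrite addrAC subrr add0r exprMn.
rewrite RintZ; last exact: sqint_intg2.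
by rewrite sqrtrM ?sqr_ge0// sqrtr_sqr ger0_norm.
Qed.

Lemma residual_bound : {ae P, forall w, forall eps, 0 <= eps ->
  `|residual eps w| <= eps * envelope w}.
Proof.
apply: filterS2 sections tl => w [s1 s2] l1 eps e0.
have h1 := W2_shift e0 s1 s2 l1; have [_ lip] := a1.
set mu := law_of _ _ in h1.
have h2 := lip (X w + eps * U T w) (X w) mu.
have h3 := a3 (X w) mu m0T.
rewrite (addrC (X w)) addrK normrM (ger0_norm e0) in h2.
have h4 := le_trans h3 (ler_wpM2l K0 h1).
rewrite /residual -/mu /envelope.
have -> : dx gg (X w + eps * U T w) mu - dx gg (X w) m0T - eps * V T w =
  (dx gg (eps * U T w + X w) mu - dx gg (X w) mu) + (dx gg (X w) mu - dx gg (X w) m0T) - eps * V T w.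
  by rewrite (addrC (X w)); ring.
apply: le_trans (ler_normB _ _) _; rewrite normrM (ger0_norm e0) mulrDr.
apply: lerD => //; rewrite mulrDr; apply: le_trans (ler_normD _ _) _.
by rewrite ![eps * (K * _)]mulrCA; apply: lerD.
Qed.

(** The shift of the state is treated at the shifted law, by the mean value theorem and the
    continuity of [dxx] in both arguments; the shift of the law is treated at the unshifted state,
    by [measure_derivative_along]. The terminal condition on [V] cancels the linear terms. *)
Lemma residual_small : {ae P, forall w, forall e, 0 < e -> exists2 del, 0 < del &
  forall eps, 0 < eps <= del -> `|residual eps w| <= e * eps}.
Proof.
have VE : {ae P, forall w, V T w = dxx gg (X w) m0T * U T w
   + \int[P0 G]_x (dxm (X w) m0T (X (x, w.2)) * U T (x, w.2))} by case: vf.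
apply: filterS3 sections tl VE => w [s1 s2] l1 VE e e0.
have [d1 _ d3 d4 _] := a5.
have e20 : 0 < e / 2 by rewrite divr_gt0.
have [del del0 hdel] := measure_derivative_along K0 (a3 (X w)) (d4 (X w) m0T) s1 s2 l1 e20.
set u := U T w; set ms := Num.sqrt (msec G (U T) w).
have ms0 : 0 <= ms by exact: sqrtr_ge0.
(* The error of the first part is at most [c * eps ^+ 2], which is below [e / 2 * eps] as soon as
   [(c + 1) * eps <= e / 2]. *)
pose c := K * ((`|u| + ms) * `|u|).
have c0 : 0 <= c by rewrite !mulr_ge0// addr_ge0.
exists (Num.min del (e / 2 / (c + 1))).
  by rewrite lt_min del0 divr_gt0// ltr_wpDl.
move=> eps /andP[eps0]; rewrite le_min => /andP[edel ec].
have eps0' := ltW eps0.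
have h1 := W2_shift eps0' s1 s2 l1.
have s3 : sqint (P0 G) (fun x => X (x, w.2) + eps * U T (x, w.2)).
  by apply: sqintD => //; exact: sqintZ.
have lm := law_ofP s3; rewrite /residual; set mu := law_of _ _ in h1 lm *.
have ed : 0 < eps <= del by rewrite eps0.
have h2 := hdel eps mu ed lm.
have [x xc xE] := mean_value (fun x => d1 x mu) (X w) (X w + eps * u).
have xw : `|x - X w| <= eps * `|u|.
  rewrite -(ger0_norm eps0') -normrM; move: xc.
  rewrite minElt maxElt; case: ltP => uX /andP[x1 x2].
    by rewrite !ger0_norm; move: (X w) (eps * u) x1 x2 uX => *; lra.
  by rewrite !ler0_norm; move: (X w) (eps * u) x1 x2 uX => *; lra.
have h3 := d3 x (X w) mu m0T.
have h4 : `|dxx gg x mu - dxx gg (X w) m0T| <= K * (eps * (`|u| + ms)).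
  apply: le_trans h3 _; apply: ler_wpM2l => //; rewrite mulrDr; exact: lerD.
rewrite VE -/u; set I := \int[P0 G]_y _ in h2 *.
have -> : dx gg (X w + eps * u) mu - dx gg (X w) m0T - eps * (dxx gg (X w) m0T * u + I) =
  (dxx gg x mu - dxx gg (X w) m0T) * (eps * u) + (dx gg (X w) mu - dx gg (X w) m0T - eps * I).
  have -> : dx gg (X w + eps * u) mu = dx gg (X w) mu + dxx gg x mu * (eps * u).
    have xE' : dx gg (X w + eps * u) mu - dx gg (X w) mu = dxx gg x mu * (eps * u).
      by rewrite /dxx [LHS]xE; congr (_ * _); ring.
    by rewrite -xE' [RHS]addrC subrK.
  move: (dx gg (X w) mu) (dx gg (X w) m0T) (dxx gg x mu) (dxx gg (X w) m0T) => *.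
  by ring.
apply: le_trans (ler_normD _ _) _; have -> : e * eps = e / 2 * eps + e / 2 * eps by rewrite -mulrDl -splitr.
apply: lerD => //.
rewrite normrM normrM (ger0_norm eps0').
have h5 : K * (eps * (`|u| + ms)) * (eps * `|u|) <= e / 2 * eps.
  have -> : K * (eps * (`|u| + ms)) * (eps * `|u|) = (eps * c) * eps by rewrite /c; ring.
  rewrite ler_pM2r//; move: ec; rewrite ler_pdivlMr ?ltr_wpDl//; lra.
apply: le_trans h5; apply: ler_wpM2r => //; by rewrite mulr_ge0.
Qed.


Lemma residual_cvg (e : nat -> R) : (forall k, 0 < e k) -> e k @[k --> \oo] --> 0 ->
  {ae P, forall w, (residual (e k) w / e k) ^+ 2 @[k --> \oo] --> 0}.
Proof.
move=> e0 ec; apply: filterS residual_small => w small.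
suff c : residual (e k) w / e k @[k --> \oo] --> 0.
  rewrite (_ : (fun k => _) = fun k => (residual (e k) w / e k) * (residual (e k) w / e k)).
    by rewrite -[X in _ --> X](mulr0 0); exact: cvgM.
  by apply/funext => k; rewrite expr2.
apply/cvgr0Pnorm_le => r r0; have [del del0 hdel] := small _ r0.
have /cvgr0Pnorm_le/(_ _ del0) := ec.
apply: filterS => k; rewrite gtr0_norm// => ek.
have := hdel (e k); rewrite e0 ek => /(_ isT) h.
by rewrite normrM normfV (gtr0_norm (e0 k)) ler_pdivrMr.
Qed.

(** By contradiction along a sequence of failures tending to 0, to which dominated convergence
    applies: the squared quotients of the residuals by [eps] tend to 0 in mean, while each failure
    keeps their mean at least [2 / T]. *)
Lemma small_noise_nash D : sqint P D -> {ae P, forall w, D w = dx gg (X w) m0T} ->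
  (forall c, admissible G c -> inner P T0 alpha c = - \int[P]_w (D w * tint T c w)) ->
  exists2 eps0, 0 < eps0 & forall eps, 0 < eps < eps0 ->
  nash_equilibrium G eps (eps ^+ 2) (beta eps).
Proof.
move=> sD DE foc; apply: contrapT => no.
have ex k : exists e, [/\ 0 < e, e < k.+1%:R^-1 & ~ nash_equilibrium G e (e ^+ 2) (beta e)].
  apply: contrapT => nk; apply: no; exists k.+1%:R^-1; first by rewrite invr_gt0.
  by move=> e /andP[e0 ek]; apply: contrapT => nn; apply: nk; exists e.
have [e he] := choice ex.
have e0 k : 0 < e k by case: (he k).
have ec : e k @[k --> \oo] --> 0.
  apply: (@squeeze_cvgr _ _ _ _ (fun=> 0) (fun k => k.+1%:R^-1)); [|exact: cvg_cst|exact: cvg_harmonic].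
  by apply: nearW => k; case: (he k) => ek0 ek1 _; rewrite !ltW.
(* A smaller second moment would, by [cost_gap], make [beta (e k)] an equilibrium up to
   [e k ^+ 2]. *)
have rex k : exists rho, [/\ sqint P rho, {ae P, forall w, rho w = residual (e k) w} &
    2 / T * e k ^+ 2 <= \int[P]_w (rho w ^+ 2)].
  apply: contrapT => nk; case: (he k) => _ _; apply; split; first exact: Hbeta.
  move=> m fm b Hadm; have ek0 := ltW (e0 k).
  have [De [sDe DeE rE]] := equilibrium_residual ek0 fm sD DE.
  apply: le_trans (cost_gap ek0 fm sD foc sDe DeE Hadm) _.
  apply: leeD => //; rewrite lee_fin leNgt; apply/negP => lt; apply: nk.
  exists (fun w => De w - D w - e k * V T w); split => //.
    by apply: sqintB; [exact: sqintB|exact: sqintZ].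
  rewrite mulrAC ler_pdivrMr//; move: lt.
  by move: (e k ^+ 2) (\int[P]_w _) => x y; lra.
have [rho hrho] := choice rex.
pose f k w := (rho k w / e k) ^+ 2.
have sf k : sqint P (fun w => rho k w / e k).
  rewrite (_ : (fun w => _) = fun w => (e k)^-1 * rho k w); first by apply: sqintZ; case: (hrho k).
  by apply/funext => w; rewrite mulrC.
have lim : \int[P]_w f k w @[k --> \oo] --> 0.
  have [] := @dominated_convergence _ _ R P setT measurableT (fun k w => (f k w)%:E) (fun=> 0%E)
     (fun w => (envelope w ^+ 2)%:E).
  - by move=> k; apply/measurable_EFinP; exact: intg_meas (sqint_intg2 (sf k)).
  - exact: measurable_cst.
  - have aer : {ae P, forall w, forall k, rho k w = residual (e k) w}.
      by apply: ae_foralln => k; case: (hrho k).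
    apply: filterS2 aer (residual_cvg e0 ec) => w rE lim _.
    apply: cvg_EFin; first by apply: nearW.
    rewrite (_ : _ \o _ = fun k => (residual (e k) w / e k) ^+ 2)//.
    by apply/funext => k; rewrite /f/= rE.
  - exact: sqint_intg2 sqint_envelope.
  - have aer : {ae P, forall w, forall k, rho k w = residual (e k) w}.
      by apply: ae_foralln => k; case: (hrho k).
    apply: filterS2 aer residual_bound => w rE hb' k _.
    have := hb' _ (ltW (e0 k)); rewrite -rE -ler_pdivrMl// => h.
    rewrite lee_fin /f ger0_norm ?sqr_ge0// -real_normK ?num_real//.
    have en : 0 <= envelope w by apply: le_trans h; rewrite mulr_ge0// invr_ge0 ltW.
    by rewrite ler_pXn2r ?nnegrE// normrM normfV (gtr0_norm (e0 k)) mulrC.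
  - move=> _ _; rewrite integral0 => /fine_cvg; exact.
have low k : 2 / T <= \int[P]_w f k w.
  have [sr _ h] := hrho k.
  have -> : \int[P]_w f k w = (e k)^-2 * \int[P]_w (rho k w ^+ 2).
    rewrite -RintZ; last exact: sqint_intg2.
    by apply: eq_Rintegral => w _; rewrite /f exprMn exprVn mulrC.
  by rewrite [leRHS]mulrC ler_pdivlMr// exprn_gt0.
have : 2 / T <= 0 by apply: (cvgr_to_ge lim); exact: nearW.
by rewrite leNgt divr_gt0.
Qed.

(** The pointwise bound by the envelope takes the place of the limit and supplies the constant. *)
Lemma approximate_nash D : sqint P D -> {ae P, forall w, D w = dx gg (X w) m0T} ->
  (forall c, admissible G c -> inner P T0 alpha c = - \int[P]_w (D w * tint T c w)) ->
  forall eps, 0 < eps ->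
  nash_equilibrium G eps (T / 2 * \int[P]_w (envelope w ^+ 2) * eps ^+ 2) (beta eps).
Proof.
move=> sD DE foc eps e0; have e0' := ltW e0; split; first exact: Hbeta.
move=> m fm b Hadm.
have [De [sDe DeE rE]] := equilibrium_residual e0' fm sD DE.
apply: le_trans (cost_gap e0' fm sD foc sDe DeE Hadm) _.
apply: leeD => //; rewrite lee_fin -[leRHS]mulrA ler_pM2l ?divr_gt0// mulrC.
have sM := sqint_envelope.
rewrite -RintZ; last exact: sqint_intg2.
apply: Rint_ae_le.
- by apply: sqint_intg2; apply: sqintB; [exact: sqintB|exact: sqintZ].
- by apply: intgZ; exact: sqint_intg2.
apply: filterS2 rE residual_bound => w -> hb'.
have h := hb' _ e0'; rewrite -exprMn -real_normK ?num_real// ler_pXn2r ?nnegrE//.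
exact: le_trans h.
Qed.

End main.

(** [C] is half of [T] times the second moment of the envelope; [eps0] comes from an argument by
    contradiction and is not explicit. Both depend on the data but not on [eps]. *)
Theorem theorem5 (R : realType) (T K : R) (d0 : measure_display)
    (Omega0 : measurableType d0) (G : game T Omega0)
    (dxm : R -> P2 R -> R -> R)
    (alpha0 U V Q Qt : R -> (Omega0 * path_space T)%type -> R)
    (m0 : R -> P2 R) :
  0 < T ->
  stochastic_basis G ->
  A1 K (g G) -> A2 (g G) -> A3 K (g G) -> A4 (g G) ->
  A5 K (g G) (prob G) dxm ->
  cost_well_defined G ->
  mfg_solution G 0 alpha0 ->
  (forall t, 0 <= t <= T -> has_law (prob G) (state G 0 alpha0 t) (m0 t)) ->
  variational_fbsde G dxm (state G 0 alpha0 T) (m0 T) U V Q Qt ->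
  let beta (eps : R) := fun t w => alpha0 t w - eps * V t w in
  exists C eps0 : R, 0 < eps0 /\
    forall eps : R, 0 < eps ->
      nash_equilibrium G eps (C * eps ^+ 2) (beta eps) /\
      (eps < eps0 -> nash_equilibrium G eps (eps ^+ 2) (beta eps)).
Proof.
move=> T0 hb a1 a2 a3 a4 a5 cwd sol laws vf beta.
have lX : has_law (prob G) (state G 0 alpha0 T) (m0 T) by apply: laws; rewrite lexx ltW.
have [D [sD DE tl foc]] := equilibrium_gain T0 hb a1 a2 a3 a4 cwd sol lX.

have [eps0 eps0_gt0 small] := small_noise_nash hb a1 a2 a3 a5 cwd sol vf tl sD DE foc.
exists (T / 2 * \int[prob G]_w (envelope G K U V w ^+ 2)), eps0; split => // eps e0; split.
  exact: (approximate_nash hb a1 a2 a3 cwd sol vf tl sD DE foc).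
by move=> lt; apply: small; rewrite e0.
Qed.
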